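(* Let $1<p<\infty$ be fixed, let $\mathcal R$ be the rearrangement class of some function in $L^p(\mathbb S^2_+)$, and let $\lambda\in\mathbb R$ be fixed. Let $\mathcal M$ be the set of maximizers of $\mathcal E:=E-\lambda I$ over $\mathcal R$. Then $\mathcal M$ is stable under the dynamics of the Euler equation $$\partial_t\omega+J\nabla\mathcal G_+\omega\cdot\nabla\omega=0,\qquad t\in\mathbb R,\ \mathbf x\in\mathbb S^2_+,$$ in the following sense: for any $\epsilon>0$ there exists some $\delta>0$ such that for any sufficiently smooth solution $\omega(t,\mathbf x)$ of this equation it holds that $$\inf_{v\in\mathcal M}\|\omega(0,\cdot)-v\|_{L^p(\mathbb S^2_+)}<\delta\quad\Longrightarrow\quad\inf_{v\in\mathcal M}\|\omega(t,\cdot)-v\|_{L^p(\mathbb S^2_+)}<\epsilon\quad\forall\,t\in\mathbb R.$$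
   Context: $\mathbb S^2=\{\mathbf x\in\mathbb R^3: x_1^2+x_2^2+x_3^2=1\}$ carries the standard metric induced from $\mathbb R^3$; $\sigma$ (also written $|\cdot|$ for sets) is the surface area measure; $\nabla$ is the gradient on $\mathbb S^2$. $\mathbb S^2_+=\{\mathbf x\in\mathbb S^2: x_3>0\}$ is the open northern hemisphere. For $\mathbf p\in T_{\mathbf x}\mathbb S^2$, $J\mathbf p:=\mathbf p\times\mathbf x$. For $\mathbf y=(y_1,y_2,y_3)$ put $\mathbf y'=(y_1,y_2,-y_3)$. The Green operator of $-\Delta$ on $\mathbb S^2_+$ with zero boundary condition is $$\mathcal G_+v(\mathbf x)=\frac1{2\pi}\int_{\mathbb S^2_+}\ln\frac{|\mathbf x-\mathbf y'|}{|\mathbf x-\mathbf y|}\,v(\mathbf y)\,d\sigma_{\mathbf y}.$$ For $v:\mathbb S^2_+\to\mathbb R$: $E(v):=\frac12\int_{\mathbb S^2_+}v\,\mathcal G_+v\,d\sigma$ and $I(v):=\int_{\mathbb S^2_+}x_3v\,d\sigma$. The rearrangement class of a measurable $v:\mathbb S^2_+\to\mathbb R$ is the set $\mathcal R_v$ of all measurable $w:\mathbb S^2_+\to\mathbb R$ with $|\{w>s\}|=|\{v>s\}|$ for all $s\in\mathbb R$. Functions agreeing a.e. are identified. ''Sufficiently smooth solution'' means a solution with $\omega(t,\cdot)\in L^p(\mathbb S^2_+)$ for all $t\in\mathbb R$ that is regular enough for the following conservation laws to hold for all $t\in\mathbb R$: $E(\omega(t,\cdot))=E(\omega(0,\cdot))$,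 $I(\omega(t,\cdot))=I(\omega(0,\cdot))$, and $\omega(t,\cdot)\in\mathcal R_{\omega(0,\cdot)}$. *)

(* Defs.v *)
From HB Require Import structures.
From mathcomp Require Import all_boot all_order all_algebra.
From mathcomp Require Import all_classical all_reals all_analysis.
From mathcomp Require Import measurable_realfun.

Set Implicit Arguments.
Unset Strict Implicit.
Unset Printing Implicit Defensive.

Import Order.TTheory GRing.Theory Num.Theory.
Import numFieldNormedType.Exports.

Local Open Scope classical_set_scope.
Local Open Scope ring_scope.

(* [R3] carries the product topology and the product (Borel) sigma-algebra of
   the library; its library norm is the sup norm, so the Euclidean structure
   used below is introduced separately. *)
Notation R3 R := (R * R * R)%type.

Definition vec3 {R : realType} (a b c : R) : R3 R := (a, b, c).

Definition dot {R : realType} (x y : R3 R) : R :=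
  x.1.1 * y.1.1 + x.1.2 * y.1.2 + x.2 * y.2.

Definition cross {R : realType} (x y : R3 R) : R3 R :=
  vec3 (x.1.2 * y.2 - x.2 * y.1.2)
       (x.2 * y.1.1 - x.1.1 * y.2)
       (x.1.1 * y.1.2 - x.1.2 * y.1.1).

Definition enorm {R : realType} (x : R3 R) : R := Num.sqrt (dot x x).

Definition reflect3 {R : realType} (y : R3 R) : R3 R :=
  vec3 y.1.1 y.1.2 (- y.2).

Definition sphere {R : realType} : set (R3 R) := [set x | enorm x = 1].

Definition hemisphere {R : realType} : set (R3 R) :=
  [set x | sphere x /\ 0 < x.2].

Definition sphpar {R : realType} (u : R * R) : R3 R :=
  vec3 (sin u.1 * cos u.2) (sin u.1 * sin u.2) (cos u.1).

Definition sphdom {R : realType} : set (R * R) := `[0, pi] `*` `[0, pi *+ 2[.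

Lemma measurable_sphdom {R : realType} : measurable (@sphdom R).
Proof. by apply: measurableX; exact: measurable_itv. Qed.

Lemma measurable_sphpar {R : realType} :
  measurable_fun [set: R * R] (@sphpar R).
Proof.
have ms (f : R * R -> R) : measurable_fun setT f ->
    measurable_fun setT (fun u => sin (f u)).
  by move=> mf; apply: (measurableT_comp _ mf);
     apply: continuous_measurable_fun; exact: continuous_sin.
have mc (f : R * R -> R) : measurable_fun setT f ->
    measurable_fun setT (fun u => cos (f u)).
  by move=> mf; apply: (measurableT_comp _ mf);
     apply: continuous_measurable_fun; exact: continuous_cos.
apply: measurable_fun_pair; last by apply: mc; exact: measurable_fst.
apply: measurable_fun_pair; apply: measurable_funM.
- by apply: ms; exact: measurable_fst.
- by apply: mc; exact: measurable_snd.
- by apply: ms; exact: measurable_fst.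
- by apply: ms; exact: measurable_snd.
Qed.

(* Surface area measure of the unit sphere, as a Borel measure on R^3
   concentrated on the sphere: in the parametrisation [sphpar] (colatitude,
   longitude) the area element |d_phi sphpar x d_theta sphpar| is sin phi. *)
Definition area {R : realType} (A : set (R3 R)) : \bar R :=
  (\int[@lebesgue_measure R \x @lebesgue_measure R]_(u in
      sphdom `&` sphpar @^-1` A) (sin u.1)%:E)%E.

Section area_measure.
Context {R : realType}.

Let sin_ge0_dom (u : R * R) : sphdom u -> (0 <= (sin u.1)%:E)%E.
Proof.
move=> [/= + _]; rewrite in_itv/= => hu.
by rewrite lee_fin; apply: sin_ge0_pi.
Qed.

Let area0 : area (@set0 (R3 R)) = 0%E.
Proof. by rewrite /area preimage_set0 setI0 integral_set0. Qed.

Let area_ge0 (A : set (R3 R)) : (0 <= area A)%E.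
Proof. by apply: integral_ge0 => u [/sin_ge0_dom]. Qed.

Let area_sigma_additive : semi_sigma_additive (@area R).
Proof.
move=> F mF tF mUF; rewrite /area preimage_bigcup setI_bigcupr.
rewrite ge0_integral_bigcup//.
- apply: is_cvg_ereal_nneg_natsum_cond => n _ _.
  by apply: integral_ge0 => u [/sin_ge0_dom].
- move=> k; apply: measurableI; first exact: measurable_sphdom.
  by rewrite -[X in measurable X]setTI; exact: measurable_sphpar.
- apply/measurable_EFinP; apply: measurable_funTS.
  apply: (measurableT_comp _ measurable_fst).
  by apply: continuous_measurable_fun; exact: continuous_sin.
- by move=> u [k _ [/sin_ge0_dom]].
- apply/trivIsetP => i j _ _ ij; rewrite setIACA setIid -preimage_setI.
  by move/trivIsetP : tF => /(_ i j I I ij) ->; rewrite preimage_set0 setI0.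
Qed.

HB.instance Definition _ :=
  isMeasure.Build _ _ _ (@area R) area0 area_ge0 area_sigma_additive.

End area_measure.

(* Functions on the hemisphere are represented by functions on R^3, of which
   only the values on [hemisphere] are ever used. *)
Definition greenop {R : realType} (v : R3 R -> R) (x : R3 R) : R :=
  (pi *+ 2)^-1 * \int[@area R]_(y in hemisphere)
    (ln (enorm (x - reflect3 y) / enorm (x - y)) * v y).

Definition energy {R : realType} (v : R3 R -> R) : R :=
  2^-1 * \int[@area R]_(x in hemisphere) (v x * greenop v x).

Definition impulse {R : realType} (v : R3 R -> R) : R :=
  \int[@area R]_(x in hemisphere) (x.2 * v x).

Definition Lpnorm {R : realType} (p : R) (v : R3 R -> R) : \bar R :=
  'N[@area R]_p%:E[EFin \o (v \_ hemisphere)].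

Definition inLp {R : realType} (p : R) (v : R3 R -> R) : Prop :=
  measurable_fun hemisphere v /\ (Lpnorm p v < +oo)%E.

Definition rearrangement {R : realType} (v : R3 R -> R) : set (R3 R -> R) :=
  [set w | measurable_fun hemisphere w /\
    forall s : R, area (hemisphere `&` [set x | s < w x]) =
                  area (hemisphere `&` [set x | s < v x])].

Definition maximizers {R : realType} (F : (R3 R -> R) -> R)
    (C : set (R3 R -> R)) : set (R3 R -> R) :=
  [set v | C v /\ forall w, C w -> F w <= F v].

(* First-order expansion along the sphere: [f] is differentiable at [x] as a
   function on the (open) hemisphere, with gradient the tangent vector [g] for
   the metric induced from R^3. *)
Definition is_sgrad {R : realType} (f : R3 R -> R) (x g : R3 R) : Prop :=
  dot g x = 0 /\
  (f y - f x - dot g (y - x)) / enorm (y - x) @[y --> within hemisphere x^'] --> 0.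

Definition Jrot {R : realType} (x q : R3 R) : R3 R := cross q x.

Definition euler_solution {R : realType} (w : R -> R3 R -> R) : Prop :=
  forall (t : R) (x : R3 R), hemisphere x ->
  exists (dw : R) (g h : R3 R),
    [/\ is_derive t 1 (fun s => w s x) dw,
        is_sgrad (greenop (w t)) x g,
        is_sgrad (w t) x h &
        dw + dot (Jrot x g) h = 0].

Record smooth_solution {R : realType} (p : R) (w : R -> R3 R -> R) : Prop := {
  smooth_solution_euler : euler_solution w ;
  smooth_solution_Lp : forall t, inLp p (w t) ;
  smooth_solution_energy : forall t, energy (w t) = energy (w 0) ;
  smooth_solution_impulse : forall t, impulse (w t) = impulse (w 0) ;
  smooth_solution_rearrangement : forall t, rearrangement (w 0) (w t)
}.

(* Extended-real infimum: the distance to the empty set is +oo. *)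
Definition Lpdist {R : realType} (p : R) (v : R3 R -> R)
    (M : set (R3 R -> R)) : \bar R :=
  ereal_inf [set Lpnorm p (v \- u) | u in M].

(* Main.v *)
(* Suppose that solutions starting closer and closer to [M] are at distance at
   least [eps] from [M] at some times [t_n]. By the conservation laws the
   functions [omega_n(t_n)] are, up to errors tending to 0 in Lp, rearrangements
   that maximize the functional in the limit. It is enough to show that they
   subconverge in Lp to a maximizer.

   Since |x - y|^2 = 2 (1 - x.y) on the sphere, the Taylor series of
   - ln (1 - t) writes the Green kernel as a series of terms c_i e_i(x) e_i(y)
   with c_i >= 0, where the e_i are monomials, odd in x3; in particular the
   energy is a nonnegative quadratic form. After extraction all moments against
   the e_i converge, so that the stream functions converge pointwise to some
   psi. Let w be the rearrangement of v0 that is nondecreasing along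
   psi - lambda x3, ties being broken by the height x3, whose level sets are
   null. The bathtub inequality gives, for v_n = omega_n(t_n),
     F(w) >= F(v_n) + B(w - v_n, w - v_n) / 2 - o(1),
   where F is the functional and B the quadratic form of the energy. Hence w is
   a maximizer and B(w - v_n, w - v_n) tends to 0, so all moments of w - v_n
   tend to 0. The monomials e_i being dense, v_n converges weakly to w, and
   weak convergence together with (asymptotic) equidistribution is strong
   convergence in Lp. *)

Require Import Defs.
From HB Require Import structures.
From mathcomp Require Import all_boot all_order all_algebra.
From mathcomp Require Import all_classical all_reals all_analysis.
From mathcomp Require Import measurable_realfun.
From mathcomp Require Import ring lra zify.

Set Implicit Arguments.
Unset Strict Implicit.
Unset Printing Implicit Defensive.

Import Order.TTheory GRing.Theory Num.Theory.
Import numFieldNormedType.Exports.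

Local Open Scope classical_set_scope.
Local Open Scope ring_scope.

(** * Integrals and Lp classes *)

(** The obstacle is that a solution at time [t_n] is a rearrangement of its own initial value, not
    of [v0]; it need not be a competitor, and its initial value is only close to a maximizer in Lp.
    So equidistribution is used through integrals of Lipschitz functions: those of [omega_n(t_n)]
    equal those of [omega_n(0)] and differ from those of the maximizer by at most a multiple of an
    L1 distance. The bathtub inequality, with a convex primitive, and the strong convergence, with
    the Huber function, are both arranged in this way.

    No weak limit is extracted in Lp: the limit is built from scalar limits alone and is recognised
    as the weak limit only afterwards, because the energy of the difference vanishes.

    The kernel and all truncations of its series need a common integrable bound. The dot products
    are estimated through the difference of heights alone, which spreads the singularity from a
    point to a circle of latitude. A logarithm there is still in every Lq, since slices of the
    sphere have area at most proportional to their thickness. *)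

Section powR_inequalities.
Context {R : realType}.
Implicit Types (a b c p q : R).

(** Bounding the sum by twice the larger term costs the constant [2 ^ p] but covers all [p >= 0]
    without convexity. *)
Lemma powR_norm_leD p a b : 0 <= p ->
  `|a + b| `^ p <= 2 `^ p * (`|a| `^ p + `|b| `^ p).
Proof.
move=> p0.
have key (x y : R) : `|x| <= `|y| ->
    `|x + y| `^ p <= 2 `^ p * (`|x| `^ p + `|y| `^ p).
  move=> xy; apply: (@le_trans _ _ ((2 * `|y|) `^ p)).
    apply: ge0_ler_powR; rewrite ?nnegrE ?mulr_ge0//.
    by rewrite (le_trans (ler_normD _ _))// mulr_natl mulr2n lerD2r.
  by rewrite powRM// ler_wpM2l ?powR_ge0// lerDr powR_ge0.
have [ab|/ltW ba] := leP `|a| `|b|; first exact: key.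
by rewrite addrC [X in _ * X]addrC; exact: key.
Qed.

Lemma powR_norm_leB p a b : 0 <= p ->
  `|a - b| `^ p <= 2 `^ p * (`|a| `^ p + `|b| `^ p).
Proof. by move=> p0; have := @powR_norm_leD p a (- b) p0; rewrite normrN. Qed.

Lemma young_small p q (eta : R) : 0 < p -> 0 < q -> p^-1 + q^-1 = 1 -> 0 < eta ->
  exists2 C, 0 <= C & forall a b, `|a * b| <= eta * `|a| `^ p + C * `|b| `^ q.
Proof.
(* [t] is chosen so that [t ^ p / p = eta]; Young's inequality is then applied to [t |a|] and
   [|b| / t]. *)
move=> p0 q0 pq eta0; pose t := (p * eta) `^ p^-1.
have pe0 : 0 < p * eta by rewrite mulr_gt0.
have t0 : 0 < t by rewrite powR_gt0.
exists (t^-1 `^ q / q); first by rewrite divr_ge0 ?powR_ge0 ?ltW.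
move=> a b; have -> : `|a * b| = (t * `|a|) * (t^-1 * `|b|).
  by rewrite mulrACA divff ?gt_eqF// mul1r normrM.
have tiV : 0 <= t^-1 by rewrite invr_ge0 ltW.
have := @conjugate_powR _ (t * `|a|) (t^-1 * `|b|) p q
  (mulr_ge0 (ltW t0) (normr_ge0 a)) (mulr_ge0 tiV (normr_ge0 b)) p0 q0 pq.
move=> /le_trans; apply.
rewrite !powRM ?(ltW t0)// {1}/t -powRrM mulVf ?gt_eqF// powRr1 ?(ltW pe0)//.
rewrite le_eqVlt; apply/orP; left; apply/eqP.
by field; rewrite !gt_eqF.
Qed.

End powR_inequalities.

Section integration.
Context d (T : measurableType d) (R : realType).
Variable mu : {measure set T -> \bar R}.
Implicit Types (f g u v : T -> R).

Local Notation integ f := (mu.-integrable setT (EFin \o f)).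

Lemma integ_measurable f : integ f -> measurable_fun setT f.
Proof. by move/measurable_int/measurable_EFinP. Qed.

Lemma le_integ f g : measurable_fun setT f -> integ g ->
  (forall x, `|f x| <= g x) -> integ f.
Proof.
move=> mf ig fg; apply: (le_integrable measurableT _ _ ig) => //.
  exact/measurable_EFinP.
by move=> x _ /=; rewrite lee_fin (le_trans (fg x))// ler_norm.
Qed.

Lemma integD f g : integ f -> integ g -> integ (fun x => f x + g x).
Proof. by move=> fi gi; exact: (integrableD measurableT fi gi). Qed.

Lemma integB f g : integ f -> integ g -> integ (fun x => f x - g x).
Proof. by move=> fi gi; exact: (integrableB measurableT fi gi). Qed.

Lemma integZ (k : R) f : integ f -> integ (fun x => k * f x).
Proof. by move=> fi; exact: (integrableZl measurableT k fi). Qed.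

Lemma integ_sum (I : Type) (s : seq I) (f : I -> T -> R) :
  (forall i, integ (f i)) -> integ (fun x => \sum_(i <- s) f i x).
Proof.
move=> fi; have := @integrable_sum _ _ _ mu setT measurableT I s xpredT
  (fun i => EFin \o f i) (fun i _ => fi i).
by apply: eq_integrable => // x _; rewrite /= sumEFin.
Qed.

Lemma Rint_sum (I : Type) (s : seq I) (f : I -> T -> R) :
  (forall i, integ (f i)) ->
  \int[mu]_x (\sum_(i <- s) f i x) = \sum_(i <- s) \int[mu]_x f i x.
Proof.
move=> fi; elim: s => [|i s ih].
  rewrite big_nil; under eq_Rintegral do rewrite big_nil.
  by rewrite Rintegral_cst// mul0r.
rewrite big_cons -ih -RintegralD//; last exact: integ_sum.
by apply: eq_Rintegral => x _; rewrite big_cons.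
Qed.

Lemma le_Rint f g : integ f -> integ g -> (forall x, f x <= g x) ->
  \int[mu]_x f x <= \int[mu]_x g x.
Proof. by move=> fi gi fg; apply: le_Rintegral. Qed.

Lemma le_norm_Rint f g : integ f -> integ g -> (forall x, `|f x| <= g x) ->
  `|\int[mu]_x f x| <= \int[mu]_x g x.
Proof.
move=> fi gi fg; apply: (le_trans (le_normr_Rintegral measurableT fi)).
by apply: le_Rint => //; exact: integrable_norm.
Qed.

Lemma Rint_dominated (f_ : nat -> T -> R) f g :
  (forall n, measurable_fun setT (f_ n)) -> measurable_fun setT f ->
  {ae mu, forall x, f_ n x @[n --> \oo] --> f x} ->
  integ g -> (forall n, {ae mu, forall x, `|f_ n x| <= g x}) ->
  \int[mu]_x f_ n x @[n --> \oo] --> \int[mu]_x f x.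
Proof.
move=> mf_ mf f_f ig f_g.
have mf_E n : measurable_fun setT (EFin \o f_ n) by exact/measurable_EFinP.
have mfE : measurable_fun setT (EFin \o f) by exact/measurable_EFinP.
have cE : {ae mu, forall x, setT x -> (EFin \o f_ n) x @[n --> \oo] --> (EFin \o f) x}.
  by apply: filterS f_f => x fx _; apply/cvg_EFin/fx; exact: nearW.
have bE : {ae mu, forall x n, setT x -> (`|(EFin \o f_ n) x| <= (EFin \o g) x)%E}.
  by apply/ae_foralln => n; apply: filterS (f_g n) => x fx _; rewrite /= lee_fin.
have [fi _ cv] := dominated_convergence measurableT mf_E mfE cE ig bE.
by apply: fine_cvg; rewrite fineK//; exact: integrable_fin_num.
Qed.

End integration.

Section integration_ae.
Context d (T : measurableType d) (R : realType).
Variable mu : {finite_measure set T -> \bar R}.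
Implicit Types (f g u v : T -> R).

Local Notation integ f := (mu.-integrable setT (EFin \o f)).

Lemma integ_bounded f (C : R) : measurable_fun setT f ->
  (forall x, `|f x| <= C) -> integ f.
Proof.
move=> mf fC; apply: (@le_integ _ _ _ _ f (cst C)) => //.
exact: finite_measure_integrable_cst.
Qed.

Lemma le_integ_ae f g : measurable_fun setT f -> integ g ->
  {ae mu, forall x, `|f x| <= g x} -> integ f.
Proof.
move=> mf ig fg; apply/integrableP; split; first exact/measurable_EFinP.
have [mg gy] := integrableP _ _ _ ig.
apply: le_lt_trans gy; apply: ae_ge0_le_integral => //.
- exact: measurableT_comp (measurableT_comp _ mf).
- exact: measurableT_comp.
- by apply: filterS fg => x fgx _ /=; rewrite lee_fin (le_trans fgx)// ler_norm.
Qed.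

Lemma le_Rint_ae f g : integ f -> integ g -> {ae mu, forall x, f x <= g x} ->
  \int[mu]_x f x <= \int[mu]_x g x.
Proof.
move=> fi gi fg; rewrite -subr_ge0 -RintegralB//.
have ie := integB fi gi.
(* The positive part of [g - f] agrees with it almost everywhere and is nonnegative everywhere. *)
rewrite (_ : \int[mu]_x _ = \int[mu]_x (Num.max (g x - f x) 0)).
  by apply: Rintegral_ge0 => x _; rewrite le_max lexx orbT.
have mfg : measurable_fun setT (fun x => g x - f x).
  exact: measurable_funB (integ_measurable gi) (integ_measurable fi).
congr fine; apply: ae_eq_integral => //.
- exact/measurable_EFinP.
- by apply/measurable_EFinP; apply: measurable_maxr => //.
- by apply: filterS fg => x fgx _; rewrite max_l// subr_ge0.
Qed.

End integration_ae.

(** Stated with the [p]-th power, so that the estimates concern real integrals and roots appear only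
    when the norm of the theorem is recovered. *)
Definition Lpfun {d} {T : measurableType d} {R : realType}
    (mu : {measure set T -> \bar R}) (p : R) (f : T -> R) :=
  measurable_fun setT f /\ mu.-integrable setT (EFin \o (fun x => `|f x| `^ p)).

Section Lpfun.
Context d (T : measurableType d) (R : realType).
Variable mu : {finite_measure set T -> \bar R}.
Variables p q : R.
Hypotheses (p0 : 0 < p) (q0 : 0 < q) (pq : p^-1 + q^-1 = 1).
Implicit Types (f g u v : T -> R).

Local Notation integ f := (mu.-integrable setT (EFin \o f)).
Local Notation Lp := (Lpfun mu p).
Local Notation Lq := (Lpfun mu q).

Lemma measurable_norm_powR f (r : R) : measurable_fun setT f ->
  measurable_fun setT (fun x => `|f x| `^ r).
Proof.
move=> mf; apply: (measurableT_comp (measurable_powR r)).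
exact: measurableT_comp.
Qed.

Lemma Lpfun_bounded (r : R) f (C : R) : 0 <= r -> measurable_fun setT f ->
  (forall x, `|f x| <= C) -> Lpfun mu r f.
Proof.
move=> r0 mf fC; split => //.
apply: (@integ_bounded _ _ _ _ _ (C `^ r)); first exact: measurable_norm_powR.
move=> x; rewrite ger0_norm ?powR_ge0//.
by apply: ge0_ler_powR => //; rewrite nnegrE// (le_trans _ (fC x)).
Qed.

Lemma LpfunB f g : Lp f -> Lp g -> Lp (f \- g).
Proof.
move=> [mf fi] [mg gi]; have mfg : measurable_fun setT (f \- g).
  exact: measurable_funB.
split => //; apply: (le_integ _ (integZ (2 `^ p) (integD fi gi))).
  exact: measurable_norm_powR.
by move=> x; rewrite ger0_norm ?powR_ge0// powR_norm_leB// ltW.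
Qed.

Lemma Lpfun_intB_le f g : Lp f -> Lp g ->
  \int[mu]_x (`|f x - g x| `^ p) <=
  2 `^ p * (\int[mu]_x (`|f x| `^ p) + \int[mu]_x (`|g x| `^ p)).
Proof.
move=> Lf Lg; rewrite -RintegralD ?Lf.2 ?Lg.2//.
have iD := integD Lf.2 Lg.2.
rewrite -RintegralZl//; apply: le_Rint => //.
- exact: (LpfunB Lf Lg).2.
- exact: integZ.
- by move=> x; rewrite powR_norm_leB// ltW.
Qed.

Lemma Lpfun_mul g f : Lq g -> Lp f -> integ (fun x => g x * f x).
Proof.
move=> [mg gi] [mf fi].
have [C C0 yC] := young_small p0 q0 pq (@ltr01 R).
apply: (le_integ _ (integD fi (integZ C gi))).
  exact: measurable_funM.
by move=> x; have := yC (f x) (g x); rewrite mulrC mul1r.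
Qed.

Lemma Lpfun_integ f : Lp f -> integ f.
Proof.
move=> Lf; have L1 : Lq (cst 1).
  by apply: (@Lpfun_bounded _ _ 1); rewrite ?ltW// => x; rewrite normr1.
have := Lpfun_mul L1 Lf; apply: eq_integrable => // x _ /=.
by rewrite mul1r.
Qed.

(** An additive substitute for Hoelder's inequality. As [C] depends only on [eta], a [g] vanishing
    in Lq beats an [f] bounded in Lp. *)
Lemma Lpfun_young (eta : R) : 0 < eta -> exists2 C, 0 <= C &
  forall g f, Lq g -> Lp f -> \int[mu]_x `|g x * f x| <=
    eta * \int[mu]_x (`|f x| `^ p) + C * \int[mu]_x (`|g x| `^ q).
Proof.
move=> eta0; have [C C0 yC] := young_small p0 q0 pq eta0.
exists C => // g f Lg Lf.
have iZf := integZ eta Lf.2; have iZg := integZ C Lg.2.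
rewrite -RintegralZl// ?Lf.2// -RintegralZl// ?Lg.2// -RintegralD//.
apply: le_Rint => //.
- exact: (integrable_norm (Lpfun_mul Lg Lf)).
- exact: integD.
- by move=> x; rewrite mulrC.
Qed.

(** Dominated convergence makes [b n] small in Lq, and [Lpfun_young] turns this into smallness
    uniform over a ball of Lp. The uniformity permits testing with functions that depend on [n]. *)
Lemma Lpfun_vanish (b : nat -> T -> R) (kappa : T -> R) :
  (forall n, measurable_fun setT (b n)) -> Lq kappa ->
  (forall n, {ae mu, forall x, `|b n x| <= `|kappa x|}) ->
  {ae mu, forall x, b n x @[n --> \oo] --> 0} ->
  forall C eps : R, 0 < eps ->
  \forall n \near \oo, forall f, Lp f -> \int[mu]_x (`|f x| `^ p) <= C ->
    \int[mu]_x `|b n x * f x| <= eps.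
Proof.
move=> mb Lk bk b0 C eps eps0.
have Lb n : Lq (b n).
  split => //; apply: (le_integ_ae _ Lk.2); first exact: measurable_norm_powR.
  apply: filterS (bk n) => x bx; rewrite ger0_norm ?powR_ge0//.
  by apply: ge0_ler_powR; rewrite ?nnegrE ?(ltW q0).
have Iq : \int[mu]_x (`|b n x| `^ q) @[n --> \oo] --> 0.
  rewrite (_ : 0 = \int[mu]_(x in setT) (cst 0 x)); last first.
    by rewrite Rintegral_cst// mul0r.
  apply: (Rint_dominated _ _ _ Lk.2) => //.
  - by move=> n; exact: measurable_norm_powR.
  - apply: filterS b0 => x bx; apply/cvgrPdist_lt => e e0.
    have e'0 : 0 < e `^ q^-1 by rewrite powR_gt0.
    near=> n; rewrite sub0r normrN ger0_norm ?powR_ge0//.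
    rewrite -[ltRHS]powRr1 ?(ltW e0)// -(mulVf (lt0r_neq0 q0)) powRrM.
    apply: gt0_ltr_powR => //; rewrite ?nnegrE ?powR_ge0//.
    near: n; have /cvgrPdist_lt/(_ _ e'0) := bx.
    by apply: filterS => n; rewrite sub0r normrN.
  - move=> n; apply: filterS (bk n) => x bx; rewrite ger0_norm ?powR_ge0//.
    by apply: ge0_ler_powR; rewrite ?nnegrE ?(ltW q0).
pose eta := eps / 2 / (`|C| + 1).
have C1 : 0 < `|C| + 1 by rewrite ltr_wpDl.
have eta0 : 0 < eta by rewrite !divr_gt0.
have [D D0 yD] := Lpfun_young eta0.
have e2 : 0 < eps / 2 / (D + 1) by rewrite !divr_gt0// ltr_wpDl.
have /cvgrPdist_lt/(_ _ e2) := Iq; apply: filterS => n.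
rewrite sub0r normrN ger0_norm; last by apply: Rintegral_ge0 => x _; exact: powR_ge0.
move=> Ie f Lf fC; apply: (le_trans (yD _ _ (Lb n) Lf)).
have I0 : 0 <= \int[mu]_x (`|b n x| `^ q).
  by apply: Rintegral_ge0 => x _; exact: powR_ge0.
rewrite [leRHS]splitr lerD//.
  apply: (@le_trans _ _ (eta * (`|C| + 1))); last by rewrite /eta divfK ?gt_eqF.
  rewrite ler_wpM2l ?(ltW eta0)// (le_trans fC)// (le_trans (ler_norm _))//.
  by rewrite lerDl.
apply: (@le_trans _ _ ((D + 1) * (eps / 2 / (D + 1)))).
  by apply: ler_pM => //; [rewrite lerDl|exact: ltW].
by rewrite mulrC divfK// gt_eqF// ltr_wpDl.
Unshelve. all: by end_near. Qed.

End Lpfun.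

(** * Equidistributed functions *)

Definition equidist {d} {T : measurableType d} {R : realType}
    (mu : {measure set T -> \bar R}) (v w : T -> R) :=
  forall s, mu [set x | s < v x] = mu [set x | s < w x].

Section equidist.
Context d (T : measurableType d) (R : realType).
Variable mu : {finite_measure set T -> \bar R}.
Implicit Types (f g u v w : T -> R).

Local Notation integ f := (mu.-integrable setT (EFin \o f)).

Lemma equidist_sym v w : equidist mu v w -> equidist mu w v.
Proof. by move=> vw s; rewrite vw. Qed.

Lemma equidist_trans u v w :
  equidist mu u v -> equidist mu v w -> equidist mu u w.
Proof. by move=> uv vw s; rewrite uv vw. Qed.

Lemma measurable_preimage (v : T -> R) (A : set R) :
  measurable_fun setT v -> measurable A -> measurable (v @^-1` A).
Proof. by move=> mv mA; rewrite -[X in measurable X]setTI; exact: mv. Qed.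

(** The half-lines []s, +oo[] are stable under intersection, generate the Borel sets, and countably
    many of them, of finite measure, cover the line; so the two image measures coincide. *)
Lemma equidist_preimage v w : measurable_fun setT v -> measurable_fun setT w ->
  equidist mu v w ->
  forall A, measurable A -> mu (v @^-1` A) = mu (w @^-1` A).
Proof.
move=> mv mw vw A mA.
have GE : @measurable _ R = <<s @RGenOInfty.G R >>.
  exact: RGenOInfty.measurableE.
have := @measure_unique _ R _ (@RGenOInfty.G R)
  (fun n => `]- n%:R, +oo[%classic) GE _ _ _
  (measure_function_pushforward__canonical__measure_function_Measure mu mv)
  (measure_function_pushforward__canonical__measure_function_Measure mu mw)
  _ _ _ mA.
apply.
- move=> _ _ [x ->] [y ->]; exists (Num.max x y).
  apply/seteqP; split => z /=; rewrite !in_itv/= !andbT gt_max.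
    by move=> [-> ->].
  by move=> /andP[].
- by move=> n; exists (- n%:R).
- apply/seteqP; split => // x _.
  exists (Num.truncn `|x|).+1 => //=; rewrite in_itv/= andbT ltrNl.
  by rewrite (le_lt_trans _ (truncnS_gt _))// -normrN ler_norm.
- move=> _ [x ->].
  have E (f : T -> R) : f @^-1` `]x, +oo[ = [set y | x < f y].
    by apply/seteqP; split => y /=; rewrite in_itv/= andbT.
  by rewrite [LHS]/(mu (v @^-1` _)) [RHS]/(mu (w @^-1` _)) !E.
- move=> k; have fk : mu (v @^-1` `]- k%:R, +oo[) \is a fin_num.
    by apply: fin_num_measure; exact: measurable_preimage.
  by move: fk; rewrite fin_numElt => /andP[].
Qed.

Lemma ge0_equidist_integral v w (F : R -> \bar R) :
  measurable_fun setT v -> measurable_fun setT w -> equidist mu v w ->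
  measurable_fun setT F -> (forall t, (0 <= F t)%E) ->
  (\int[mu]_x F (v x) = \int[mu]_x F (w x))%E.
Proof.
move=> mv mw vw mF F0.
transitivity (\int[pushforward mu v]_y F y)%E.
  by rewrite (ge0_integral_pushforward mv).
transitivity (\int[pushforward mu w]_y F y)%E; last first.
  by rewrite (ge0_integral_pushforward mw).
by apply: eq_measure_integral => A mA _; exact: equidist_preimage.
Qed.

Lemma equidist_integ v w (F : R -> R) :
  measurable_fun setT v -> measurable_fun setT w -> equidist mu v w ->
  measurable_fun setT F -> integ (F \o v) -> integ (F \o w).
Proof.
move=> mv mw vw mF /integrableP[_ Fv]; apply/integrableP; split.
  exact/measurable_EFinP/measurableT_comp.
rewrite -(@ge0_equidist_integral v w (fun t => `|(F t)%:E|%E))//.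
by apply: measurableT_comp => //; exact/measurable_EFinP.
Qed.

Lemma equidist_Rint v w (F : R -> R) :
  measurable_fun setT v -> measurable_fun setT w -> equidist mu v w ->
  measurable_fun setT F -> integ (F \o v) ->
  \int[mu]_x F (v x) = \int[mu]_x F (w x).
Proof.
move=> mv mw vw mF iv.
have iw := equidist_integ mv mw vw mF iv.
have mE : measurable_fun setT (EFin \o F) by exact/measurable_EFinP.
congr fine; transitivity (\int[pushforward mu v]_y (F y)%:E)%E.
  by rewrite (integral_pushforward mv mE).
transitivity (\int[pushforward mu w]_y (F y)%:E)%E; last first.
  by rewrite (integral_pushforward mw mE).
by apply: eq_measure_integral => A mA _; exact: equidist_preimage.
Qed.

Lemma equidist_Lpfun p v w : measurable_fun setT w ->
  equidist mu v w -> Lpfun mu p v -> Lpfun mu p w.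
Proof.
move=> mw vw [mv iv]; split => //.
apply: (@equidist_integ v w (fun t => `|t| `^ p)) => //.
exact: measurable_norm_powR.
Qed.

Lemma lipschitz_measurable (F : R -> R) (C : R) :
  (forall a b, `|F a - F b| <= C * `|a - b|) -> measurable_fun setT F.
Proof.
move=> FC; apply: continuous_measurable_fun => x.
apply/(@cvgrPdist_lt _ R) => e e0.
have C1 : 0 < `|C| + 1 by rewrite ltr_wpDl.
near=> y; apply: (le_lt_trans (FC _ _)).
apply: (@le_lt_trans _ _ ((`|C| + 1) * `|x - y|)).
  by rewrite ler_wpM2r// (le_trans (ler_norm _))// lerDl.
rewrite mulrC -ltr_pdivlMr//; near: y.
by apply: (@cvgr_dist_lt _ _ _ _ _ id x cvg_id); rewrite divr_gt0.
Unshelve. all: by end_near. Qed.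

Lemma lipschitz_integ (F : R -> R) (C : R) v :
  (forall a b, `|F a - F b| <= C * `|a - b|) -> integ v -> integ (F \o v).
Proof.
move=> FC iv.
have i1 : integ (fun x => `|F 0| + C * `|v x|).
  apply: (@integD _ _ _ _ (cst `|F 0|) (fun x => C * `|v x|)).
    exact: finite_measure_integrable_cst.
  by apply: integZ; exact: (integrable_norm iv).
apply: (le_integ _ i1).
  exact: measurableT_comp (lipschitz_measurable FC) (integ_measurable iv).
move=> x /=; rewrite -[F (v x)](subrK (F 0)) addrC.
by rewrite (le_trans (ler_normD _ _))// lerD2l (le_trans (FC _ _))// subr0.
Qed.

(** Passing to equidistributed copies changes neither integral, and the copies may be close in L1
    even when [v] and [w] are not. *)
Lemma equidist_lipschitz_le (F : R -> R) (C : R) v v0 w w0 :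
  (forall a b, `|F a - F b| <= C * `|a - b|) ->
  integ v -> integ v0 -> integ w -> integ w0 ->
  equidist mu v v0 -> equidist mu w w0 ->
  `|\int[mu]_x F (v x) - \int[mu]_x F (w x)| <= C * \int[mu]_x `|v0 x - w0 x|.
Proof.
move=> FC iv iv0 iw iw0 vv0 ww0.
have mF := lipschitz_measurable FC.
rewrite (equidist_Rint _ _ vv0)//; last first.
- exact: lipschitz_integ iv.
- exact: integ_measurable iv0.
- exact: integ_measurable iv.
rewrite (equidist_Rint _ _ ww0)//; last first.
- exact: lipschitz_integ iw.
- exact: integ_measurable iw0.
- exact: integ_measurable iw.
have iFv := lipschitz_integ FC iv0; have iFw := lipschitz_integ FC iw0.
rewrite -RintegralB// -RintegralZl//; last first.
  exact: (integrable_norm (integB iv0 iw0)).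
apply: le_norm_Rint => //; first exact: integB.
by apply: integZ; exact: (integrable_norm (integB iv0 iw0)).
Qed.

End equidist.

(** * Monotone rearrangement along a given function *)

Section finite_measure_lemmas.
Context d (T : measurableType d) (R : realType).
Variable mu : {finite_measure set T -> \bar R}.
Implicit Types A B : set T.

Lemma finite_measureD A B : measurable A -> measurable B ->
  mu (A `\` B) = (mu A - mu (A `&` B))%E.
Proof. by move=> mA mB; rewrite measureD// ltey_eq fin_num_measure. Qed.

Lemma measureD0 A B : measurable A -> measurable B -> mu B = 0%E ->
  mu (A `\` B) = mu A.
Proof.
move=> mA mB B0; rewrite finite_measureD// (_ : mu (A `&` B) = 0%E) ?sube0//.
by apply: (@subset_measure0 _ _ _ _ _ B) => //; exact: measurableI.
Qed.

Lemma le_measure_diff0 A B : measurable A -> measurable B ->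
  mu (A `\` B) = 0%E -> (mu A <= mu B)%E.
Proof.
move=> mA mB AB0; have mAB : measurable (A `\` B) by exact: measurableD.
rewrite -(measureU0 mB mAB AB0); apply: le_measure; rewrite ?inE//.
  exact: measurableU.
by move=> x Ax; have [Bx|nBx] := pselect (B x); [left|right].
Qed.

End finite_measure_lemmas.

(** * Rank function of a strict order with null ties *)

Section rank.
Context d (T : measurableType d) (R : realType).
Variable mu : {finite_measure set T -> \bar R}.
Variable lt : T -> T -> Prop.
Hypothesis lt_trans : forall y x z, lt x y -> lt y z -> lt x z.
Hypothesis lt_asym : forall x y, lt x y -> ~ lt y x.
Hypothesis mlt : measurable [set z : T * T | lt z.2 z.1].
Hypothesis tie0 : forall x, mu [set y | ~ lt x y /\ ~ lt y x] = 0%E.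

Let below V x := V `&` [set y | lt y x].

Lemma measurable_rank_below V x : measurable V -> measurable (below V x).
Proof.
move=> mV; apply: measurableI => //.
have := measurable_xsection x mlt.
by congr measurable; apply/seteqP; split => y /=; rewrite /xsection/= inE.
Qed.

Lemma measurable_rank_above y : measurable [set x | lt y x].
Proof.
have := measurable_ysection y mlt.
by congr measurable; apply/seteqP; split => x /=; rewrite /ysection/= inE.
Qed.

Lemma measurable_rank_set x : measurable [set y | lt y x].
Proof.
by have := measurable_rank_below x measurableT; rewrite /below setTI.
Qed.

Lemma measurable_tie x : measurable [set y | ~ lt x y /\ ~ lt y x].
Proof.
rewrite (_ : [set y | _] = ~` [set y | lt x y] `&` ~` [set y | lt y x])//.
by apply: measurableI; apply: measurableC;
  [exact: measurable_rank_above|exact: measurable_rank_set].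
Qed.

(* If all initial segments of [V] have the same measure [a], then by symmetry
   (Fubini) so do all final segments, up to the null ties. *)
Lemma constant_below_half V (a : R) : measurable V ->
  (forall x, V x -> mu (below V x) = a%:E) ->
  fine (mu V) = 0 \/ a + a = fine (mu V).
Proof.
move=> mV Va; set m := fine (mu V).
have muV : mu V = m%:E by rewrite fineK// fin_num_measure.
pose S : set (T * T) := [set z | lt z.2 z.1] `&` (V `*` V).
have mS : measurable S by apply: measurableI => //; exact: measurableX.
have := @indic_fubini_tonelli _ _ _ _ R mu mu S mS.
rewrite indic_fubini_tonelli_FE// indic_fubini_tonelli_GE//.
have -> : (\int[mu]_x (mu \o xsection S) x = (a * m)%:E)%E.
  rewrite (eq_integral (fun x => a%:E * (\1_V x)%:E))%E; last first.
    move=> x _ /=; rewrite indicE; have [xV|xV] := boolP (x \in V).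
      rewrite mule1 -(Va x) ?inE//; last by rewrite inE in xV.
      congr (mu _); apply/seteqP; split => y; rewrite /xsection/= inE /S/=.
        by move=> [? [_ ?]].
      by move=> [? ?]; rewrite inE in xV.
    rewrite mule0 (_ : xsection S x = set0) ?measure0//.
    apply/seteqP; split => y //; rewrite /xsection/= inE /S/= => -[_ [Vx _]].
    by rewrite notin_setE in xV.
  rewrite integralZl//; last exact: integrable_indic.
  rewrite integral_indic// setIT.
  exact: (congr1 (fun z => a%:E * z)%E muV).
have -> : (\int[mu]_x (mu \o ysection S) x = ((m - a) * m)%:E)%E.
  rewrite (eq_integral (fun x => (m - a)%:E * (\1_V x)%:E))%E; last first.
    move=> x _ /=; rewrite indicE; have [xV|xV] := boolP (x \in V).
      rewrite inE in xV; rewrite mule1.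
      have -> : ysection S x = (V `\` below V x) `\` [set y | ~ lt x y /\ ~ lt y x].
        apply/seteqP; split => y; rewrite /ysection/= inE /S/=.
          move=> [xy [Vy _]]; split; last by move=> -[].
          by split => // -[_ /=]; exact: lt_asym.
        move=> [[Vy nyx] /not_andP[/contrapT ?|/contrapT yx]] //.
        by exfalso; apply: nyx; split.
      have mb := measurable_rank_below x mV.
      rewrite measureD0//.
      - rewrite finite_measureD// setIidr; last exact: subIsetl.
        by rewrite Va// muV.
      - exact: measurableD.
      - exact: measurable_tie.
    rewrite mule0 (_ : ysection S x = set0) ?measure0//.
    apply/seteqP; split => y //; rewrite /ysection/= inE /S/= => -[_ [_ Vx]].
    by rewrite notin_setE in xV.
  rewrite integralZl//; last exact: integrable_indic.
  rewrite integral_indic// setIT.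
  exact: (congr1 (fun z => (m - a)%:E * z)%E muV).
move=> [] /eqP; rewrite -subr_eq0 -mulrBl mulf_eq0 => /orP[|/eqP]; last by left.
by rewrite opprB addrA subr_eq0 => /eqP ->; right.
Qed.

Definition rank x : R := fine (mu [set y | lt y x]).

Lemma rankE x : mu [set y | lt y x] = (rank x)%:E.
Proof. by rewrite fineK// fin_num_measure//; exact: measurable_rank_set. Qed.

Lemma measurable_rank : measurable_fun setT rank.
Proof.
have -> : rank = fine \o (mu \o xsection [set z : T * T | lt z.2 z.1]).
  apply/funext => x /=; congr (fine (mu _)).
  by apply/seteqP; split => y /=; rewrite /xsection/= inE.
apply: measurableT_comp => //; exact: measurable_fun_xsection.
Qed.

Lemma rank_le x y : lt x y -> rank x <= rank y.
Proof.
move=> xy; rewrite -lee_fin -!rankE; apply: le_measure; rewrite ?inE.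
- exact: measurable_rank_set.
- exact: measurable_rank_set.
- by move=> z /= zx; exact: lt_trans xy.
Qed.

Lemma rank_ge0 x : 0 <= rank x.
Proof. by rewrite fine_ge0. Qed.

Lemma rank_ub x : rank x <= fine (mu setT).
Proof.
rewrite -lee_fin -rankE fineK ?fin_num_measure//.
by apply: le_measure; rewrite ?inE//; exact: measurable_rank_set.
Qed.

(** Over a level set [V] the initial segments of the order differ by null sets, so all [below V x]
    have the same measure [a]. Hence [V] is null or has measure [a + a]. The same alternative for
    [below V x0], whose own initial segments again have measure [a], forces [a = 0]. *)
Lemma rank_level0 c : mu [set x | rank x = c] = 0%E.
Proof.
set V := [set x | rank x = c].
have mV : measurable V.
  have -> : V = rank @^-1` [set c] by [].
  exact: (measurable_preimage measurable_rank).
have mb x := measurable_rank_below x mV.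
have [[x0 Vx0]|nV] := pselect (exists x, V x); last first.
  rewrite (_ : V = set0) ?measure0//.
  by apply/seteqP; split => // x Vx; apply: nV; exists x.
(* Without [lt y x], a point below [x] and not below [y] is tied with [y]; with it, the segment of
   [y] lies in that of [x] and has the same measure. *)
have diff0 x y : V x -> V y -> mu ([set z | lt z x] `\` [set z | lt z y]) = 0%E.
  move=> Vx Vy; have mx := measurable_rank_set x; have my := measurable_rank_set y.
  have [yx|nyx] := pselect (lt y x).
    rewrite finite_measureD// setIidr; last by move=> z /= zy; exact: lt_trans yx.
    by rewrite !rankE (Vx : rank x = c) (Vy : rank y = c) subee.
  apply: (subset_measure0 _ (measurable_tie y) _ (tie0 y)).
    exact: measurableD.
  move=> z /= [zx nzy]; split => // yz; apply: nyx; exact: lt_trans zx.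
have le_below x y : V x -> V y -> (mu (below V x) <= mu (below V y))%E.
  move=> Vx Vy; apply: le_measure_diff0 => //.
  apply: (subset_measure0 _ _ _ (diff0 _ _ Vx Vy)).
  - exact: measurableD.
  - by apply: measurableD; exact: measurable_rank_set.
  - by move=> z /= [[Vz zx] nzy]; split => // zy; apply: nzy.
set a := fine (mu (below V x0)).
have Va x : V x -> mu (below V x) = a%:E.
  move=> Vx; rewrite fineK ?fin_num_measure//.
  by apply/eqP; rewrite eq_le !le_below.
have V0 : fine (mu V) = 0.
  have [//|aV] := constant_below_half mV Va.
  suff a0 : a = 0 by rewrite -aV a0 addr0.
  have Va' x : below V x0 x -> mu (below (below V x0) x) = a%:E.
    move=> [Vx xx0]; rewrite -(Va x Vx); congr (mu _).
    apply/seteqP; split => z /=; first by move=> [[Vz _] zx].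
    by move=> [Vz zx]; split => //; split => //; exact: lt_trans xx0.
  have [//|/eqP] := constant_below_half (mb x0) Va'.
  by rewrite -subr_eq0 addrK => /eqP.
by rewrite -[mu V]fineK ?fin_num_measure// V0.
Qed.

End rank.

(** * Distribution functions and quantiles *)

Section quantile.
Context d (T : measurableType d) (R : realType).
Variable mu : {finite_measure set T -> \bar R}.
Implicit Types f g v w : T -> R.

Local Notation sub f t := [set x | (f x <= t)%R].

Lemma measurable_sublevel f t : measurable_fun setT f ->
  measurable (sub f (t)).
Proof.
move=> mf; rewrite (_ : [set x | _] = f @^-1` `]-oo, t]).
  exact: measurable_preimage.
by apply/seteqP; split => x /=; rewrite in_itv.
Qed.

Lemma measurable_suplevel f t : measurable_fun setT f ->
  measurable [set x | t < f x].
Proof.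
move=> mf; rewrite (_ : [set x | _] = f @^-1` `]t, +oo[).
  exact: measurable_preimage.
by apply/seteqP; split => x /=; rewrite in_itv/= andbT.
Qed.

Lemma measurable_fun_sublevel f :
  (forall t, measurable (sub f (t))) -> measurable_fun setT f.
Proof.
move=> mf; apply: (measurability (@RGenOInfty.G R)).
  exact: RGenOInfty.measurableE.
move=> _ [_ [t ->] <-]; rewrite setTI.
rewrite (_ : _ @^-1` _ = ~` (sub f (t))); first exact: measurableC.
by apply/seteqP; split => x /=; rewrite in_itv/= andbT ltNge => /negP.
Qed.

Lemma sublevel_le f s t : measurable_fun setT f -> s <= t ->
  (mu (sub f (s)) <= mu (sub f (t)))%E.
Proof.
move=> mf st; apply: le_measure; rewrite ?inE; [exact: measurable_sublevel..|].
by move=> x /= /le_trans; apply.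
Qed.

Lemma measure_lt_le f a c : measurable_fun setT f ->
  (forall t, t < a -> (mu (sub f (t)) <= c)%E) ->
  (mu [set x | (f x < a)%R] <= c)%E.
Proof.
move=> mf tc; pose F n := (sub f (a - n.+1%:R^-1)).
have mF n : measurable (F n) by exact: measurable_sublevel.
have -> : [set x | (f x < a)%R] = \bigcup_n F n.
  apply/seteqP; split => x /=.
    move=> /ltr_add_invr[n fn]; exists n => //.
    by rewrite /F/= lerBrDr ltW.
  by move=> [n _] /le_lt_trans; apply; rewrite ltrBlDr ltrDl invr_gt0.
have ndF : nondecreasing_seq F.
  move=> m n mn; apply/subsetPset => x /= /le_trans; apply.
  by rewrite lerD2l lerN2 lef_pV2 ?posrE// ler_nat.
have cF := @nondecreasing_cvg_mu _ _ _ mu F mF (bigcup_measurable (fun k _ => mF k)) ndF.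
apply: (cvge_to_le cF).
by apply: nearW => n; apply: tc; rewrite ltrBlDr ltrDl invr_gt0.
Qed.

Lemma measure_setT_le f c : measurable_fun setT f ->
  (forall t, (mu (sub f (t)) <= c)%E) -> (mu setT <= c)%E.
Proof.
move=> mf tc; pose F n := (sub f (n%:R)).
have mF n : measurable (F n) by exact: measurable_sublevel.
have <- : \bigcup_n F n = setT.
  apply/seteqP; split => x //= _; exists (Num.truncn `|f x|).+1 => //.
  by rewrite /F/= (le_trans (ler_norm _))// ltW// truncnS_gt.
have ndF : nondecreasing_seq F.
  by move=> m n mn; apply/subsetPset => x /= /le_trans; apply; rewrite ler_nat.
have cF := @nondecreasing_cvg_mu _ _ _ mu F mF (bigcup_measurable (fun k _ => mF k)) ndF.
apply: (cvge_to_le cF).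
by apply: nearW => n; exact: tc.
Qed.

Lemma measure_le_ge f a c : measurable_fun setT f ->
  (forall t, a < t -> (c <= mu (sub f (t)))%E) ->
  (c <= mu (sub f (a)))%E.
Proof.
move=> mf tc; pose F n := (sub f (a + n.+1%:R^-1)).
have mF n : measurable (F n) by exact: measurable_sublevel.
have -> : (sub f (a)) = \bigcap_n F n.
  apply/seteqP; split => x /=.
    by move=> fa n _; rewrite /F/= (le_trans fa)// lerDl invr_ge0.
  move=> h; rewrite leNgt; apply/negP => /ltr_add_invr[n]; apply/negP.
  by rewrite -leNgt; exact: h.
have niF : nonincreasing_seq F.
  move=> m n mn; apply/subsetPset => x /= /le_trans; apply.
  by rewrite lerD2l lef_pV2 ?posrE// ler_nat.
have F0y : (mu (F 0%N) < +oo)%E by rewrite ltey_eq fin_num_measure.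
have cF := @nonincreasing_cvg_mu _ _ _ mu F F0y mF (bigcapT_measurable mF) niF.
apply: (cvge_to_ge cF).
by apply: nearW => n; apply: tc; rewrite ltrDl invr_gt0.
Qed.

Lemma measure_le_ge0 f c : measurable_fun setT f ->
  (forall t, (c <= mu (sub f (t)))%E) -> (c <= 0)%E.
Proof.
move=> mf tc; pose F n := (sub f (- n%:R)).
have mF n : measurable (F n) by exact: measurable_sublevel.
have <- : mu (\bigcap_n F n) = 0%E.
  rewrite (_ : \bigcap_n F n = set0) ?measure0//.
  apply/seteqP; split => x //= h.
  have := h (Num.truncn `|f x|).+1 I; rewrite /F/= lerNr => fx.
  have := truncnS_gt `|f x|; rewrite ltNge (le_trans fx)//.
  by rewrite -normrN ler_norm.
have niF : nonincreasing_seq F.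
  by move=> m n mn; apply/subsetPset => x /= /le_trans; apply; rewrite lerN2 ler_nat.
have F0y : (mu (F 0%N) < +oo)%E by rewrite ltey_eq fin_num_measure.
have cF := @nonincreasing_cvg_mu _ _ _ mu F F0y mF (bigcapT_measurable mF) niF.
apply: (cvge_to_ge cF).
by apply: nearW => n; exact: tc.
Qed.

Lemma suplevelE f s : measurable_fun setT f ->
  mu [set x | (s < f x)%R] = (mu setT - mu (sub f s))%E.
Proof.
move=> mf; rewrite (_ : [set x | _] = setT `\` sub f s); last first.
  apply/seteqP; split => x /=; first by rewrite ltNge => /negP.
  by move=> [_ /negP]; rewrite -ltNge.
by rewrite finite_measureD// ?setTI//; exact: measurable_sublevel.
Qed.

(** Probability integral transform. At the supremum [tau] of the levels where the distribution
    function of [g] is at most [c], it jumps by the measure of [g = tau], which is 0, so its value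
    there is exactly [c]. *)
Lemma atomless_uniform g (B : R) c : measurable_fun setT g ->
  (forall t, mu [set x | g x = t] = 0%E) -> (forall x, 0 <= g x <= B) ->
  (0 <= c)%E -> (c < mu setT)%E ->
  mu [set x | (mu (sub g (g x)) <= c)%E] = c.
Proof.
move=> mg g0 gB c0 cT; pose D t := mu (sub g (t)).
pose S := [set t | (D t <= c)%E]; pose tau := sup S.
have S0 : S (- 1).
  rewrite /S/= /D (_ : [set y | _] = set0) ?measure0//.
  apply/seteqP; split => x //=; have /andP[gx0 _] := gB x; lra.
have hS : has_sup S.
  split; first by exists (-1).
  exists B => t /= St; rewrite leNgt; apply/negP => Bt.
  move: cT; rewrite ltNge => /negP; apply; apply: (le_trans _ St).
  apply: le_measure; rewrite ?inE//; first exact: measurable_sublevel.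
  by move=> x _ /=; have /andP[_ gxB] := gB x; lra.
have Dt t : t < tau -> (D t <= c)%E.
  move=> tt; have tpos : 0 < tau - t by rewrite subr_gt0.
  have [s Ss] := sup_adherent tpos hS; rewrite opprB addrCA subrr addr0 => ts.
  by apply: le_trans Ss; apply: sublevel_le => //; exact: ltW.
have tD t : tau < t -> (c < D t)%E.
  move=> tt; rewrite ltNge; apply/negP => Dc.
  by move: tt; rewrite ltNge => /negP; apply; apply: sup_ubound => //; exact: hS.2.
have mlt : measurable [set x | (g x < tau)%R].
  rewrite (_ : [set x | _] = g @^-1` `]-oo, tau[); first exact: measurable_preimage.
  by apply/seteqP; split => x /=; rewrite in_itv.
have msub := measurable_sublevel _ mg.
have lo : (mu [set x | (g x < tau)%R] <= c)%E by exact: measure_lt_le.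
have hi : (c <= mu (sub g tau))%E.
  by apply: measure_le_ge => // t /tD/ltW.
have mlev : measurable [set x | g x = tau].
  by rewrite (_ : [set x | _] = g @^-1` [set tau])//; exact: measurable_preimage.
have eqtau : mu (sub g tau) = mu [set x | (g x < tau)%R].
  rewrite -(measureU0 mlt mlev (g0 tau)); congr (mu _).
  apply/seteqP; split => x /=; first by rewrite le_eqVlt => /predU1P[]; [right|left].
  by case=> [/ltW//|->].
have Dtau : D tau = c.
  by apply/eqP; rewrite eq_le hi andbT /D eqtau lo.
rewrite -[RHS]Dtau; congr (mu _); apply/seteqP; split => x /=.
  by move=> Dc; rewrite leNgt; apply/negP => /tD; rewrite ltNge Dc.
by move=> gt; rewrite -Dtau; exact: sublevel_le.
Qed.

(** [w] is the generalized inverse of the distribution function [m] of [v], evaluated at that of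
    [g]. The latter is uniformly distributed, which gives [w] the sublevel measures of [v]. *)
Lemma quantile_along g v (B : R) :
  measurable_fun setT g -> measurable_fun setT v ->
  (forall t, mu [set x | g x = t] = 0%E) -> (forall x, 0 <= g x <= B) ->
  exists w, [/\ measurable_fun setT w, equidist mu v w &
    exists2 N, mu.-negligible N &
      forall x y, ~ N x -> ~ N y -> g x <= g y -> w x <= w y].
Proof.
move=> mg mv g0 gB; pose D x := mu (sub g (g x)); pose m s := mu (sub v s).
have msub := measurable_sublevel _ mg.
have mm := measurable_sublevel _ mv.
have [T0|Tpos] := eqVneq (mu setT) 0%E.
  exists (cst 0); split => //.
    have A0 A : measurable A -> mu A = 0%E.
      by move=> mA; exact: (subset_measure0 mA measurableT).
    move=> s; transitivity (0%E : \bar R); [|symmetry]; apply: A0;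
      exact: measurable_suplevel.
  by exists setT => [|x y []//]; exists setT; split.
have {Tpos} Tpos : (0 < mu setT)%E by rewrite lt_neqAle eq_sym Tpos/=.
have mDc c : measurable [set x | (D x <= c)%E].
  pose J := [set t | (mu (sub g t) <= c)%E].
  have mJ : measurable J.
    apply: is_interval_measurable => a b /= Ja Jb z /andP[_ zb].
    by apply: le_trans Jb; exact: sublevel_le.
  by rewrite (_ : [set x | _] = g @^-1` J)//; exact: measurable_preimage.
have unif c : (0 <= c)%E -> (c <= mu setT)%E -> mu [set x | (D x <= c)%E] = c.
  move=> c0; rewrite le_eqVlt => /predU1P[->|]; last exact: atomless_uniform gB c0.
  congr (mu _); apply/seteqP; split => x //= _.
  by apply: le_measure; rewrite ?inE.
(* Off [N] the set whose infimum will define [w] is nonempty and bounded below. *)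
pose N := [set x | (D x <= 0)%E] `|` [set x | (mu setT <= D x)%E].
have mN2 : measurable [set x | (mu setT <= D x)%E].
  pose J := [set t | (mu setT <= mu (sub g t))%E].
  have mJ : measurable J.
    apply: is_interval_measurable => a b /= Ja Jb z /andP[az _].
    by apply: (le_trans Ja); exact: sublevel_le.
  by rewrite (_ : [set x | _] = g @^-1` J)//; exact: measurable_preimage.
have mN : measurable N by apply: measurableU.
have N0 : mu N = 0%E.
  apply: null_set_setU => //; first exact: unif.
  set N2 := [set x | _] in mN2 *; pose M := fine (mu setT); pose r := fine (mu N2).
  have MT : mu setT = M%:E by rewrite fineK// fin_num_measure.
  have rN : mu N2 = r%:E by rewrite fineK// fin_num_measure.
  have r0 : 0 <= r by rewrite fine_ge0.
  have rM : r <= M by rewrite -lee_fin -rN -MT; apply: le_measure; rewrite ?inE.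
  suff : mu N2 = 0%E by [].
  rewrite rN; congr EFin; apply/eqP; rewrite eq_le r0 andbT leNgt; apply/negP => rpos.
  (* Uniformity at the level [M - r / 2] leaves measure [r / 2] for the complement, which however
     contains [N2], of measure [r]. *)
  have c0 : (0 <= (M - r / 2)%:E)%E by rewrite lee_fin; lra.
  have cM : ((M - r / 2)%:E <= mu setT)%E by rewrite MT lee_fin; lra.
  have uc := unif _ c0 cM.
  have : (mu N2 <= mu (setT `\` [set x | (D x <= (M - r / 2)%:E)%E]))%E.
    apply: le_measure; rewrite ?inE//; first exact: measurableD.
    move=> x /= TD; split => // Dc; have := le_trans TD Dc.
    by rewrite MT lee_fin; lra.
  by rewrite finite_measureD// setTI uc rN MT -EFinB lee_fin; lra.
pose Sx x := [set s | (D x <= m s)%E].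
pose w x := if x \in N then 0 else inf (Sx x).
(* Galois connection between quantile and distribution function; the direct implication rests on the
   right continuity of [m]. *)
have wP x s : ~ N x -> (w x <= s) = (D x <= m s)%E.
  move=> Nx; rewrite /w memNset//.
  have [D0 DT] : (0 < D x)%E /\ (D x < mu setT)%E.
    by split; rewrite ltNge; apply/negP => h; apply: Nx; [left|right].
  have hS : has_inf (Sx x).
    split.
      apply: contrapT => h; move: DT; rewrite ltNge => /negP; apply.
      apply: (measure_setT_le mv) => t; apply/ltW; rewrite ltNge; apply/negP => Dt.
      by apply: h; exists t.
    apply: contrapT => h; move: D0; rewrite ltNge => /negP; apply.
    apply: (measure_le_ge0 mv) => t; rewrite leNgt; apply/negP => tD.
    apply: h; exists t => r Sr; rewrite leNgt; apply/negP => rt.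
    move: tD; rewrite ltNge => /negP; apply; apply: (le_trans Sr).
    by apply: sublevel_le => //; exact: ltW.
  apply/idP/idP => [ws|Ds]; last by apply: ge_inf => //; exact: hS.2.
  apply: measure_le_ge => // t st.
  have tpos : 0 < t - inf (Sx x) by rewrite subr_gt0 (le_lt_trans ws).
  have [r Sr] := inf_adherent tpos hS; rewrite addrCA subrr addr0 => rt.
  by apply: (le_trans Sr); apply: sublevel_le => //; exact: ltW.
have subw s : sub w s = ([set x | (D x <= m s)%E] `\` N) `|` (N `&` [set _ | 0 <= s]).
  apply/seteqP; split => x /=.
    have [Nx|Nx] := pselect (N x).
      by rewrite /w mem_set// => s0; right.
    by rewrite wP// => ?; left.
  case=> [[Dm Nx]|[Nx s0]]; first by rewrite wP.
  by rewrite /w mem_set.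
have mw : measurable_fun setT w.
  apply: measurable_fun_sublevel => s; rewrite subw; apply: measurableU.
    exact: measurableD.
  have [s0|s0] := boolP (0 <= s).
    by rewrite (_ : [set _ | _] = setT) ?setIT//; apply/seteqP; split.
  by rewrite (_ : [set _ | _] = set0) ?setI0//; apply/seteqP; split.
exists w; split => //.
  move=> s; transitivity (mu setT - mu (sub v s))%E; first exact: suplevelE.
  transitivity (mu setT - mu (sub w s))%E; last by symmetry; exact: suplevelE.
  congr (_ - _)%E; rewrite subw.
  have mNs : measurable (N `&` [set _ | 0 <= s]).
    by apply: measurableI => //; case: (0 <= s);
      [rewrite (_ : [set _ | _] = setT)|rewrite (_ : [set _ | _] = set0)] => //;
      apply/seteqP; split.
  have Ns0 : mu (N `&` [set _ | 0 <= s]) = 0%E.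
    by apply: (subset_measure0 _ mN) => //; exact: subIsetl.
  rewrite measureU0//; last exact: measurableD.
  transitivity (mu [set x | (D x <= m s)%E]); symmetry; last exact: measureD0.
  by apply: unif => //; apply: le_measure; rewrite ?inE.
exists N; first by exists N; split.
move=> x y Nx Ny gxy; rewrite wP//; apply: (@le_trans _ _ (D y)); first exact: sublevel_le.
by rewrite -wP.
Qed.

End quantile.

Section comonotone.
Context d (T : measurableType d) (R : realType).
Variable mu : {finite_measure set T -> \bar R}.
Implicit Types f g v w psi h : T -> R.

Local Notation integ f := (mu.-integrable setT (EFin \o f)).

(** [psi] may be constant on a set of positive measure, and then a function of [psi] alone may fail
    to be equidistributed with [v]. The rank for the lexicographic order by [psi], then [h], has
    null level sets; [w] is the quantile along it, so it may vary on a level set of [psi] but never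
    decreases when [psi] increases. *)
Lemma comonotone_rearrangement psi h v :
  measurable_fun setT psi -> measurable_fun setT h -> measurable_fun setT v ->
  (forall c, mu [set x | h x = c] = 0%E) ->
  exists w, [/\ measurable_fun setT w, equidist mu v w &
    exists2 N, mu.-negligible N &
      forall x y, ~ N x -> ~ N y -> w y < w x -> psi y <= psi x].
Proof.
move=> mpsi mh mv h0.
pose lt x y := psi x < psi y \/ (psi x = psi y /\ h x < h y).
have lt_tr y x z : lt x y -> lt y z -> lt x z.
  move=> [xy|[xy hxy]] [yz|[yz hyz]].
  - by left; exact: lt_trans yz.
  - by left; rewrite -yz.
  - by left; rewrite xy.
  - by right; rewrite xy yz; split => //; exact: lt_trans hyz.
have lt_as x y : lt x y -> ~ lt y x.
  move=> xy yx; have := lt_tr _ _ _ xy yx.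
  by case=> [|[_]]; rewrite ltxx.
have m1 f : measurable_fun setT f -> measurable_fun setT (fun z : T * T => f z.1).
  by move=> mf; exact: measurableT_comp mf measurable_fst.
have m2 f : measurable_fun setT f -> measurable_fun setT (fun z : T * T => f z.2).
  by move=> mf; exact: measurableT_comp mf measurable_snd.
have mltr (f g : T * T -> R) : measurable_fun setT f -> measurable_fun setT g ->
    measurable [set z | f z < g z].
  move=> mf mg; have := measurable_fun_ltr mf mg.
  move/(_ measurableT [set true] I); rewrite setTI.
  by congr measurable; apply/seteqP; split.
have meqr (f g : T * T -> R) : measurable_fun setT f -> measurable_fun setT g ->
    measurable [set z | f z = g z].
  move=> mf mg; have := measurable_fun_eqr mf mg.
  move/(_ measurableT [set true] I); rewrite setTI.
  by congr measurable; apply/seteqP; split => z /= /eqP.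
have mlt : measurable [set z : T * T | lt z.2 z.1].
  have -> : [set z : T * T | lt z.2 z.1] = [set z | psi z.2 < psi z.1] `|`
      ([set z | psi z.2 = psi z.1] `&` [set z | h z.2 < h z.1]).
    by apply/seteqP; split.
  apply: measurableU; first by apply: mltr; [exact: m2|exact: m1].
  by apply: measurableI; [apply: meqr|apply: mltr]; by [exact: m2|exact: m1].
have mhc c : measurable [set x | h x = c].
  by rewrite (_ : [set x | _] = h @^-1` [set c])//; exact: measurable_preimage.
have tie0 x : mu [set y | ~ lt x y /\ ~ lt y x] = 0%E.
  apply: (subset_measure0 _ (mhc (h x)) _ (h0 (h x))).
    exact: measurable_tie.
  move=> y /= [nxy nyx]; apply/eqP; rewrite eq_le !leNgt.
  have pxy : psi x = psi y.
    by apply/eqP; rewrite eq_le !leNgt; apply/andP; split; apply/negP => ?;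
      [apply: nyx; left|apply: nxy; left].
  by apply/andP; split; apply/negP => ?; [apply: nxy; right|apply: nyx; right].
have rB x : 0 <= rank mu lt x <= fine (mu setT) by rewrite rank_ge0 rank_ub.
have [w [mw vw [N N0 wN]]] := quantile_along (measurable_rank mu mlt) mv
  (rank_level0 lt_tr lt_as mlt tie0) rB.
exists w; split => //; exists N => // x y Nx Ny wyx.
rewrite leNgt; apply/negP => pxy; move: wyx; rewrite ltNge wN//.
by apply: rank_le => //; left.
Qed.

End comonotone.

Section primitive.
Context {R : realType}.
Local Notation leb := (@lebesgue_measure R).

(** Signed indicator of the interval between [a] and [b]: it turns oriented integrals into integrals
    over the line, for either order of the end points. *)
Let chi (a b s : R) : R := \1_(`]-oo, b[) s - \1_(`]-oo, a[) s.

Let chi_le a b : a <= b -> chi a b = \1_(`[a, b[).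
Proof.
move=> ab; apply/funext => s; rewrite /chi !indicE !mem_setE !in_itv/=.
by have [] := ltP s a => sa /=; have [] := ltP s b => sb //=; lra.
Qed.

Let chi_opp a b s : chi a b s = - chi b a s.
Proof. by rewrite /chi opprB. Qed.

Let chi_int a b : leb.-integrable setT (EFin \o chi a b) /\
  \int[leb]_s chi a b s = b - a.
Proof.
have le x y : x <= y -> leb.-integrable setT (EFin \o chi x y) /\
    \int[leb]_s chi x y s = y - x.
  move=> xy; split; first by rewrite chi_le//; exact: integrable_indic_itv.
  rewrite chi_le// /Rintegral integral_indic// setIT.
  transitivity (fine (if (x%:E < y%:E)%E then (y%:E - x%:E)%E else 0%E)).
    by congr fine; exact: (@lebesgue_measure_itv R `[x, y[).
  rewrite lte_fin.
  by move: xy; rewrite le_eqVlt => /predU1P[->|->//]; rewrite ltxx subrr.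
have [/le//|/ltW/le [ib eb]] := leP a b.
have E : chi a b = \- chi b a by apply/funext => s; exact: chi_opp.
split; first by rewrite E; exact: (integrableN ib).
transitivity (\int[leb]_s (-1 * chi b a s)).
  by apply: eq_Rintegral => s _; rewrite chi_opp mulN1r.
by rewrite RintegralZl// eb; lra.
Qed.

Let chi_norm a b s : `|chi a b s| = chi (Num.min a b) (Num.max a b) s.
Proof.
have [ab|/ltW ba] := leP a b; first by rewrite chi_le// ger0_norm// indicE.
by rewrite chi_opp normrN chi_le// ger0_norm// indicE.
Qed.

(* [Phi] is an integral of [theta]; the last clause says that every [t] in the
   jump of [theta] at [a] is a subgradient of [Phi] at [a]. *)
Lemma convex_primitive (theta : R -> R) (C : R) :
  {homo theta : s t / s <= t} -> (forall s, `|theta s| <= C) ->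
  exists2 Phi : R -> R, (forall a b, `|Phi a - Phi b| <= C * `|a - b|) &
    forall a b t, (forall s, a <= s -> t <= theta s) ->
      (forall s, s < a -> theta s <= t) -> Phi a + t * (b - a) <= Phi b.
Proof.
move=> ndt tC; have mt : measurable_fun setT theta.
  exact: nondecreasing_measurable.
have C0 : 0 <= C by exact: le_trans (tC 0).
have ichi a b := (chi_int a b).1.
have itchi a b : leb.-integrable setT (EFin \o (fun s => theta s * chi a b s)).
  have iC : leb.-integrable setT (EFin \o (fun s => C * `|chi a b s|)).
    exact: (integZ C (integrable_norm (ichi a b))).
  apply: (le_integrable measurableT _ _ iC).
    apply/measurable_EFinP; apply: measurable_funM => //.
    by have /measurable_int/measurable_EFinP := ichi a b.
  by move=> s _ /=; rewrite lee_fin [leRHS]ger0_norm ?mulr_ge0// normrM ler_wpM2r.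
pose Phi a := \int[leb]_s (theta s * chi 0 a s).
have PhiB a b : Phi b - Phi a = \int[leb]_s (theta s * chi a b s).
  rewrite -RintegralB//; apply: eq_Rintegral => s _.
  by rewrite -mulrBr /chi; congr (_ * _); lra.
exists Phi => [a b|a b t ta at_].
  rewrite PhiB (le_trans (le_normr_Rintegral measurableT (itchi b a)))//.
  have -> : C * `|a - b| = \int[leb]_s (C * `|chi b a s|).
    rewrite RintegralZl//; last exact: (integrable_norm (ichi b a)).
    under eq_Rintegral do rewrite chi_norm.
    rewrite (chi_int _ _).2; congr (_ * _).
    by case: (leP b a) => ba; [rewrite ger0_norm|rewrite ltr0_norm]; lra.
  apply: le_Rintegral => //.
  - exact: (integrable_norm (itchi b a)).
  - exact: (integZ C (integrable_norm (ichi b a))).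
  - by move=> s _; rewrite normrM ler_wpM2r.
have e1 : t * (b - a) = \int[leb]_s (t * chi a b s).
  by rewrite RintegralZl// (chi_int a b).2.
have itc := integZ t (ichi a b).
rewrite -subr_ge0 opprD addrA PhiB e1 -(RintegralB measurableT (itchi a b) itc).
(* [theta - t] is nonnegative from [a] on and nonpositive before, like [chi a b] according to the
   order of [a] and [b]; the product is nonnegative. *)
apply: Rintegral_ge0 => s _; rewrite -mulrBl.
have [ab|/ltW ba] := leP a b.
  rewrite chi_le// indicE; have [sab|_] := boolP (s \in _); last by rewrite mulr0.
  move: sab; rewrite inE/= in_itv/= => /andP[as_ _].
  by rewrite mulr1 subr_ge0; exact: ta.
rewrite chi_opp chi_le// indicE; have [sab|_] := boolP (s \in _); last first.
  by rewrite oppr0 mulr0.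
move: sab; rewrite inE/= in_itv/= => /andP[_ sa].
by rewrite mulrN1 opprB subr_ge0; exact: at_.
Qed.

End primitive.

(** * The bathtub inequality *)

Section bathtub.
Context d (T : measurableType d) (R : realType).
Variable mu : {finite_measure set T -> \bar R}.
Implicit Types f g v w psi h : T -> R.

Local Notation integ f := (mu.-integrable setT (EFin \o f)).

(** Let [theta s] be the supremum of [psi] over [w <= s] and [Phi] its convex primitive.
    Comonotonicity makes [psi x] a subgradient of [Phi] at [w x]. Integrating the subgradient
    inequality leaves a difference of integrals of [Phi], which would be 0 for equidistributed [v]
    and [w] and is otherwise controlled by the Lipschitz constant. *)
Lemma comonotone_maximal psi (C : R) w N v v0 w0 :
  measurable_fun setT psi -> 0 <= C -> (forall x, `|psi x| <= C) ->
  mu.-negligible N ->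
  (forall x y, ~ N x -> ~ N y -> w y < w x -> psi y <= psi x) ->
  integ v -> integ v0 -> integ w -> integ w0 ->
  equidist mu v v0 -> equidist mu w w0 ->
  \int[mu]_x (psi x * (v x - w x)) <= C * \int[mu]_x `|v0 x - w0 x|.
Proof.
move=> mpsi C0 psiC N0 wN iv iv0 iw iw0 vv0 ww0.
have CpC x : - C <= psi x <= C by rewrite -ler_norml.
(* The element [- C] keeps the set nonempty at every level [s]. *)
pose A s := [set t | t = - C \/ exists x, [/\ ~ N x, w x <= s & t = psi x]].
have AC s : ubound (A s) C.
  by move=> t [->|[x [_ _ ->]]]; [lra|case/andP: (CpC x)].
have hA s : has_sup (A s) by split; [exists (- C); left|exists C].
have ndA : {homo (fun s => sup (A s)) : s t / s <= t}.
  move=> s t st; apply: ge_sup => [|r]; first by exists (- C); left.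
  case=> [->|[x [Nx wx ->]]]; apply: ub_le_sup; [exact: (hA t).2|by left|exact: (hA t).2|].
  by right; exists x; split => //; exact: le_trans st.
have bA s : `|sup (A s)| <= C.
  rewrite ler_norml; apply/andP; split.
    by apply: ub_le_sup; [exact: (hA s).2|left].
  by apply: ge_sup; [exists (- C); left|exact: AC].
have [Phi lipT subT] := convex_primitive ndA bA.
have le_Th x : ~ N x -> psi x * (v x - w x) <= Phi (v x) - Phi (w x).
  move=> Nx; rewrite lerBrDl; apply: subT => s ws.
    by apply: ub_le_sup; [exact: (hA s).2|right; exists x].
  apply: ge_sup; first by exists (- C); left.
  move=> t [->|[y [Ny wy ->]]]; first by case/andP: (CpC x).
  by apply: wN => //; exact: le_lt_trans ws.
have iTv := lipschitz_integ lipT iv; have iTw := lipschitz_integ lipT iw.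
have ipsi : integ (fun x => psi x * (v x - w x)).
  have ivw := integB iv iw.
  apply: (le_integ _ (integZ C (integrable_norm ivw))).
    by apply: measurable_funM => //; exact: (integ_measurable ivw).
  by move=> x; rewrite normrM ler_wpM2r.
apply: (@le_trans _ _ (\int[mu]_x (Phi (v x) - Phi (w x)))).
  apply: le_Rint_ae => //; first exact: (integB iTv iTw).
  by apply: negligibleS N0 => x /= h; apply: contrapT => Nx; apply: h; exact: le_Th.
rewrite RintegralB//; apply: (le_trans (ler_norm _)).
exact: equidist_lipschitz_le.
Qed.

End bathtub.

(** * From weak to strong convergence among equidistributed functions *)

Section huber.
Context {R : realType}.
Implicit Types (a b t L : R).

Definition clamp L t : R := Num.max (- L) (Num.min t L).

(** The convex primitive of [clamp L]: quadratic on [[-L, L]], linear outside. It keeps the strict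
    convexity of the square below the cut-off and is Lipschitz, hence stable under L1 errors. *)
Definition huber L t : R := t * clamp L t - clamp L t ^+ 2 / 2.

Definition excess L t : R := Num.max (`|t| - L) 0.

Variant clamp_spec L t : R -> Type :=
| ClampLow of t < - L : clamp_spec L t (- L)
| ClampMid of - L <= t <= L : clamp_spec L t t
| ClampHigh of L < t : clamp_spec L t L.

Lemma clampP L t : 0 <= L -> clamp_spec L t (clamp L t).
Proof.
move=> L0; rewrite /clamp; have [tL|Lt] := leP t L.
  have [Lt|tL'] := leP (- L) t; last exact: ClampLow.
  by apply: ClampMid; rewrite Lt.
have -> : Num.max (- L) L = L by apply/max_idPr; lra.
exact: ClampHigh.
Qed.

Lemma clamp_norm_le L t : 0 <= L -> `|clamp L t| <= L.
Proof.
by move=> L0; rewrite ler_norml; case: (clampP t L0) => //; lra.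
Qed.

Lemma clampB_norm_le L a b : 0 <= L -> `|clamp L a - clamp L b| <= L *+ 2.
Proof.
move=> L0; rewrite (le_trans (ler_normB _ _))// mulr2n.
by rewrite lerD// clamp_norm_le.
Qed.

Lemma excessE L t : 0 <= L -> `|t - clamp L t| = excess L t.
Proof.
move=> L0; rewrite /excess; case: (clampP t L0) => [tL|/andP[tL tL']|tL].
- rewrite ltr0_norm; last lra.
  rewrite (@ltr0_norm _ t); last lra.
  by rewrite max_l; lra.
- rewrite subrr normr0 max_r// subr_le0 ler_norml; lra.
- rewrite gtr0_norm; last lra.
  rewrite (@gtr0_norm _ t); last lra.
  by rewrite max_l; lra.
Qed.

(** Cocoercivity: [huber L] is convex with the 1-Lipschitz derivative [clamp L]. *)
Lemma huber_bregman L a b : 0 <= L ->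
  (clamp L a - clamp L b) ^+ 2 / 2 <=
  huber L b - huber L a - clamp L a * (b - a).
Proof.
by move=> L0; rewrite /huber; case: (clampP a L0); case: (clampP b L0) => *; nra.
Qed.

Lemma huber_lipschitz L a b : 0 <= L ->
  `|huber L a - huber L b| <= L * `|a - b|.
Proof.
move=> L0.
have key x y : huber L x - huber L y <= L * `|x - y|.
  have /le_trans h := huber_bregman x y L0.
  have : clamp L x * (x - y) <= L * `|x - y|.
    by rewrite (le_trans (ler_norm _))// normrM ler_wpM2r// clamp_norm_le.
  have := huber_bregman x y L0.
  have : 0 <= (clamp L x - clamp L y) ^+ 2 / 2 by rewrite divr_ge0// sqr_ge0.
  lra.
by rewrite ler_norml lerNl opprB key andbT distrC key.
Qed.

Lemma measurable_clamp L : measurable_fun setT (clamp L).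
Proof. by apply: measurable_maxr => //; exact: measurable_minr. Qed.

Lemma measurable_excess L : measurable_fun setT (excess L).
Proof.
by apply: measurable_maxr => //; exact: measurable_funB.
Qed.

Lemma excess_ge0 L t : 0 <= excess L t.
Proof. by rewrite /excess le_max lexx orbT. Qed.

Lemma excess_le L t : 0 <= L -> excess L t <= `|t|.
Proof. by move=> L0; rewrite /excess ge_max normr_ge0 andbT; lra. Qed.

(** The outer absolute value on the right gives the shape to which [powR_norm_leD] applies. *)
Lemma excess_leD L a b : excess L a <= `|excess L b + `|a - b| |.
Proof.
rewrite ger0_norm ?addr_ge0 ?excess_ge0//.
rewrite {1}/excess ge_max addr_ge0 ?excess_ge0// andbT.
apply: (@le_trans _ _ (`|b| - L + `|a - b|)).
  have := ler_normD b (a - b); rewrite addrCA subrr addr0; lra.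
by rewrite lerD2r /excess le_max lexx.
Qed.

(** Up to the threshold [dl] with [dl ^ p = eta] the power is at most [eta]; above it
    [t ^ 2 / dl ^ 2 >= 1]. For clamped differences this passes from L2 to Lp on either side of
    [p = 2]. *)
Lemma powR_le_sqr (p : R) L (eta : R) : 0 < p -> 0 <= L -> 0 < eta ->
  exists2 C, 0 <= C & forall t, `|t| <= L *+ 2 -> `|t| `^ p <= eta + C * t ^+ 2.
Proof.
move=> p0 L0 eta0; pose dl := eta `^ p^-1.
have dl0 : 0 < dl by rewrite powR_gt0.
have dlp : dl `^ p = eta by rewrite /dl -powRrM mulVf ?gt_eqF// powRr1 ?(ltW eta0).
exists ((L *+ 2) `^ p / dl ^+ 2) => [|t tL].
  by rewrite divr_ge0 ?powR_ge0// sqr_ge0.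
have [tdl|dlt] := leP `|t| dl.
  apply: (@le_trans _ _ eta).
    by rewrite -dlp; apply: ge0_ler_powR; rewrite ?nnegrE ?(ltW p0) ?(ltW dl0).
  by rewrite lerDl mulr_ge0 ?sqr_ge0// divr_ge0 ?powR_ge0// sqr_ge0.
apply: (@le_trans _ _ ((L *+ 2) `^ p)).
  by apply: ge0_ler_powR; rewrite ?nnegrE ?(ltW p0) ?mulrn_wge0.
apply: (@le_trans _ _ ((L *+ 2) `^ p / dl ^+ 2 * t ^+ 2)); last by rewrite lerDr ltW.
rewrite -mulrA ler_peMr ?powR_ge0// mulrC ler_pdivlMr ?exprn_gt0// mul1r.
by rewrite -(real_normK (num_real t)) lerXn2r ?nnegrE ?(ltW dl0)// ltW.
Qed.

End huber.

(** * Strong convergence from almost equal distributions *)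

Section strong_convergence.
Context d (T : measurableType d) (R : realType).
Variable mu : {finite_measure set T -> \bar R}.
Variables p q : R.
Hypotheses (p0 : 0 < p) (q0 : 0 < q) (pq : p^-1 + q^-1 = 1).
Implicit Types (f g u v w : T -> R).

Local Notation integ f := (mu.-integrable setT (EFin \o f)).
Local Notation Lp := (Lpfun mu p).
Local Notation Lq := (Lpfun mu q).

Lemma Lpfun_cvg_L1 (z : nat -> T -> R) : (forall n, Lp (z n)) ->
  \int[mu]_x (`|z n x| `^ p) @[n --> \oo] --> 0 ->
  \int[mu]_x `|z n x| @[n --> \oo] --> 0.
Proof.
move=> Lz z0; apply/(@cvgr0Pnorm_le R R) => e e0.
have qp : q^-1 + p^-1 = 1 by rewrite addrC.
pose M := \int[mu]_x (`|1 : R| `^ q).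
have M0 : 0 <= M by apply: Rintegral_ge0 => x _; exact: powR_ge0.
have eta0 : 0 < e / 2 / (M + 1) by rewrite !divr_gt0// ltr_wpDl.
(* The exponents are exchanged: the small weight goes to the constant 1 and [C] to [z n]. *)
have [C C0 yC] := Lpfun_young mu q0 p0 qp eta0.
have L1 : Lq (cst 1).
  by apply: (@Lpfun_bounded _ _ _ _ _ _ 1); rewrite ?ltW// => x; rewrite normr1.
have e2 : 0 < e / 2 / (C + 1) by rewrite !divr_gt0// ltr_wpDl.
have /cvgr0Pnorm_lt/(_ _ e2) := z0; apply: filterS => n zn.
rewrite ger0_norm; last exact: Rintegral_ge0.
have := yC _ _ (Lz n) L1.
rewrite (_ : \int[mu]_x `|z n x * cst 1 x| = \int[mu]_x `|z n x|); last first.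
  by apply: eq_Rintegral => x _; rewrite mulr1.
move=> /le_trans; apply; rewrite [leRHS]splitr lerD//.
  rewrite -[leRHS](@divfK _ (M + 1)); last by rewrite gt_eqF// ltr_wpDl.
  by rewrite ler_wpM2l ?(ltW eta0)// lerDl.
rewrite ger0_norm in zn; last by apply: Rintegral_ge0 => x _; exact: powR_ge0.
rewrite -[leRHS](@divfK _ (C + 1)); last by rewrite gt_eqF// ltr_wpDl.
rewrite [leRHS]mulrC; apply: ler_pM; [by []| |by rewrite lerDl|exact: ltW].
by apply: Rintegral_ge0 => x _; exact: powR_ge0.
Qed.

Lemma Lpfun_excess (L : R) w : 0 <= L -> Lp w -> Lp (excess L \o w).
Proof.
move=> L0 [mw iw]; have me : measurable_fun setT (excess L \o w).
  exact: measurableT_comp (measurable_excess L) mw.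
split => //; apply: (le_integ _ iw); first exact: measurable_norm_powR.
move=> x /=; rewrite ger0_norm ?powR_ge0//; apply: ge0_ler_powR; rewrite ?nnegrE ?(ltW p0)//.
by rewrite ger0_norm ?excess_ge0// excess_le.
Qed.

Lemma excess_vanish w : Lp w ->
  \int[mu]_x (`|excess n%:R (w x)| `^ p) @[n --> \oo] --> 0.
Proof.
move=> Lw; rewrite (_ : 0 = \int[mu]_(x in setT) (cst 0 x)); last first.
  by rewrite Rintegral_cst// mul0r.
apply: (Rint_dominated _ _ _ Lw.2) => //.
- by move=> n; exact/integ_measurable/(Lpfun_excess _ Lw).2.
- apply: aeW => x; apply: cvg_near_cst.
  exists (Num.truncn `|w x|).+1 => // n /= wn.
  rewrite /excess max_r ?normr0 ?powR0 ?gt_eqF// subr_le0.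
  by rewrite (le_trans (ltW (truncnS_gt _)))// ler_nat.
- move=> n; apply: aeW => x; rewrite ger0_norm ?powR_ge0//.
  apply: ge0_ler_powR; rewrite ?nnegrE ?(ltW p0)//.
  by rewrite ger0_norm ?excess_ge0// excess_le.
Qed.

(** A Radon-Riesz argument with almost equal integrals of [huber L] in place of equal norms. Weak
    convergence tested with [clamp L] of [w], together with [huber_bregman], makes the clamped
    functions converge in L2. By equidistribution the parts of [om n] beyond [L] are controlled by
    those of [w] and the error [om0 n - u n]. *)
Lemma Lpfun_strong_cvg w (om om0 u : nat -> T -> R) :
  Lp w -> (forall n, Lp (om n)) -> (forall n, Lp (om0 n)) -> (forall n, Lp (u n)) ->
  (forall n, equidist mu (om n) (om0 n)) -> (forall n, equidist mu w (u n)) ->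
  \int[mu]_x (`|om0 n x - u n x| `^ p) @[n --> \oo] --> 0 ->
  (forall f (C : R), measurable_fun setT f -> (forall x, `|f x| <= C) ->
    \int[mu]_x (f x * (om n x - w x)) @[n --> \oo] --> 0) ->
  \int[mu]_x (`|om n x - w x| `^ p) @[n --> \oo] --> 0.
Proof.
move=> Lw Lom Lom0 Lu omE uE z0 weak.
have iw := Lpfun_integ p0 q0 pq Lw.
have iom n := Lpfun_integ p0 q0 pq (Lom n).
have iom0 n := Lpfun_integ p0 q0 pq (Lom0 n).
have iu n := Lpfun_integ p0 q0 pq (Lu n).
have Lz n : Lp (om0 n \- u n) by exact: LpfunB.
have z1 := Lpfun_cvg_L1 Lz z0.
have mT (L : R) v : measurable_fun setT v -> measurable_fun setT (clamp L \o v).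
  exact: measurableT_comp (measurable_clamp L).
have mom n := (Lom n).1; have mw := Lw.1.
have sqr_cvg (L : R) : 0 <= L ->
    \int[mu]_x ((clamp L (om n x) - clamp L (w x)) ^+ 2) @[n --> \oo] --> 0.
  move=> L0; have wk := weak (clamp L \o w) L (mT L w mw) (fun x => clamp_norm_le _ L0).
  (* The first term bounds the difference of the Huber integrals, the second is the linear term of
     the Bregman inequality. *)
  pose bnd n := 2 * (L * \int[mu]_x `|om0 n x - u n x| +
    `|\int[mu]_x (clamp L (w x) * (om n x - w x))|).
  have bnd0 : bnd n @[n --> \oo] --> 0.
    have h : bnd n @[n --> \oo] --> 2 * (L * 0 + `|0 : R|).
      apply: cvgM; first exact: cvg_cst.
      apply: cvgD; last by apply: cvg_norm; exact: wk.
      by apply: cvgM; [exact: cvg_cst|exact: z1].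
    by rewrite mulr0 normr0 addr0 mulr0 in h.
  apply: (squeeze_cvgr _ (cvg_cst 0) bnd0); apply: nearW => n.
  apply/andP; split; first by apply: Rintegral_ge0 => x _; exact: sqr_ge0.
  have lip := fun a b => huber_lipschitz a b L0.
  have ihom := lipschitz_integ lip (iom n); have ihw := lipschitz_integ lip iw.
  have iTd : integ (fun x => clamp L (w x) * (om n x - w x)).
    have id := integB (iom n) iw.
    apply: (le_integ _ (integZ L (integrable_norm id))).
      by apply: measurable_funM; [exact: (mT L w)|exact: (integ_measurable id)].
    by move=> x; rewrite normrM ler_wpM2r// clamp_norm_le.
  have mS : measurable_fun setT (fun x => (clamp L (om n x) - clamp L (w x)) ^+ 2).
    by apply: measurable_funX; apply: measurable_funB; exact: mT.
  have iS : integ (fun x => (clamp L (om n x) - clamp L (w x)) ^+ 2).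
    apply: (@integ_bounded _ _ _ mu _ ((L *+ 2) ^+ 2)) => // x.
    rewrite normrX lerXn2r ?nnegrE ?mulrn_wge0//; exact: clampB_norm_le.
  have iD := integB (integB ihom ihw) iTd.
  have le1 : \int[mu]_x ((clamp L (om n x) - clamp L (w x)) ^+ 2) <=
      2 * (\int[mu]_x (huber L (om n x) - huber L (w x) - clamp L (w x) * (om n x - w x))).
    rewrite -RintegralZl//; apply: le_Rint => //; first exact: (integZ 2 iD).
    move=> x; rewrite mulrC -ler_pdivrMr// -(sqrrN (_ - _)) opprB.
    exact: huber_bregman.
  apply: (le_trans le1); rewrite ler_wpM2l// RintegralB//; last exact: (integB ihom ihw).
  rewrite RintegralB// lerD//; last by rewrite -normrN ler_norm.
  apply: (le_trans (ler_norm _)); apply: equidist_lipschitz_le => //.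
apply/(@cvgr0Pnorm_le R R) => e e0.
(* [A] is the loss in the triangle inequality for [p]-th powers. Its nested use in [E3] and [E1]
   gives the weight [A ^ 3 + A ^ 2] to the tail [t] and [A ^ 3] to the error [zn]; each of four
   contributions is allotted [e / 4]. *)
pose A : R := 2 `^ p; have A0 : 0 < A by rewrite powR_gt0.
have B0 : 0 < A ^+ 3 + A ^+ 2 by rewrite addr_gt0 ?exprn_gt0.
pose M := fine (mu setT); have M0 : 0 <= M by rewrite fine_ge0.
have tpos : 0 < e / 4 / (A ^+ 3 + A ^+ 2) by rewrite !divr_gt0.
have /cvgr0Pnorm_le/(_ _ tpos)[N _ /(_ _ (leqnn N)) tle] := excess_vanish Lw.
set L : R := N%:R in tle; have L0 : 0 <= L by [].
pose t := \int[mu]_x (`|excess L (w x)| `^ p).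
have t0 : 0 <= t by apply: Rintegral_ge0 => x _; exact: powR_ge0.
have {}tle : t <= e / 4 / (A ^+ 3 + A ^+ 2).
  by apply: le_trans tle; exact: ler_norm.
have AM0 : 0 < A * M + 1 by rewrite ltr_wpDl ?mulr_ge0 ?(ltW A0).
have etapos : 0 < e / 4 / (A * M + 1) by rewrite !divr_gt0.
have [C C0 pC] := powR_le_sqr p0 L0 etapos.
have AC0 : 0 < A * C + 1 by rewrite ltr_wpDl ?mulr_ge0 ?(ltW A0).
have xpos : 0 < e / 4 / (A * C + 1) by rewrite !divr_gt0.
have zpos : 0 < e / 4 / A ^+ 3 by rewrite !divr_gt0 ?exprn_gt0.
near=> n.
have zle : `|\int[mu]_x (`|om0 n x - u n x| `^ p)| <= e / 4 / A ^+ 3.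
  by near: n; have /cvgr0Pnorm_le/(_ _ zpos) := z0.
have Xle : `|\int[mu]_x ((clamp L (om n x) - clamp L (w x)) ^+ 2)| <=
    e / 4 / (A * C + 1).
  by near: n; have /cvgr0Pnorm_le/(_ _ xpos) := sqr_cvg _ L0.
pose zn := \int[mu]_x (`|om0 n x - u n x| `^ p).
pose X := \int[mu]_x ((clamp L (om n x) - clamp L (w x)) ^+ 2).
have zn0 : 0 <= zn by apply: Rintegral_ge0 => x _; exact: powR_ge0.
have X0 : 0 <= X by apply: Rintegral_ge0 => x _; exact: sqr_ge0.
rewrite -/zn (ger0_norm zn0) in zle; rewrite -/X (ger0_norm X0) in Xle.
have I0 : 0 <= \int[mu]_x (`|om n x - w x| `^ p).
  by apply: Rintegral_ge0 => x _; exact: powR_ge0.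
rewrite (ger0_norm I0).
have mexc : measurable_fun setT (fun a => `|excess L a| `^ p).
  by apply: measurable_norm_powR; exact: measurable_excess.
have Leom := Lpfun_excess L0 (Lom n); have Leom0 := Lpfun_excess L0 (Lom0 n).
have Leu := Lpfun_excess L0 (Lu n); have Lew := Lpfun_excess L0 Lw.
have E1 : \int[mu]_x (`|excess L (om n x)| `^ p) <= A * (t + zn).
  rewrite (equidist_Rint (mom n) (Lom0 n).1 (omE n) mexc Leom.2).
  have -> : t = \int[mu]_x (`|excess L (u n x)| `^ p).
    exact: (equidist_Rint mw (Lu n).1 (uE n) mexc Lew.2).
  rewrite -RintegralD//; [|exact: Leu.2|exact: (Lz n).2].
  have iD := integD Leu.2 (Lz n).2.
  rewrite -RintegralZl//; apply: le_Rint; [exact: Leom0.2|exact: (integZ A iD)|].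
  move=> x /=; have := powR_norm_leD (excess L (u n x)) `|om0 n x - u n x| (ltW p0).
  rewrite normr_id; apply: le_trans.
  apply: ge0_ler_powR; rewrite ?nnegrE ?(ltW p0)//.
  by rewrite [leLHS]ger0_norm ?excess_ge0// excess_leD.
pose Tn x := clamp L (om n x) - clamp L (w x).
have mTn : measurable_fun setT Tn by apply: measurable_funB; exact: mT.
have TnL x : `|Tn x| <= L *+ 2 by exact: clampB_norm_le.
have LTn : Lp Tn by exact: (Lpfun_bounded _ (ltW p0) mTn TnL).
have iX : integ (fun x => Tn x ^+ 2).
  apply: (@integ_bounded _ _ _ mu _ ((L *+ 2) ^+ 2)); first exact: measurable_funX.
  by move=> x; rewrite normrX lerXn2r ?nnegrE ?mulrn_wge0.
have E2 : \int[mu]_x (`|Tn x| `^ p) <= e / 4 / (A * M + 1) * M + C * X.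
  have ic : integ (cst (e / 4 / (A * M + 1))) by exact: finite_measure_integrable_cst.
  rewrite -(Rintegral_cst mu measurableT) -RintegralZl// -RintegralD//; last exact: (integZ C iX).
  apply: le_Rint; [exact: LTn.2|exact: (integD ic (integZ C iX))|].
  by move=> x; exact: pC.
have E3 : \int[mu]_x (`|om n x - w x| `^ p) <=
    A * (\int[mu]_x (`|Tn x| `^ p) + A * (\int[mu]_x (`|excess L (om n x)| `^ p) + t)).
  have iee := integD Leom.2 Lew.2.
  have <- : \int[mu]_x (`|excess L (om n x)| `^ p + `|excess L (w x)| `^ p) =
      \int[mu]_x (`|excess L (om n x)| `^ p) + t.
    exact: (RintegralD measurableT Leom.2 Lew.2).
  rewrite -RintegralZl// -RintegralD//; [|exact: LTn.2|exact: (integZ A iee)].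
  have iall := integD LTn.2 (integZ A iee).
  rewrite -RintegralZl//; apply: le_Rint; [exact: (LpfunB _ _ _).2|exact: (integZ A iall)|].
  move=> x /=.
  have -> : om n x - w x = Tn x + ((om n x - clamp L (om n x)) - (w x - clamp L (w x))).
    by rewrite /Tn; ring.
  apply: (le_trans (powR_norm_leD _ _ (ltW p0))); rewrite -/A.
  apply: ler_wpM2l; [exact: ltW|rewrite lerD2l].
  apply: (le_trans (powR_norm_leB _ _ (ltW p0))).
  by rewrite -/A !excessE// (ger0_norm (excess_ge0 L _)) (ger0_norm (excess_ge0 L (w x))).
have b1 : A * (e / 4 / (A * M + 1) * M) <= e / 4.
  rewrite mulrCA -[leRHS](divfK (lt0r_neq0 AM0)) ler_wpM2l ?(ltW etapos)//.
  by rewrite lerDl.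
have b2 : A * C * X <= e / 4.
  apply: (@le_trans _ _ ((A * C + 1) * (e / 4 / (A * C + 1)))); last first.
    by rewrite mulrC divfK// gt_eqF.
  by apply: ler_pM => //; [rewrite mulr_ge0 ?(ltW A0)|rewrite lerDl].
have b3 : (A ^+ 3 + A ^+ 2) * t <= e / 4.
  by rewrite mulrC -ler_pdivlMr.
have b4 : A ^+ 3 * zn <= e / 4.
  by rewrite mulrC -ler_pdivlMr ?exprn_gt0.
pose S1 := A * (e / 4 / (A * M + 1) * M).
apply: (le_trans E3); apply: (@le_trans _ _
    (S1 + A * C * X + (A ^+ 3 + A ^+ 2) * t + A ^+ 3 * zn)); last first.
  have -> : e = e / 4 + e / 4 + e / 4 + e / 4 by field.
  by apply: lerD b4; apply: lerD b3; exact: lerD b1 b2.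
have -> : S1 + A * C * X + (A ^+ 3 + A ^+ 2) * t + A ^+ 3 * zn =
    A * (e / 4 / (A * M + 1) * M + C * X + A * (A * (t + zn) + t)).
  by rewrite /S1; ring.
apply: ler_wpM2l; first exact: ltW.
apply: lerD; first exact: E2.
by apply: ler_wpM2l; [exact: ltW|rewrite lerD2r].
Unshelve. all: by end_near. Qed.

End strong_convergence.

(** * Extraction of convergent subsequences *)

Section diagonal_extraction.
Context {R : realType}.

Lemma bounded_ultra_cvg (U : set_system nat) (a : nat -> R) (C : R) :
  UltraFilter U -> (forall n, `|a n| <= C) ->
  exists A : R, forall eps, 0 < eps -> U [set n | `|a n - A| < eps].
Proof.
move=> uU aC; have cC := @segment_compact R (- C) C.
have UC : (a @ U) `[- C, C]%classic.
  apply: (@filterS _ U _ setT); last exact: filterT.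
  by move=> n _ /=; rewrite in_itv/= -ler_norml.
have [A [_ clA]] := cC _ _ UC.
exists A => eps eps0.
have [//|nU] := in_ultra_setVsetC [set n | `|a n - A| < eps] uU.
have [|r []] := clA (~` ball A eps) (ball A eps) _ (nbhsx_ballx A eps eps0); last by [].
apply: filterS nU => n /=; rewrite /ball/= /ball_ distrC.
exact.
Qed.

(** One ultrafilter finer than the neighbourhoods of infinity provides the limits for all indices at
    once, so a single choice replaces nested subsequences. [n <= phi n] already sends [phi] to
    infinity. *)
Lemma diagonal_extraction (I : countType) (a : nat -> I -> R) (C : R) :
  (forall n i, `|a n i| <= C) ->
  exists2 phi : nat -> nat, (forall n, (n <= phi n)%N) &
    forall i, cvgn (fun n => a (phi n) i).
Proof.
move=> aC; have [U [uU ooU]] := ultraFilterLemma (eventually_filter).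
have limA i := cid (bounded_ultra_cvg uU (fun n => aC n i)).
pose A i := sval (limA i).
have step N : exists n, (N <= n)%N /\
    forall i, (pickle i < N)%N -> `|a n i - A i| < N.+1%:R^-1.
  have UN : U [set n | (N <= n)%N] by apply: ooU; exists N.
  have Uj : \forall n \near U, forall j : 'I_N, forall i, pickle i = j ->
      `|a n i - A i| < N.+1%:R^-1.
    apply: filter_forall => j.
    have [[i ij]|nij] := pselect (exists i : I, pickle i = j).
      have eN : 0 < N.+1%:R^-1 :> R by rewrite invr_gt0.
      apply: filterS (svalP (limA i) _ eN) => n ni i' i'j.
      by have -> : i' = i by apply: (pcan_inj (@pickleK I)); rewrite ij.
    by apply: (@filterS _ U _ setT); [move=> n _ i ij; case: nij; exists i|exact: filterT].
  have [n [Nn nj]] := filter_ex (filterI UN Uj).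
  by exists n; split => // i iN; exact: (nj (Ordinal iN)).
have [phi phiP] := choice step.
exists phi => [n|i]; first exact: (phiP n).1.
apply/cvg_ex; exists (A i); apply/(@cvgrPdist_lt _ R) => eps eps0.
near=> n; rewrite distrC (lt_trans ((phiP n).2 i _))//.
  by near: n; exists (pickle i).+1.
near: n; exact: near_infty_natSinv_lt (PosNum eps0).
Unshelve. all: by end_near. Qed.

(** The approximants may have limits that change with [eps], hence the Cauchy criterion. *)
Lemma cvgn_uniform_approx (b : nat -> R) :
  (forall eps, 0 < eps -> exists2 b' : nat -> R, cvgn b' &
    \forall n \near \oo, `|b n - b' n| <= eps) -> cvgn b.
Proof.
move=> approx; apply/cauchy_cvgP/cauchy_ballP => eps eps0; near_simpl.
have e4 : 0 < eps / 4 by rewrite divr_gt0.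
have [b' cb' bb'] := approx _ e4.
have {}cb' : \forall n \near \oo, `|limn b' - b' n| < eps / 4.
  by move/cvgrPdist_lt : cb'; apply.
near=> m n => /=; rewrite /ball/= /ball_.
have -> : b m - b n = (b m - b' m) - (limn b' - b' m) +
   ((limn b' - b' n) - (b n - b' n)) by ring.
have m1 : `|b m - b' m| <= eps / 4 by near: m.
have m2 : `|limn b' - b' m| < eps / 4 by near: m.
have n1 : `|b n - b' n| <= eps / 4 by near: n.
have n2 : `|limn b' - b' n| < eps / 4 by near: n.
rewrite (le_lt_trans (ler_normD _ _))//.
have := ler_normB (b m - b' m) (limn b' - b' m).
have := ler_normB (limn b' - b' n) (b n - b' n).
lra.
Unshelve. all: by end_near. Qed.

Lemma cvgn_sub (b : nat -> R) (phi : nat -> nat) (A : R) :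
  (forall n, (n <= phi n)%N) -> b n @[n --> \oo] --> A ->
  b (phi n) @[n --> \oo] --> A.
Proof.
move=> nphi bA; apply: (cvg_comp phi b _ bA) => P [N _ NP].
by exists N => // n /= Nn; apply: NP; exact: leq_trans (nphi n).
Qed.

Lemma cvgn_sqr0 (b : nat -> R) :
  b n ^+ 2 @[n --> \oo] --> 0 -> b n @[n --> \oo] --> 0.
Proof.
move=> b0; apply/(@cvgr0Pnorm_lt R R) => eps eps0.
have e2 : 0 < eps ^+ 2 by rewrite exprn_gt0.
have /cvgr0Pnorm_lt/(_ _ e2) := b0; apply: filterS => n.
by rewrite normrX ltr_pXn2r ?nnegrE ?(ltW eps0).
Qed.

End diagonal_extraction.

(** * Maximizing sequences for a positive definite kernel *)

Section gap.
Context {R : realType}.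

(** [Fu], [Fv], [Fw] stand for the values at a maximizer, at [v_n] and at the rearrangement [w], [B]
    for half the quadratic form at [w - v_n], and [I1], [I2] for the linear terms with the stream
    function of [v_n] and with its limit. *)
Lemma gap_le (Fu Fv Fw B I1 I2 a b r : R) : Fw - Fv = I1 + B ->
  `|Fv - Fu| <= b -> `|I1 - I2| <= r -> - a <= I2 -> Fu - (b + a + r) + B <= Fw.
Proof. by rewrite !ler_norml => E /andP[? ?] /andP[? ?] ?; lra. Qed.

Lemma gap_le_half (Fu Fw B E : R) : Fu - E + B <= Fw -> Fw <= Fu -> B <= E.
Proof. by move=> *; lra. Qed.

Lemma gap_le_max (Ff Fu Fw B E : R) :
  Fu - E + B <= Fw -> Ff <= Fu -> 0 <= B -> Ff - Fw <= E.
Proof. by move=> *; lra. Qed.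

Lemma gap_moment (m B E c : R) :
  0 < c -> c * m ^+ 2 <= B -> 2^-1 * B <= E -> m ^+ 2 <= 2 / c * E.
Proof. by move=> c0 mB BE; rewrite mulrAC ler_pdivlMr// mulrC; lra. Qed.

End gap.

Section kernel.
Context d (T : measurableType d) (R : realType).
Variable mu : {finite_measure set T -> \bar R}.
Variables p q : R.
Hypotheses (p0 : 0 < p) (q0 : 0 < q) (pq : p^-1 + q^-1 = 1).
Variables (I : countType) (s : nat -> seq I) (c : I -> R) (e : I -> T -> R).
Variables (k kappa : T -> T -> R) (h : T -> R) (K : R).
Hypothesis c0 : forall i, 0 <= c i.
Hypothesis me : forall i, measurable_fun setT (e i).
Hypothesis e1 : forall i x, `|e i x| <= 1.
Hypothesis sc : forall i, 0 < c i -> \forall n \near \oo, i \in s n.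
Hypothesis mh : measurable_fun setT h.
Hypothesis h0 : forall t, mu [set x | h x = t] = 0%E.
Hypothesis mk : forall x, measurable_fun setT (k x).
Hypothesis Lkappa : forall x, Lpfun mu q (kappa x).
Hypothesis kappaK : forall x, \int[mu]_y (`|kappa x y| `^ q) <= K.

(** Finite-rank positive truncations. They are controlled only off the set [h x = h y], which is to
    contain the singularity and is null in [y] for each [x]; the same [h] later breaks the ties. *)
Let kN n x y := \sum_(i <- s n) c i * e i x * e i y.

Hypothesis kN_le : forall n x y, h x != h y -> `|kN n x y| <= kappa x y.
Hypothesis kN_cvg : forall x y, h x != h y -> kN n x y @[n --> \oo] --> k x y.

Implicit Types (f g u v w : T -> R).

Local Notation integ f := (mu.-integrable setT (EFin \o f)).
Local Notation Lp := (Lpfun mu p).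
Local Notation Lq := (Lpfun mu q).

Definition moment i v : R := \int[mu]_y (e i y * v y).

Definition potential v x : R := \int[mu]_y (k x y * v y).

Let GN n v x : R := \int[mu]_y (kN n x y * v y).

Let ae_neq x : {ae mu, forall y, h x != h y}.
Proof.
exists [set y | h y = h x]; split.
- by rewrite (_ : [set y | _] = h @^-1` [set h x])//; exact: measurable_preimage.
- exact: h0.
- by move=> y /= /negP; rewrite negbK => /eqP.
Qed.

Let k_le x y : h x != h y -> `|k x y| <= kappa x y.
Proof.
move=> xy; have kc : `|kN n x y| @[n --> \oo] --> `|k x y|.
  by apply: cvg_norm; exact: kN_cvg.
by apply: (cvgr_to_le kc); apply: nearW => n; exact: kN_le.
Qed.

Let mkN n x : measurable_fun setT (kN n x).
Proof. by apply: measurable_sum => i; apply: measurable_funM. Qed.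

Let Lq_dom g x : measurable_fun setT g ->
  (forall y, h x != h y -> `|g y| <= kappa x y) -> Lq g.
Proof.
move=> mg gk; split => //; apply: (le_integ_ae _ (Lkappa x).2).
  exact: measurable_norm_powR.
apply: filterS (ae_neq x) => y xy; rewrite ger0_norm ?powR_ge0//.
apply: ge0_ler_powR; rewrite ?nnegrE ?(ltW q0)//.
by rewrite (le_trans (gk _ xy))// ler_norm.
Qed.

Let Lk x : Lq (k x). Proof. by apply: (@Lq_dom _ x) => // y; exact: k_le. Qed.

Let LkN n x : Lq (kN n x).
Proof. by apply: (@Lq_dom _ x) => // y; exact: kN_le. Qed.

Lemma moment_integ i v : Lp v -> integ (fun y => e i y * v y).
Proof.
move=> Lv; apply: (Lpfun_mul p0 q0 pq) => //.
exact: (@Lpfun_bounded _ _ _ _ _ _ 1 (ltW q0)).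
Qed.

Lemma momentB i u v : Lp u -> Lp v ->
  moment i (u \- v) = moment i u - moment i v.
Proof.
move=> Lu Lv; rewrite /moment -RintegralB//; try exact: moment_integ.
by apply: eq_Rintegral => y _ /=; rewrite mulrBr.
Qed.

Let GNE n v x : Lp v -> GN n v x = \sum_(i <- s n) c i * e i x * moment i v.
Proof.
move=> Lv; rewrite /GN.
under eq_Rintegral do rewrite /kN mulr_suml.
rewrite Rint_sum; last first.
  move=> i; have := integZ (c i * e i x) (moment_integ i Lv).
  by apply: eq_integrable => // y _ /=; rewrite mulrA.
apply: eq_bigr => i _; rewrite /moment -RintegralZl//; last exact: moment_integ.
by apply: eq_Rintegral => y _; rewrite mulrA.
Qed.

Let mGN n v : Lp v -> measurable_fun setT (GN n v).
Proof.
move=> Lv; rewrite (_ : GN n v = fun x => \sum_(i <- s n) c i * e i x * moment i v).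
  by apply: measurable_sum => i; do 2 apply: measurable_funM => //.
by apply/funext => x; exact: GNE.
Qed.

(** At a fixed [x] the error of truncation is uniform over a ball of Lp; this is what turns
    convergence of the moments into pointwise convergence of the potentials. *)
Lemma potential_uniform x (C eps : R) : 0 < eps ->
  \forall n \near \oo, forall v, Lp v -> \int[mu]_y (`|v y| `^ p) <= C ->
    `|potential v x - \sum_(i <- s n) c i * e i x * moment i v| <= eps.
Proof.
move=> eps0; pose b n y := k x y - kN n x y.
have mb n : measurable_fun setT (b n) by exact: measurable_funB.
have L2 : Lq (fun y => 2 * kappa x y).
  split; first by apply: measurable_funM => //; exact: (Lkappa x).1.
  have := integZ (2 `^ q) (Lkappa x).2; apply: eq_integrable => // y _ /=.
  by rewrite normrM powRM// ger0_norm.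
have b_le n : {ae mu, forall y, `|b n y| <= `|2 * kappa x y|}.
  apply: filterS (ae_neq x) => y xy.
  rewrite (le_trans (ler_normB _ _))// mulr_natl mulr2n (le_trans _ (ler_norm _))//.
  by rewrite lerD ?k_le ?kN_le.
have b_0 : {ae mu, forall y, b n y @[n --> \oo] --> 0}.
  apply: filterS (ae_neq x) => y xy; rewrite -(subrr (k x y)).
  by apply: cvgB; [exact: cvg_cst|exact: kN_cvg].
have := Lpfun_vanish p0 q0 pq mb L2 b_le b_0 C eps0.
apply: filterS => n bn v Lv vC; apply: le_trans (bn v Lv vC).
have ikv := Lpfun_mul p0 q0 pq (Lk x) Lv.
have ikNv := Lpfun_mul p0 q0 pq (LkN n x) Lv.
rewrite -GNE// /potential /GN -RintegralB//.
have ibv : integ (fun y => b n y * v y).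
  have := integB ikv ikNv; apply: eq_integrable => // y _ /=.
  by rewrite -mulrBl.
rewrite (_ : \int[mu]_y _ = \int[mu]_y (b n y * v y)); last first.
  by apply: eq_Rintegral => y _; rewrite -mulrBl.
exact: le_normr_Rintegral.
Qed.

Let GN_cvg v x : Lp v -> GN n v x @[n --> \oo] --> potential v x.
Proof.
move=> Lv; apply/(@cvgrPdist_le _ R) => eps eps0.
have := potential_uniform x (\int[mu]_y (`|v y| `^ p)) eps0.
by apply: filterS => n /(_ v Lv (lexx _)); rewrite -GNE.
Qed.

Lemma measurable_potential v : Lp v -> measurable_fun setT (potential v).
Proof.
move=> Lv; apply: (@measurable_fun_cvg _ _ _ _ (fun n => GN n v)) => [n|x _].
  exact: mGN.
exact: GN_cvg.
Qed.

Lemma potential_bounded (C : R) : exists D : R, forall v, Lp v ->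
  \int[mu]_y (`|v y| `^ p) <= C -> forall x, `|potential v x| <= D.
Proof.
have [C1 C10 yC] := Lpfun_young mu p0 q0 pq (@ltr01 R).
exists (C + C1 * K) => v Lv vC x.
have ikv := Lpfun_mul p0 q0 pq (Lk x) Lv.
apply: (le_trans (le_normr_Rintegral measurableT ikv)).
apply: (le_trans (yC _ _ (Lk x) Lv)); rewrite mul1r lerD// ler_wpM2l//.
apply: le_trans (kappaK x); apply: le_Rint_ae; [exact: (Lk x).2|exact: (Lkappa x).2|].
apply: filterS (ae_neq x) => y xy; apply: ge0_ler_powR; rewrite ?nnegrE ?(ltW q0)//.
by rewrite (le_trans (k_le xy))// ler_norm.
Qed.

Let GN_bounded (C : R) : exists D : R, forall n v, Lp v ->
  \int[mu]_y (`|v y| `^ p) <= C -> forall x, `|GN n v x| <= D.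
Proof.
have [C1 C10 yC] := Lpfun_young mu p0 q0 pq (@ltr01 R).
exists (C + C1 * K) => n v Lv vC x.
have ikv := Lpfun_mul p0 q0 pq (LkN n x) Lv.
apply: (le_trans (le_normr_Rintegral measurableT ikv)).
apply: (le_trans (yC _ _ (LkN n x) Lv)); rewrite mul1r lerD// ler_wpM2l//.
apply: le_trans (kappaK x); apply: le_Rint_ae; [exact: (LkN n x).2|exact: (Lkappa x).2|].
apply: filterS (ae_neq x) => y xy; apply: ge0_ler_powR; rewrite ?nnegrE ?(ltW q0)//.
by rewrite (le_trans (kN_le n xy))// ler_norm.
Qed.

Lemma integ_bounded_mul g u (D : R) : measurable_fun setT g ->
  (forall x, `|g x| <= D) -> integ u -> integ (fun x => g x * u x).
Proof.
move=> mg gD iu; apply: (le_integ _ (integZ D (integrable_norm iu))).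
  by apply: measurable_funM => //; exact: (integ_measurable iu).
by move=> x; rewrite normrM ler_wpM2r.
Qed.

Lemma integ_potential_mul u v : Lp u -> Lp v ->
  integ (fun x => potential v x * u x).
Proof.
move=> Lu Lv; have [D /(_ v Lv (lexx _)) vD] :=
  potential_bounded (\int[mu]_y (`|v y| `^ p)).
apply: integ_bounded_mul vD _; first exact: measurable_potential.
exact: (Lpfun_integ p0 q0 pq Lu).
Qed.

Lemma potentialB u v x : Lp u -> Lp v ->
  potential (u \- v) x = potential u x - potential v x.
Proof.
move=> Lu Lv; rewrite /potential -RintegralB//.
- by apply: eq_Rintegral => y _ /=; rewrite mulrBr.
- exact: (Lpfun_mul p0 q0 pq (Lk x) Lu).
- exact: (Lpfun_mul p0 q0 pq (Lk x) Lv).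
Qed.

Definition bienergy u v : R := \int[mu]_x (potential v x * u x).

Lemma bienergy_cvg u v : Lp u -> Lp v ->
  (\sum_(i <- s n) c i * moment i u * moment i v) @[n --> \oo] --> bienergy u v.
Proof.
move=> Lu Lv.
have [D GD] := GN_bounded (\int[mu]_y (`|v y| `^ p)).
have iu := Lpfun_integ p0 q0 pq Lu.
rewrite (_ : (fun n => _) = fun n => \int[mu]_x (GN n v x * u x)); last first.
  apply/funext => n; under [RHS]eq_Rintegral do rewrite GNE// mulr_suml.
  rewrite Rint_sum => [|i]; last first.
    have := integZ (c i * moment i v) (moment_integ i Lu).
    by apply: eq_integrable => // x _ /=; congr EFin; ring.
  apply: eq_bigr => i _; rewrite mulrAC /moment -RintegralZl//; last exact: moment_integ.
  by apply: eq_Rintegral => x _; rewrite /moment; ring.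
apply: (@Rint_dominated _ _ _ _ _ _ (fun x => `|D| * `|u x|)).
- by move=> n; apply: measurable_funM; [exact: mGN|exact: Lu.1].
- by apply: measurable_funM; [exact: measurable_potential|exact: Lu.1].
- by apply: aeW => x; apply: cvgM; [exact: GN_cvg|exact: cvg_cst].
- exact: (integZ _ (integrable_norm iu)).
- move=> n; apply: aeW => x; rewrite normrM ler_wpM2r//.
  by rewrite (le_trans (GD n v Lv (lexx _) x))// ler_norm.
Qed.

(** Symmetry is read off the truncated series, without exchanging the order of integration. *)
Lemma bienergy_sym u v : Lp u -> Lp v -> bienergy u v = bienergy v u.
Proof.
move=> Lu Lv; apply: (cvg_unique _ (bienergy_cvg Lu Lv)) => //.
rewrite (_ : (fun n => _) = fun n => \sum_(i <- s n) c i * moment i v * moment i u).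
  exact: bienergy_cvg.
by apply/funext => n; apply: eq_bigr => i _; rewrite mulrAC.
Qed.

(** A term with positive coefficient eventually occurs in the truncations, and all other terms are
    nonnegative. Thus a vanishing energy forces the moments to vanish. *)
Lemma moment_le_bienergy i v : Lp v -> c i * moment i v ^+ 2 <= bienergy v v.
Proof.
have pos j w : 0 <= c j * moment j w * moment j w.
  by rewrite -mulrA mulr_ge0// -expr2 sqr_ge0.
move=> Lv; apply: (cvgr_to_ge (bienergy_cvg Lv Lv)).
have := c0 i; rewrite le_eqVlt => /predU1P[<-|ci0].
  by apply: nearW => n; rewrite mul0r sumr_ge0.
apply: filterS (sc ci0) => n isn.
by rewrite (big_rem i)//= -mulrA -expr2 lerDl sumr_ge0.
Qed.

Lemma bienergy_ge0 v : Lp v -> 0 <= bienergy v v.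
Proof.
move=> Lv; apply: (cvgr_to_ge (bienergy_cvg Lv Lv)); apply: nearW => n.
by apply: sumr_ge0 => i _; rewrite -mulrA mulr_ge0// -expr2 sqr_ge0.
Qed.

Variables (l : T -> R) (lam : R).
Hypothesis ml : measurable_fun setT l.
Hypothesis l1 : forall x, `|l x| <= 1.

Definition functional v : R :=
  2^-1 * bienergy v v - lam * \int[mu]_x (l x * v x).

(** The functional is quadratic, so its expansion at [v] is exact; the remainder is a nonnegative
    energy and is the source of coercivity. *)
Lemma functionalB w v : Lp w -> Lp v ->
  functional w - functional v =
  \int[mu]_x ((potential v x - lam * l x) * (w x - v x)) +
  2^-1 * bienergy (w \- v) (w \- v).
Proof.
move=> Lw Lv.
have iw := Lpfun_integ p0 q0 pq Lw; have iv := Lpfun_integ p0 q0 pq Lv.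
have ilw : integ (fun x => l x * w x) := integ_bounded_mul ml l1 iw.
have ilv : integ (fun x => l x * v x) := integ_bounded_mul ml l1 iv.
have ivw := integ_potential_mul Lw Lv; have ivv := integ_potential_mul Lv Lv.
have iww := integ_potential_mul Lw Lw; have iwv := integ_potential_mul Lv Lw.
have E1 : \int[mu]_x ((potential v x - lam * l x) * (w x - v x)) =
    bienergy w v - bienergy v v -
    lam * (\int[mu]_x (l x * w x) - \int[mu]_x (l x * v x)).
  rewrite /bienergy -RintegralB// -RintegralB// -RintegralZl//; last exact: integB.
  rewrite -RintegralB//; [|exact: integB|exact: (integZ lam (integB ilw ilv))].
  by apply: eq_Rintegral => x _; ring.
have E2 : bienergy (w \- v) (w \- v) =
    (bienergy w w - bienergy v w) - (bienergy w v - bienergy v v).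
  rewrite /bienergy -!RintegralB//; try exact: integB.
  by apply: eq_Rintegral => x _ /=; rewrite potentialB//; ring.
rewrite E1 E2 /functional (bienergy_sym Lv Lw).
have alg (a b a' r t : R) : 2^-1 * a - lam * r - (2^-1 * a' - lam * t) =
    b - a' - lam * (r - t) + 2^-1 * (a - b - (b - a')) by field.
exact: alg.
Qed.

Lemma moment_bounded (C : R) : exists D : R, forall i v, Lp v ->
  \int[mu]_y (`|v y| `^ p) <= C -> `|moment i v| <= D.
Proof.
have [C1 C10 yC] := Lpfun_young mu p0 q0 pq (@ltr01 R).
exists (C + C1 * fine (mu setT)) => i v Lv vC.
have Le : Lq (e i) := @Lpfun_bounded _ _ _ _ _ _ 1 (ltW q0) (me i) (e1 i).
apply: (le_trans (le_normr_Rintegral measurableT (moment_integ i Lv))).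
apply: (le_trans (yC _ _ Le Lv)); rewrite mul1r lerD// ler_wpM2l//.
rewrite -[leRHS]mul1r -(Rintegral_cst mu measurableT); apply: le_Rint.
- exact: Le.2.
- exact: finite_measure_integrable_cst.
- move=> y; apply: (@le_trans _ _ (1 `^ q)); last by rewrite powR1.
  by apply: ge0_ler_powR; rewrite ?nnegrE ?(ltW q0).
Qed.

Lemma potential_cvgn (v : nat -> T -> R) (C : R) x : (forall n, Lp (v n)) ->
  (forall n, \int[mu]_y (`|v n y| `^ p) <= C) ->
  (forall i, cvgn (fun n => moment i (v n))) -> cvgn (fun n => potential (v n) x).
Proof.
move=> Lv vC mv; apply: cvgn_uniform_approx => eps eps0.
have [N _ /(_ _ (leqnn N)) PN] := potential_uniform x C eps0.
exists (fun n => \sum_(i <- s N) c i * e i x * moment i (v n)).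
  apply/cvg_ex; exists (\sum_(i <- s N) c i * e i x * limn (fun n => moment i (v n))).
  elim: (s N) => [|i r ih].
    by rewrite big_nil; under eq_fun do rewrite big_nil; exact: cvg_cst.
  rewrite big_cons; under eq_fun do rewrite big_cons.
  by apply: cvgD ih; apply: cvgM; [exact: cvg_cst|exact: mv].
by apply: nearW => n; exact: PN.
Qed.

(** Only the moments with [0 < c i] are asked to vanish: these are the ones that the energy
    controls. *)
Hypothesis moments_dense : forall z : nat -> T -> R, (forall n, Lp (z n)) ->
  (exists C : R, forall n, \int[mu]_x (`|z n x| `^ p) <= C) ->
  (forall i, 0 < c i -> moment i (z n) @[n --> \oo] --> 0) ->
  forall f (C : R), measurable_fun setT f -> (forall x, `|f x| <= C) ->
    \int[mu]_x (f x * z n x) @[n --> \oo] --> 0.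

Lemma functional_lipschitz (C : R) : exists D : R, forall u v,
  Lp u -> Lp v -> \int[mu]_x (`|v x| `^ p) <= C ->
  \int[mu]_x (`|u x - v x| `^ p) <= 1 ->
  `|functional u - functional v| <= D * \int[mu]_x `|u x - v x|.
Proof.
have [D1 pD1] := potential_bounded C; have [D2 pD2] := potential_bounded 1.
exists (D1 + `|lam| + 2^-1 * D2) => u v Lu Lv vC uv1.
have Luv : Lp (u \- v) by exact: LpfunB.
have iuv := Lpfun_integ p0 q0 pq Luv.
have mpv := measurable_potential Lv; have mpuv := measurable_potential Luv.
have bd1 x : `|potential v x - lam * l x| <= D1 + `|lam|.
  rewrite (le_trans (ler_normB _ _))// lerD ?pD1// normrM.
  by rewrite ler_piMr.
have bd2 x : `|potential (u \- v) x| <= D2 by exact: pD2.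
have m1 : measurable_fun setT (fun x => potential v x - lam * l x).
  by apply: measurable_funB => //; exact: measurable_funM.
have i1 := integ_bounded_mul m1 bd1 iuv; have i2 := integ_bounded_mul mpuv bd2 iuv.
rewrite functionalB// mulrDl (le_trans (ler_normD _ _))// lerD//.
  rewrite -RintegralZl//; last exact: (integrable_norm iuv).
  apply: le_norm_Rint => //; first exact: (integZ _ (integrable_norm iuv)).
  by move=> x; rewrite normrM ler_wpM2r.
rewrite normrM (ger0_norm (_ : 0 <= 2^-1)) ?invr_ge0// -mulrA ler_wpM2l ?invr_ge0//.
rewrite -RintegralZl//; last exact: (integrable_norm iuv).
apply: le_norm_Rint => //; first exact: (integZ _ (integrable_norm iuv)).
by move=> x; rewrite normrM ler_wpM2r.
Qed.

Definition maximal v0 w := forall v, measurable_fun setT v -> equidist mu v0 v ->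
  functional v <= functional w.

(** The maximizers [u n] may vary with [n] and no limit of them is taken; their distance to [om0 n]
    enters the comparisons as the error [z1n]. One good index for each [eps] suffices for a proof of
    stability by contradiction. *)
Theorem maximizing_sequence_cvg v0 (om om0 u : nat -> T -> R) :
  Lp v0 -> (forall n, Lp (om n)) -> (forall n, Lp (om0 n)) ->
  (forall n, measurable_fun setT (u n)) -> (forall n, equidist mu v0 (u n)) ->
  (forall n, maximal v0 (u n)) ->
  (forall n, equidist mu (om n) (om0 n)) ->
  (forall n, functional (om n) = functional (om0 n)) ->
  (forall n, \int[mu]_x (`|om0 n x - u n x| `^ p) <= 1) ->
  \int[mu]_x (`|om0 n x - u n x| `^ p) @[n --> \oo] --> 0 ->
  exists w, [/\ measurable_fun setT w, equidist mu v0 w, maximal v0 w &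
    forall eps : R, 0 < eps -> exists n, \int[mu]_x (`|om n x - w x| `^ p) < eps].
Proof.
move=> Lv0 Lom Lom0 mu_ v0u umax omE Fom z1 z0.
pose P0 := \int[mu]_x (`|v0 x| `^ p).
have mpw : measurable_fun setT (fun a : R => `|a| `^ p) by exact: measurable_norm_powR.
have Lv v : measurable_fun setT v -> equidist mu v0 v ->
    Lp v /\ \int[mu]_x (`|v x| `^ p) = P0.
  move=> mv vv; split; first exact: equidist_Lpfun vv Lv0.
  by symmetry; exact: (equidist_Rint Lv0.1 mv vv mpw Lv0.2).
have Lu n : Lp (u n) by exact: (Lv _ (mu_ n) (v0u n)).1.
pose C := 2 `^ p * (1 + P0).
have Lz n : Lp (om0 n \- u n) by exact: LpfunB.
have omC n : \int[mu]_x (`|om n x| `^ p) <= C.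
  rewrite (equidist_Rint (Lom n).1 (Lom0 n).1 (omE n) mpw (Lom n).2).
  apply: (@le_trans _ _ (\int[mu]_x (2 `^ p * (`|om0 n x - u n x| `^ p + `|u n x| `^ p)))).
    apply: le_Rint; [exact: (Lom0 n).2|exact: (integZ _ (integD (Lz n).2 (Lu n).2))|].
    by move=> x; have := powR_norm_leD (om0 n x - u n x) (u n x) (ltW p0); rewrite subrK.
  rewrite (RintegralZl _ measurableT (integD (Lz n).2 (Lu n).2)).
  apply: ler_wpM2l; first exact: powR_ge0.
  apply: (@le_trans _ _ (\int[mu]_x (`|om0 n x - u n x| `^ p) +
      \int[mu]_x (`|u n x| `^ p))).
    by rewrite le_eqVlt; apply/orP; left; apply/eqP;
      exact: (RintegralD measurableT (Lz n).2 (Lu n).2).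
  by apply: lerD; [exact: z1|rewrite (Lv _ (mu_ n) (v0u n)).2].
have [Dm mD] := moment_bounded C.
have [phi nphi mphi] := diagonal_extraction (fun n i => mD i _ (Lom n) (omC n)).
pose v n := om (phi n); pose v' n := om0 (phi n); pose u' n := u (phi n).
have pcv x : cvgn (fun n => potential (v n) x).
  exact: (@potential_cvgn v C x (fun n => Lom (phi n)) (fun n => omC (phi n)) mphi).
pose psi x := limn (fun n => potential (v n) x).
have [D pD] := potential_bounded C.
have pvD n x : `|potential (v n) x| <= D by exact: (pD _ (Lom _) (omC _) x).
have psiD x : `|psi x| <= D.
  have nc : `|potential (v n) x| @[n --> \oo] --> `|psi x|.
    by apply: cvg_norm; exact: pcv.
  by apply: (cvgr_to_le nc); apply: nearW => n; exact: pvD.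
have mpsi : measurable_fun setT psi.
  apply: (@measurable_fun_cvg _ _ _ _ (fun n => potential (v n))) => [n|x _].
    exact: (measurable_potential (Lom _)).
  exact: pcv.
pose Psi x := psi x - lam * l x; pose DP := `|D| + `|lam|.
have mPsi : measurable_fun setT Psi.
  by apply: measurable_funB => //; exact: measurable_funM.
have PsiD x : `|Psi x| <= DP.
  apply: (le_trans (ler_normB _ _)); apply: lerD.
    exact: le_trans (psiD x) (ler_norm D).
  by rewrite normrM ler_piMr.
have [w [mw v0w [N N0 wN]]] := comonotone_rearrangement mPsi mh Lv0.1 h0.
have [Lw wP] := Lv _ mw v0w.
have iw := Lpfun_integ p0 q0 pq Lw.
have Lvn n : Lp (v n) by exact: Lom.
have iv n := Lpfun_integ p0 q0 pq (Lvn n).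
have Lwv n : Lp (w \- v n) by exact: LpfunB.
have iwv n := Lpfun_integ p0 q0 pq (Lwv n).
pose z1n n := \int[mu]_x `|v' n x - u' n x|.
have z1n0 : z1n n @[n --> \oo] --> 0.
  exact: (cvgn_sub nphi (Lpfun_cvg_L1 p0 q0 pq Lz z0)).
have bath n : \int[mu]_x (Psi x * (v n x - w x)) <= DP * z1n n.
  have DP0 : 0 <= DP by rewrite addr_ge0.
  exact: (comonotone_maximal mPsi DP0 PsiD N0 wN (iv n)
    (Lpfun_integ p0 q0 pq (Lom0 _)) iw (Lpfun_integ p0 q0 pq (Lu _)) (omE _)
    (equidist_trans (equidist_sym v0w) (v0u _))).
(* Error of replacing the potential of [v n] by its pointwise limit. The other factor moves with
   [n], so the uniformity in [Lpfun_vanish] is essential. *)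
pose rn n := \int[mu]_x `|(potential (v n) x - psi x) * (w x - v n x)|.
have rn0 : rn n @[n --> \oo] --> 0.
  have mb n : measurable_fun setT (fun x => potential (v n) x - psi x).
    exact: measurable_funB (measurable_potential (Lom _)) mpsi.
  have L2D : Lq (cst (D *+ 2)).
    by apply: (@Lpfun_bounded _ _ _ _ _ _ `|D *+ 2| (ltW q0)) => // x; exact: lexx.
  have b_le n : {ae mu, forall x, `|potential (v n) x - psi x| <= `|cst (D *+ 2) x|}.
    apply: aeW => x; apply: (le_trans (ler_normB _ _)); apply: (le_trans _ (ler_norm _)).
    by rewrite /= mulr2n; apply: lerD; [exact: pvD|exact: psiD].
  have b_0 : {ae mu, forall x, potential (v n) x - psi x @[n --> \oo] --> 0}.
    apply: aeW => x; rewrite -(subrr (psi x)); apply: cvgB; last exact: cvg_cst.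
    exact: pcv.
  apply/(@cvgr0Pnorm_le R R) => r r0.
  apply: filterS (Lpfun_vanish p0 q0 pq mb L2D b_le b_0 (2 `^ p * (P0 + C)) r0) => n bn.
  rewrite ger0_norm; last exact: Rintegral_ge0.
  apply: (bn _ (Lwv n)); apply: (le_trans (Lpfun_intB_le p0 Lw (Lvn n))).
  by apply: ler_wpM2l; [exact: powR_ge0|rewrite wP lerD2l; exact: omC].
have ipl n : integ (fun x => (potential (v n) x - lam * l x) * (w x - v n x)).
  apply: (@integ_bounded_mul _ _ (D + `|lam|)) (iwv n).
    apply: measurable_funB; first exact: (measurable_potential (Lom _)).
    exact: measurable_funM.
  move=> x; apply: (le_trans (ler_normB _ _)); apply: lerD; first exact: pvD.
  by rewrite normrM ler_piMr.
have iPsi n : integ (fun x => Psi x * (w x - v n x)).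
  exact: integ_bounded_mul mPsi PsiD (iwv n).
have [D3 FD] := functional_lipschitz P0.
have Fom' n : `|functional (v n) - functional (u' n)| <= D3 * z1n n.
  rewrite /v Fom; apply: FD; [exact: Lom0|exact: Lu| |exact: z1].
  by rewrite (Lv _ (mu_ (phi n)) (v0u (phi n))).2.
pose En n := (D3 + DP) * z1n n + rn n.
have En0 : En n @[n --> \oo] --> 0.
  have h1 : En n @[n --> \oo] --> (D3 + DP) * 0 + 0.
    apply: cvgD; last exact: rn0.
    by apply: cvgM; [exact: cvg_cst|exact: z1n0].
  by rewrite mulr0 addr0 in h1.
have lin n : `|\int[mu]_x ((potential (v n) x - lam * l x) * (w x - v n x)) -
    \int[mu]_x (Psi x * (w x - v n x))| <= rn n.
  rewrite -(RintegralB measurableT (ipl n) (iPsi n)).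
  rewrite (_ : \int[mu]_x _ =
      \int[mu]_x ((potential (v n) x - psi x) * (w x - v n x))); last first.
    by apply: eq_Rintegral => x _; rewrite /Psi; ring.
  apply: le_normr_Rintegral => //.
  have := integB (ipl n) (iPsi n); apply: eq_integrable => // x _ /=.
  by congr EFin; rewrite /Psi; ring.
have lin_ge n : - (DP * z1n n) <= \int[mu]_x (Psi x * (w x - v n x)).
  rewrite lerNl; apply: le_trans (bath n); rewrite -mulN1r -RintegralZl//.
  rewrite le_eqVlt; apply/orP; left; apply/eqP.
  by apply: eq_Rintegral => x _; ring.
have gap n : functional (u' n) - En n + 2^-1 * bienergy (w \- v n) (w \- v n) <=
    functional w.
  rewrite /En mulrDl.
  exact: gap_le (functionalB Lw (Lvn n)) (Fom' n) (lin n) (lin_ge n).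
(* [w] is itself a competitor, so its value is at most that of [u' n], and the gap inequality bounds
   the energy of the difference. *)
have Bn n : 2^-1 * bienergy (w \- v n) (w \- v n) <= En n.
  exact: gap_le_half (gap n) (umax (phi n) w mw v0w).
(* Every competitor is below [u' n], hence below [w] up to [En n], which tends to 0. *)
have wmax : maximal v0 w.
  move=> f mf v0f; rewrite -subr_le0; apply: (cvgr_to_ge En0); apply: nearW => n.
  have B0 : 0 <= 2^-1 * bienergy (w \- v n) (w \- v n).
    by rewrite mulr_ge0 ?invr_ge0// bienergy_ge0.
  exact: gap_le_max (gap n) (umax (phi n) f mf v0f) B0.
exists w; split; [exact: mw|exact: v0w|exact: wmax|move=> eps eps0].
have mom0 i : 0 < c i -> moment i (v n \- w) @[n --> \oo] --> 0.
  move=> ci0; apply: cvgn_sqr0.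
  have up : (2 / c i) * En n @[n --> \oo] --> 0.
    have h1 : (2 / c i) * En n @[n --> \oo] --> (2 / c i) * 0.
      by apply: cvgM; [exact: cvg_cst|exact: En0].
    by rewrite mulr0 in h1.
  apply: (squeeze_cvgr _ (cvg_cst 0) up); apply: nearW => n.
  rewrite sqr_ge0 andTb (momentB i (Lvn n) Lw) -sqrrN opprB -(momentB i Lw (Lvn n)).
  exact: gap_moment ci0 (moment_le_bienergy i (Lwv n)) (Bn n).
have weak f (C' : R) : measurable_fun setT f -> (forall x, `|f x| <= C') ->
    \int[mu]_x (f x * (v n x - w x)) @[n --> \oo] --> 0.
  apply: (moments_dense (z := fun n => v n \- w)).
  - by move=> n; exact: LpfunB.
  - exists (2 `^ p * (C + P0)) => n.
    apply: (le_trans (Lpfun_intB_le p0 (Lvn n) Lw)).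
    by apply: ler_wpM2l; [exact: powR_ge0|rewrite wP lerD2r; exact: omC].
  - exact: mom0.
have strong : \int[mu]_x (`|v n x - w x| `^ p) @[n --> \oo] --> 0.
  exact: (Lpfun_strong_cvg p0 q0 pq Lw Lvn (fun n => Lom0 (phi n))
    (fun n => Lu (phi n)) (fun n => omE (phi n))
    (fun n => equidist_trans (equidist_sym v0w) (v0u (phi n)))
    (cvgn_sub nphi z0) weak).
have /cvgr0Pnorm_lt/(_ _ eps0)[n0 _ /(_ _ (leqnn n0))] := strong.
by move=> /(le_lt_trans (ler_norm _)) lt_eps; exists (phi n0).
Qed.

End kernel.

(** * The logarithmic series and the area of the hemisphere *)

Section log_series.
Context {R : realType}.
Implicit Types (t a s r : R) (N : nat).

Definition log_psum N t : R := \sum_(k < N) t ^+ k.+1 / k.+1%:R.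

Let rem N t : R := - ln (1 - t) - log_psum N t.

Let remS N t : rem N.+1 t = rem N t - t ^+ N.+1 / N.+1%:R.
Proof. by rewrite /rem /log_psum big_ord_recr/= opprD addrA. Qed.

(** Differentiation turns the logarithmic series into the geometric one, whose remainder is
    explicit. *)
Let is_derive_rem N t : t < 1 -> is_derive t 1 (rem N) (t ^+ N / (1 - t)).
Proof.
move=> t1; have t10 : 0 < 1 - t by rewrite subr_gt0.
elim: N => [|N ih].
  have -> : rem 0 = (fun t => - ln (1 - t)).
    by apply/funext => x; rewrite /rem /log_psum big_ord0 subr0.
  have dl : is_derive t 1 (fun t => 1 - t) (- 1).
    by apply: is_derive_eq; rewrite add0r mul1r.
  have dln : is_derive (1 - t) 1 (@ln R) (1 - t)^-1 by exact: is_derive1_ln.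
  have := @is_derive1_comp _ (@ln R) (fun t => 1 - t) t _ _ dln dl.
  move=> /is_deriveN dN; apply: (is_derive_eq dN).
  by rewrite expr0 mulrN1 opprK mul1r.
have -> : rem N.+1 = (fun t => rem N t - t ^+ N.+1 / N.+1%:R).
  by apply/funext => x; exact: remS.
have dX : is_derive t 1 (fun t => t ^+ N.+1 / N.+1%:R) (t ^+ N).
  have dZ := is_deriveZ N.+1%:R^-1 (@is_deriveX _ _ id N.+1 t 1 1 (is_derive_id t 1)).
  rewrite (_ : (fun t => _) = N.+1%:R^-1 \*: (id : R -> R) ^+ N.+1).
    apply: (is_derive_eq dZ); rewrite /GRing.scale/= mulr1 mulrA.
    by rewrite mulVf ?mul1r ?pnatr_eq0.
  by apply/funext => x; rewrite fctE/= mulrC.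
apply: (is_derive_eq (is_deriveB ih dX)).
by rewrite exprS; field; rewrite gt_eqF.
Qed.

Let rem0 N : rem N 0 = 0.
Proof.
rewrite /rem subr0 ln1 oppr0 sub0r; apply/eqP; rewrite oppr_eq0; apply/eqP.
by apply: big1 => k _; rewrite expr0n mul0r.
Qed.

(** Mean value theorem between 0 and [t]. The bound on [|r|] gives geometric decay of the remainder,
    the sign of [r] its nonnegativity for [0 <= t]. *)
Let rem_MVT N t : t < 1 -> exists2 r, `|r| <= `|t| /\ (0 <= t -> 0 <= r) /\ r < 1 &
  rem N t = r ^+ N / (1 - r) * t.
Proof.
move=> t1; have cont a b : b < 1 -> {within `[a, b], continuous (rem N)}.
  move=> b1; apply: derivable_within_continuous => x; rewrite in_itv/= => /andP[_ xb].
  by have := is_derive_rem N (le_lt_trans xb b1); move=> dx; exact: ex_derive.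
have dr a b : b < 1 -> forall x, x \in `]a, b[%R ->
    is_derive x 1 (rem N) (x ^+ N / (1 - x)).
  move=> b1 x; rewrite in_itv/= => /andP[_ xb].
  by apply: is_derive_rem; exact: lt_trans b1.
have [t0|t0] := leP 0 t.
  have [r] := MVT_segment t0 (dr 0 t t1) (cont _ _ t1).
  rewrite in_itv/= rem0 !subr0 => /andP[r0 rt] ->; exists r => //; split.
    by rewrite !ger0_norm.
  by split => //; exact: le_lt_trans t1.
have [r] := MVT_segment (ltW t0) (dr t 0 ltr01) (cont t 0 ltr01).
rewrite in_itv/= rem0 sub0r => /andP[tr r0]; rewrite sub0r mulrN => /oppr_inj ->.
exists r => //; split; first by rewrite !ler0_norm ?lerN2// ltW.
split => //.
exact: le_lt_trans ltr01.
Qed.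

Lemma log_psum_cvg t : `|t| < 1 -> log_psum N t @[N --> \oo] --> - ln (1 - t).
Proof.
move=> t1; have t10 : 0 < 1 - `|t| by rewrite subr_gt0.
have bound N : `|rem N t| <= (1 - `|t|)^-1 * `|t| ^+ N.
  have [r [rt [_ r1]] ->] := rem_MVT N (le_lt_trans (ler_norm t) t1).
  have r10 : 0 < 1 - r by rewrite subr_gt0.
  rewrite !normrM normrX normfV (gtr0_norm r10).
  rewrite (mulrC (`|r| ^+ N)) -mulrA; apply: ler_pM.
  - by rewrite invr_ge0 ltW.
  - by rewrite mulr_ge0// exprn_ge0.
  - rewrite lef_pV2 ?posrE// lerD2l lerN2.
    exact: le_trans (ler_norm r) rt.
  - rewrite -[leRHS]mulr1.
    by apply: ler_pM; rewrite ?exprn_ge0 ?lerXn2r ?nnegrE ?(ltW t1).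
have r0 : rem N t @[N --> \oo] --> 0.
  apply: norm_cvg0.
  have up : (1 - `|t|)^-1 * `|t| ^+ N @[N --> \oo] --> 0.
    have h : (1 - `|t|)^-1 * `|t| ^+ N @[N --> \oo] --> (1 - `|t|)^-1 * 0.
      by apply: cvgM; [exact: cvg_cst|apply: cvg_expr; rewrite normr_id].
    by rewrite mulr0 in h.
  apply: (squeeze_cvgr _ (cvg_cst 0) up); apply: nearW => N.
  by rewrite normr_ge0 bound.
have h : - ln (1 - t) - rem N t @[N --> \oo] --> - ln (1 - t) - 0.
  by apply: cvgB => //; exact: cvg_cst.
rewrite subr0 in h; rewrite (_ : (fun N => _) = fun N => - ln (1 - t) - rem N t)//.
by apply/funext => N; rewrite /rem subKr.
Qed.

(** Termwise domination by the sum at [r], which stays below its limit because the remainder is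
    nonnegative. The bound is uniform in [N]. *)
Lemma log_psum_norm_le N t r : `|t| <= r -> r < 1 -> `|log_psum N t| <= - ln (1 - r).
Proof.
move=> tr r1; have r0 : 0 <= r by exact: le_trans tr.
apply: (@le_trans _ _ (log_psum N r)).
  rewrite (le_trans (ler_norm_sum _ _ _))//; apply: ler_sum => k _.
  rewrite normrM normrX normfV normr_nat ler_wpM2r ?invr_ge0//.
  exact: lerXn2r.
rewrite -subr_ge0 -/(rem N r).
have [b [_ [b0 b1]] ->] := rem_MVT N r1.
by rewrite mulr_ge0// mulr_ge0 ?exprn_ge0 ?b0// invr_ge0 subr_ge0 ltW.
Qed.

(** This is [ln y < y] at [y = (1 / s) ^ a]: the logarithm is absorbed by an arbitrarily small
    power. *)
Lemma oppln_le_powR s a : 0 < s -> 0 < a -> - ln s <= (s^-1) `^ a / a.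
Proof.
move=> s0 a0; rewrite ler_pdivlMr// -lnV ?posrE// mulrC -ln_powR ltW// ln_sublinear//.
by rewrite powR_gt0// invr_gt0.
Qed.

End log_series.

(** * Area of slices and a singular integral on the hemisphere *)

Section area_estimates.
Context {R : realType}.
Implicit Types (x y : R3 R) (z r : R).

Local Notation leb := (@lebesgue_measure R).

Lemma measurable_coord1 : measurable_fun setT (fun x : R3 R => x.1.1).
Proof. exact: measurableT_comp measurable_fst measurable_fst. Qed.

Lemma measurable_coord2 : measurable_fun setT (fun x : R3 R => x.1.2).
Proof. exact: measurableT_comp measurable_snd measurable_fst. Qed.

Lemma measurable_coord3 : measurable_fun setT (fun x : R3 R => x.2).
Proof. exact: measurable_snd. Qed.

Lemma measurable_enorm : measurable_fun setT (@enorm R).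
Proof.
rewrite (_ : @enorm R = Num.sqrt \o (fun x => dot x x))//.
apply: measurableT_comp.
  by apply: continuous_measurable_fun; exact: sqrt_continuous.
have m1 := measurable_coord1; have m2 := measurable_coord2.
have m3 := measurable_coord3.
by do ![apply: measurable_funD|apply: measurable_funM].
Qed.

Lemma measurable_hemisphere : measurable (@hemisphere R).
Proof.
rewrite (_ : hemisphere =
    @enorm R @^-1` [set 1] `&` (fun x : R3 R => x.2) @^-1` `]0, +oo[).
  apply: measurableI; first exact: (measurable_preimage measurable_enorm).
  exact: (measurable_preimage measurable_coord3).
by apply/seteqP; split => x [x1]; rewrite /= in_itv/= andbT.
Qed.

Let band z r := `[0, pi]%classic `&` [set t : R | `|cos t - z| < r].

Let measurable_band z r : measurable (band z r).
Proof.
apply: measurableI; first exact: measurable_itv.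
have mc : measurable_fun setT (fun t : R => `|cos t - z|).
  apply: measurableT_comp => //; apply: measurable_funB => //.
  by apply: continuous_measurable_fun; exact: continuous_cos.
rewrite (_ : [set t | _] = (fun t : R => `|cos t - z|) @^-1` `]-oo, r[).
  exact: (measurable_preimage mc).
by apply/seteqP; split => t /=; rewrite in_itv.
Qed.

Let integral_sin_itv (a b : R) : a <= b ->
  (\int[leb]_(t in `[a, b]) (sin t)%:E = (cos a - cos b)%:E)%E.
Proof.
rewrite le_eqVlt => /predU1P[->|ab].
  by rewrite subrr set_itv1 integral_set1.
have dN (t : R) : is_derive t 1 (fun t : R => - cos t) (sin t).
  by apply: (is_derive_eq (is_deriveN (is_derive_cos t))); rewrite opprK.
have cN : continuous (fun t : R => - cos t).
  by move=> t; apply: continuousN; exact: continuous_cos.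
have dF : derivable_oo_LRcontinuous (fun t : R => - cos t) a b.
  split.
  - by move=> t _; exact: (@ex_derive _ _ _ _ _ _ _ (dN t)).
  - exact/cvg_at_right_filter/cN.
  - exact/cvg_at_left_filter/cN.
rewrite (continuous_FTC2 ab _ dF).
- by rewrite -EFinB opprK addrC.
- exact/continuous_subspaceT/continuous_sin.
- by move=> t _; rewrite derive1E; exact: (@derive_val _ _ _ _ _ _ _ (dN t)).
Qed.

Let integral_sin_band z r : 0 < r ->
  (\int[leb]_(t in band z r) (sin t)%:E <= (2 * r)%:E)%E.
Proof.
move=> r0.
have [[t0 [t0I t0r]]|nex] := pselect (exists t, band z r t); last first.
  rewrite (_ : band z r = set0) ?integral_set0 ?lee_fin ?mulr_ge0 ?ltW//.
  by apply/seteqP; split => // t tb; apply: nex; exists t.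
have := cos_le1 t0; have := cos_geN1 t0 => c0 c1.
move: t0r => /=; rewrite ltr_norml => /andP[zl zu].
(* The interval around [z] is clipped for [acos]; the witness [t0] ensures that it meets
   [[-1, 1]]. *)
pose b := Num.max (- 1) (z - r); pose a := Num.min 1 (z + r).
have bI : -1 <= b <= 1 by rewrite le_max lexx/= ge_max; apply/andP; split; lra.
have aI : -1 <= a <= 1 by rewrite ge_min lexx/= le_min andbT; apply/andP; split; lra.
have aI' : acos a \in `[0, pi] by rewrite in_itv/= acos_ge0 ?acos_lepi.
have bI' : acos b \in `[0, pi] by rewrite in_itv/= acos_ge0 ?acos_lepi.
have ler_cos (s t : R) : s \in `[0, pi] -> t \in `[0, pi] -> cos t <= cos s -> s <= t.
  by move=> sI tI; rewrite !leNgt; apply: contra => ?; rewrite ltr_cos.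
have sub : band z r `<=` `[acos a, acos b].
  move=> t [tI]; rewrite /= ltr_norml in_itv/= => /andP[tl tu].
  have := cos_le1 t; have := cos_geN1 t => ct0 ct1.
  apply/andP; split; apply: ler_cos => //; rewrite acosK ?in_itv//=.
    by rewrite le_min ct1/=; lra.
  by rewrite ge_max ct0/=; lra.
have ab : acos a <= acos b.
  have /sub/= : band z r t0 by split => //=; rewrite ltr_norml zl zu.
  by rewrite in_itv/= => /andP[]; exact: le_trans.
apply: (@le_trans _ _ (\int[leb]_(t in `[acos a, acos b]) (sin t)%:E)%E).
  apply: ge0_subset_integral => //.
  - exact: measurable_band.
  - apply: measurable_funTS; apply/measurable_EFinP.
    by apply: continuous_measurable_fun; exact: continuous_sin.
  - move=> t /=; rewrite in_itv/= => /andP[t1 t2]; rewrite lee_fin sin_ge0_pi//.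
    move: aI' bI'; rewrite !in_itv/= => /andP[? _] /andP[_ ?].
    by apply/andP; split; [exact: le_trans t1|exact: le_trans t2 _].
rewrite integral_sin_itv// !acosK ?in_itv//= lee_fin.
have : a <= z + r by rewrite ge_min lexx orbT.
have : z - r <= b by rewrite le_max lexx orbT.
lra.
Qed.

(** Archimedes' hat-box theorem: in the variable [cos] of the colatitude the area element is
    constant, so a slice of thickness [2 r] has area at most [2 pi * 2 r], wherever it lies. *)
Lemma area_slice z r : 0 < r ->
  (area (@hemisphere R `&` [set y | (`|y.2 - z| < r)%R]) <= (pi *+ 4 * r)%:E)%E.
Proof.
move=> r0; pose F : set R := `[0, pi *+ 2[%classic.
have mF : measurable F by exact: measurable_itv.
have mE := measurable_band z r.
have mEF : measurable (band z r `*` F) by exact: measurableX.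
pose f (u : R * R) := (sin u.1)%:E.
have mf : measurable_fun setT f.
  apply/measurable_EFinP; apply: (measurableT_comp _ measurable_fst).
  by apply: continuous_measurable_fun; exact: continuous_sin.
have f0 u : (band z r `*` F) u -> (0 <= f u)%E.
  by move=> -[[/= + _] _]; rewrite in_itv/= => ?; rewrite lee_fin sin_ge0_pi.
rewrite /area; apply: (@le_trans _ _
    (\int[leb \x leb]_(u in band z r `*` F) f u)%E).
  apply: ge0_subset_integral => //.
  - apply: measurableI; first exact: measurable_sphdom.
    rewrite -[X in measurable X]setTI; apply: measurable_sphpar => //.
    apply: measurableI.
      exact: measurable_hemisphere.
    have mz : measurable_fun setT (fun y : R3 R => `|y.2 - z|).
      have mB : measurable_fun setT (fun y : R3 R => y.2 - z).
        exact: measurable_funB measurable_coord3 (measurable_cst _).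
      exact: measurableT_comp mB.
    rewrite (_ : [set y | _] = (fun y : R3 R => `|y.2 - z|) @^-1` `]-oo, r[).
      exact: (measurable_preimage mz).
    by apply/seteqP; split => y /=; rewrite in_itv.
  - exact: measurable_funTS.
  - by move=> u [[/= u1 u2] [_ ur]].
rewrite integral_mkcond fubini_tonelli1; last 2 first.
- by apply/(measurable_restrictT _ _).1 => //; exact: measurable_funTS.
- by move=> u; rewrite patchE; case: ifPn => //; rewrite inE => /f0.
have inner t : (\int[leb]_y ((f \_ (band z r `*` F)) (t, y)) =
    ((fun t : R => ((pi *+ 2)%:E * (sin t)%:E)) \_ (band z r)) t)%E.
  rewrite patchE; case: ifPn => tb.
    transitivity (\int[leb]_y (((cst (sin t)%:E) \_ F) y))%E.
      apply: eq_integral => y _; rewrite !patchE; congr (if _ then _ else _).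
      rewrite inE in tb; apply/idP/idP; rewrite !inE; first by case.
      by move=> yF; split.
    rewrite -integral_mkcond integral_cst// muleC; congr (_ * _)%E.
    transitivity (if (0%:E < (pi *+ 2 : R)%:E)%E then ((pi *+ 2 : R)%:E - 0%:E)%E else 0%E).
      exact: (@lebesgue_measure_itv R `[0, pi *+ 2[).
    by rewrite lte_fin mulrn_wgt0 ?pi_gt0// sube0.
  rewrite -[RHS](integral0 leb setT); apply: eq_integral => y _.
  rewrite patchE ifN// notin_setE => -[/= tb' _].
  by rewrite notin_setE in tb.
under eq_integral do rewrite /fubini_F inner.
rewrite -integral_mkcond ge0_integralZl//; last 3 first.
- apply: measurable_funTS; apply/measurable_EFinP.
  by apply: continuous_measurable_fun; exact: continuous_sin.
- by move=> t [/= + _]; rewrite in_itv/= => ?; rewrite lee_fin sin_ge0_pi.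
- by rewrite lee_fin mulrn_wge0// pi_ge0.
apply: (@le_trans _ _ ((pi *+ 2)%:E * (2 * r)%:E)%E).
  by apply: lee_wpmul2l; [rewrite lee_fin mulrn_wge0// pi_ge0|exact: integral_sin_band].
by rewrite -EFinM lee_fin le_eqVlt; apply/orP; left; apply/eqP; ring.
Qed.

Lemma dot_sphere x : sphere x -> dot x x = 1.
Proof.
rewrite /sphere/= /enorm => x1; have d0 : 0 <= dot x x.
  by rewrite /dot !addr_ge0// -expr2 sqr_ge0.
by rewrite -(sqr_sqrtr d0) x1 expr1n.
Qed.

Lemma coord_sphere x : sphere x ->
  [/\ `|x.1.1| <= 1, `|x.1.2| <= 1 & `|x.2| <= 1].
Proof.
move=> /dot_sphere; rewrite /dot -!expr2 => x1.
have h (a : R) : a ^+ 2 <= 1 -> `|a| <= 1.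
  by rewrite -real_normK ?num_real// expr_le1.
by split; apply: h; rewrite -x1; have := sqr_ge0 x.1.1; have := sqr_ge0 x.1.2;
  have := sqr_ge0 x.2; lra.
Qed.

Lemma measurable_slice z r : measurable [set y : R3 R | `|y.2 - z| < r].
Proof.
have mz : measurable_fun setT (fun y : R3 R => `|y.2 - z|).
  have mB : measurable_fun setT (fun y : R3 R => y.2 - z).
    exact: measurable_funB measurable_coord3 (measurable_cst _).
  exact: measurableT_comp mB.
rewrite (_ : [set y | _] = (fun y : R3 R => `|y.2 - z|) @^-1` `]-oo, r[).
  exact: (measurable_preimage mz).
by apply/seteqP; split => y /=; rewrite in_itv.
Qed.

Lemma area_hemisphere_fin : (area (@hemisphere R) < +oo)%E.
Proof.
have r2 : 0 < 2 :> R by [].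
apply: le_lt_trans (le_lt_trans (area_slice 0 r2) (ltry _)).
apply: le_measure; rewrite ?inE.
- exact: measurable_hemisphere.
- by apply: measurableI; [exact: measurable_hemisphere|exact: measurable_slice].
- move=> x [xS x0]; split => //=; rewrite subr0.
  by have [_ _ /le_lt_trans] := coord_sphere xS; apply; rewrite ltr1n.
Qed.

Lemma area_level z : area (@hemisphere R `&` [set y | y.2 = z]) = 0%E.
Proof.
have mz : measurable [set y : R3 R | y.2 = z].
  rewrite (_ : [set y | _] = (fun y : R3 R => y.2) @^-1` [set z])//.
  exact: (measurable_preimage measurable_coord3).
have mH := measurable_hemisphere.
apply/eqP; rewrite eq_le measure_ge0 andbT; apply/lee_addgt0Pr => e e0.
rewrite add0e; have r0 : 0 < e / (pi *+ 4) by rewrite divr_gt0// mulrn_wgt0// pi_gt0.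
apply: (@le_trans _ _ (area (@hemisphere R `&` [set y | (`|y.2 - z| < e / (pi *+ 4))%R]))).
  apply: le_measure; rewrite ?inE.
  - exact: measurableI.
  - by apply: measurableI => //; exact: measurable_slice.
  - by move=> y [yH /= ->]; split => //=; rewrite subrr normr0.
apply: (le_trans (area_slice z r0)); rewrite lee_fin mulrC divfK//.
by rewrite gt_eqF// mulrn_wgt0// pi_gt0.
Qed.

(** [k.+1] is the least exponent whose inverse power of 4 is at most [dl]; powers of 4 make the
    inverse square root a matter of powers of 2. *)
Let dyadic (dl : R) : 0 < dl -> dl < 1 -> exists k : nat,
  dl < (4 ^+ k)^-1 /\ (dl^-1) `^ 2^-1 <= 2 ^+ k.+1.
Proof.
move=> d0 d1; have ex : exists n, (4 ^+ n)^-1 <= dl.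
  have := @cvg_expr R (4^-1); rewrite ger0_norm ?invr_ge0// invf_lt1// ltr1n => /(_ isT).
  move=> /cvgr0Pnorm_le/(_ _ d0)[n _ /(_ _ (leqnn n))].
  by rewrite exprVn ger0_norm ?invr_ge0 ?exprn_ge0// => h; exists n.
case: (ex_minnP ex) => -[|k] kd kmin.
  by move: kd; rewrite expr0 invr1 leNgt d1.
exists k; split.
  by rewrite ltNge; apply/negP => /kmin; rewrite ltnn.
have dk : dl^-1 <= (2 ^+ k.+1) ^+ 2.
  rewrite -[leRHS]invrK lef_pV2 ?posrE ?invr_gt0 ?exprn_gt0//.
  by rewrite exprAC (_ : 2 ^+ 2 = 4 :> R)//; ring.
have k0 : 0 <= 2 ^+ k.+1 :> R by rewrite exprn_ge0.
have -> : 2 ^+ k.+1 = ((2 ^+ k.+1) ^+ 2) `^ 2^-1 :> R.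
  by rewrite -(powR_mulrn 2 k0) -powRrM divff ?powRr1.
by apply: ge0_ler_powR; rewrite ?nnegrE ?invr_ge0 ?exprn_ge0 ?(ltW d0).
Qed.

(** The integrand is dominated by the sum of [2 ^ (k + 1)] times the indicators of the slices of
    half-width [4 ^ - k]. Their areas are at most [4 pi / 4 ^ k], and the geometric series sums to
    [16 pi]. *)
Lemma area_singular z : 0 < z <= 1 ->
  (\int[area]_(y in @hemisphere R) ((`|y.2 - z|^-1) `^ 2^-1)%:E <= (pi *+ 16)%:E)%E.
Proof.
move=> /andP[z0 z1]; have mH := measurable_hemisphere.
pose B k := [set y : R3 R | `|y.2 - z| < (4 ^+ k)^-1].
have mB k : measurable (B k) by exact: measurable_slice.
pose f k (y : R3 R) : \bar R := (2 ^+ k.+1 * \1_(B k) y)%:E.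
have mf k : measurable_fun hemisphere (f k).
  by apply/measurable_EFinP; apply: measurable_funM => //; exact: measurable_indic.
have f0 k y : hemisphere y -> (0 <= f k y)%E.
  by move=> _; rewrite lee_fin mulr_ge0// exprn_ge0.
apply: (@le_trans _ _ (\int[area]_(y in @hemisphere R) (\sum_(k <oo) f k y))%E).
  apply: ge0_le_integral => //.
  - apply: measurable_funTS; apply/measurable_EFinP.
    have mB' : measurable_fun setT (fun y : R3 R => y.2 - z).
      exact: measurable_funB measurable_coord3 (measurable_cst _).
    apply: (measurableT_comp (measurable_powR _)).
    rewrite (_ : (fun y : R3 R => `|y.2 - z|^-1) = (fun y => `|y.2 - z| `^ (- 1))).
      apply: (measurableT_comp (measurable_powR _)).
      exact: measurableT_comp mB'.
    by apply/funext => y; rewrite powR_inv1.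
  - by apply: ge0_emeasurable_sum => // k y yH _; exact: f0.
  move=> y [yS y0]; have [_ _ y1] := coord_sphere yS.
  have [->|yz] := eqVneq (y.2 - z) 0.
    (* At the singularity the integrand is 0, because [0^-1 = 0]. *)
    rewrite normr0 invr0 powR0 ?invr_eq0//.
    by apply: nneseries_ge0 => k _ _; exact: f0.
  have d0 : 0 < `|y.2 - z| by rewrite normr_gt0.
  have d1 : `|y.2 - z| < 1.
    by rewrite ltr_norml; move: y1; rewrite ler_norml => /andP[? ?]; apply/andP; split; lra.
  have [k [dk kd]] := dyadic d0 d1.
  apply: (@le_trans _ _ (f k y)).
    by rewrite lee_fin indicE mem_set// mulr1.
  apply: le_trans (nneseries_lim_ge k.+1 _); last by move=> n _ _; exact: f0.
  rewrite big_nat_recr//= leeDr// sume_ge0// => n _; exact: f0.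
rewrite integral_nneseries//.
apply: lime_le.
  by apply: is_cvg_nneseries => k _ _; apply: integral_ge0 => y; exact: f0.
apply: nearW => n.
have fk k : (\int[area]_(y in @hemisphere R) f k y <= (pi *+ 8 / 2 ^+ k)%:E)%E.
  rewrite /f; under eq_integral do rewrite EFinM.
  have mI : measurable_fun hemisphere (EFin \o (\1_(B k) : R3 R -> R)).
    by apply/measurable_EFinP; exact: measurable_indic.
  have -> : (\int[area]_(y in @hemisphere R) ((2 ^+ k.+1)%:E * (\1_(B k) y)%:E) =
      (2 ^+ k.+1)%:E * \int[area]_(y in @hemisphere R) (\1_(B k) y)%:E)%E.
    apply: ge0_integralZl => //; rewrite lee_fin; exact: exprn_ge0.
  rewrite integral_indic// setIC.
  have e0 : 0 < (4 ^+ k)^-1 :> R by rewrite invr_gt0 exprn_gt0.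
  apply: (le_trans (lee_wpmul2l _ (area_slice z e0))); first by rewrite lee_fin exprn_ge0.
  rewrite -EFinM lee_fin le_eqVlt; apply/orP; left; apply/eqP.
  have -> : 4 ^+ k = 2 ^+ k * 2 ^+ k :> R by rewrite -exprMn; congr (_ ^+ _); ring.
  by rewrite exprS; field; rewrite expf_eq0 pnatr_eq0 andbF.
apply: (@le_trans _ _ (\sum_(0 <= k < n) (pi *+ 8 / 2 ^+ k)%:E)%E).
  by apply: lee_sum => k _; exact: fk.
rewrite sumEFin lee_fin (_ : \sum_(0 <= k < n) _ = pi *+ 16 * (1 - (2 ^+ n)^-1)).
  apply: ler_piMr; first by rewrite mulrn_wge0 ?pi_ge0.
  by rewrite lerBlDr lerDl invr_ge0 exprn_ge0.
elim: n => [|n ih]; first by rewrite big_nil expr0 invr1 subrr mulr0.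
rewrite big_nat_recr//= ih exprS; field.
by rewrite expf_eq0 pnatr_eq0 andbF.
Qed.

End area_estimates.

(** * Functions tested by moments *)

Section bernoulli_step.
Context {R : realType}.
Implicit Types (s a : R) (n : nat).

Lemma bernoulli_ge (x : R) n : 0 <= x -> 1 + n%:R * x <= (1 + x) ^+ n.
Proof.
move=> x0; elim: n => [|n ih]; first by rewrite mul0r addr0 expr0.
rewrite exprS; apply: (@le_trans _ _ ((1 + x) * (1 + n%:R * x))).
  rewrite -natr1; have : 0 <= n%:R * x * x by rewrite !mulr_ge0.
  lra.
by rewrite ler_wpM2l// addr_ge0.
Qed.

Lemma bernoulli_1B_ge (x : R) n : 0 <= x <= 1 -> 1 - n%:R * x <= (1 - x) ^+ n.
Proof.
move=> /andP[x0 x1]; elim: n => [|n ih]; first by rewrite mul0r subr0 expr0.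
rewrite exprS; apply: (@le_trans _ _ ((1 - x) * (1 - n%:R * x))).
  rewrite -natr1; have : 0 <= n%:R * x * x by rewrite !mulr_ge0.
  lra.
by rewrite ler_wpM2l// subr_ge0.
Qed.

Lemma bernoulli_1B_le (x : R) n : 0 <= x <= 1 -> (1 - x) ^+ n <= (1 + n%:R * x)^-1.
Proof.
move=> /andP[x0 x1].
have p0 : 0 < 1 + n%:R * x by rewrite ltr_wpDr// mulr_ge0.
rewrite -[leRHS]mul1r ler_pdivlMr//.
apply: (@le_trans _ _ ((1 - x) ^+ n * (1 + x) ^+ n)).
  by rewrite ler_wpM2l ?bernoulli_ge// exprn_ge0// subr_ge0.
rewrite -exprMn; apply: exprn_ile1.
  by apply: mulr_ge0; rewrite ?subr_ge0// addr_ge0.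
by have := mulr_ge0 x0 x0; lra.
Qed.

Lemma cvg_natmul_expr (r : R) : 0 <= r < 1 -> n%:R * r ^+ n @[n --> \oo] --> 0.
Proof.
(* With [r = rho ^ 2], one factor [rho ^ n] absorbs [n] and the other tends to 0. *)
move=> /andP[r0 r1]; pose rho := Num.sqrt r.
have rho0 : 0 <= rho by exact: sqrtr_ge0.
have rho2 : r = rho ^+ 2 by rewrite sqr_sqrtr.
have rho1 : rho < 1.
  by rewrite ltNge; apply/negP => h; move: r1; rewrite rho2 ltNge exprn_ege1.
have bnd n : n%:R * rho ^+ n <= (1 - rho)^-1.
  have [->|rhoN0] := eqVneq rho 0.
    rewrite subr0 invr1; case: n => [|n]; first by rewrite mul0r.
    by rewrite expr0n mulr0.
  have rhop : 0 < rho by rewrite lt_neqAle eq_sym rhoN0.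
  have x0 : 0 <= rho^-1 - 1 by rewrite subr_ge0 invf_ge1// ltW.
  have := bernoulli_ge n x0; rewrite addrCA subrr addr0 exprVn => h.
  have en0 : 0 < rho ^+ n by rewrite exprn_gt0.
  have {}h : (1 + n%:R * (rho^-1 - 1)) * rho ^+ n <= 1.
    by rewrite -ler_pdivlMr// mul1r.
  have {}h : n%:R * rho ^+ n * (rho^-1 - 1) <= 1.
    apply: le_trans h; rewrite mulrDl mul1r (mulrAC _ (rho ^+ n)) lerDr.
    exact: ltW.
  rewrite -[leRHS]mul1r ler_pdivlMr ?subr_gt0//.
  have -> : 1 - rho = (rho^-1 - 1) * rho by rewrite mulrBl mulVf// mul1r.
  rewrite mulrA; apply: le_trans (_ : 1 * rho <= 1); last by rewrite mul1r ltW.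
  by rewrite ler_wpM2r.
have up : (1 - rho)^-1 * rho ^+ n @[n --> \oo] --> 0.
  have h : (1 - rho)^-1 * rho ^+ n @[n --> \oo] --> (1 - rho)^-1 * 0.
    by apply: cvgM; [exact: cvg_cst|apply: cvg_expr; rewrite ger0_norm].
  by rewrite mulr0 in h.
apply: (squeeze_cvgr _ (cvg_cst 0) up); apply: nearW => n.
rewrite mulr_ge0 ?exprn_ge0//= rho2 exprAC expr2 mulrA.
by rewrite ler_wpM2r ?exprn_ge0// bnd.
Qed.

(** Polynomials as in the Brosowski-Deutsch proof of Stone-Weierstrass. The product of [s ^ n] with
    the outer exponent is [n (2 s) ^ n], which tends to 0 for [s < 1/2] and is at least [n] from 1/2
    on; the factor [n] settles the value at 1/2. *)
Definition bstep n s : R := (1 - s ^+ n) ^+ (n * 2 ^ n).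

Lemma bstep_ge0_le1 n s : 0 <= s <= 1 -> 0 <= bstep n s <= 1.
Proof.
move=> /andP[s0 s1]; have sn1 : s ^+ n <= 1 by exact: exprn_ile1.
by rewrite /bstep exprn_ge0 ?exprn_ile1 ?subr_ge0 ?lerBlDr ?lerDl ?exprn_ge0.
Qed.

(* Bernoulli bounds force the sequence to 1 below 1/2 and to 0 from 1/2 on. *)
Lemma bstep_cvg s : 0 <= s <= 1 ->
  bstep n s @[n --> \oo] --> ((s < 2^-1)%R%:R : R).
Proof.
move=> s01; have /andP[s0 s1] := s01.
have sn01 n : 0 <= s ^+ n <= 1 by rewrite exprn_ge0// exprn_ile1.
have [sh|sh] := ltP s 2^-1.
  have r01 : 0 <= 2 * s < 1 by apply/andP; split; lra.
  have lo : 1 - n%:R * (2 * s) ^+ n @[n --> \oo] --> (1 : R).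
    rewrite -[X in _ --> X]subr0; apply: cvgB; first exact: cvg_cst.
    exact: cvg_natmul_expr.
  suff: bstep n s @[n --> \oo] --> (1 : R) by [].
  apply: squeeze_cvgr lo (cvg_cst _); apply: nearW => n.
  have /andP[_ ->] := bstep_ge0_le1 n s01; rewrite andbT.
  apply: le_trans (bernoulli_1B_ge _ (sn01 n)).
  by rewrite natrM natrX exprMn mulrA.
have hi : (1 + n%:R)^-1 @[n --> \oo] --> (0 : R).
  suff -> : (fun n : nat => (1 + n%:R)^-1) = @harmonic R by exact: cvg_harmonic.
  by apply/funext => n; rewrite /harmonic/= nat1r.
suff: bstep n s @[n --> \oo] --> (0 : R) by [].
apply: (squeeze_cvgr _ (cvg_cst 0) hi); apply: nearW => n.
have /andP[-> _] := bstep_ge0_le1 n s01; rewrite andTb.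
apply: (le_trans (bernoulli_1B_le _ (sn01 n))).
rewrite lef_pV2 ?posrE; last 2 first.
- by rewrite ltr_wpDr// mulr_ge0// exprn_ge0.
- by rewrite ltr_wpDr.
rewrite lerD2l natrM natrX -mulrA -exprMn ler_peMr// exprn_ege1//; lra.
Qed.

End bernoulli_step.

(* Multipliers form an algebra closed under bounded pointwise limits, so that
   a few coordinate functions generate all bounded measurable ones. *)
Section weak_multipliers.
Import HBNNSimple.
Context d (T : measurableType d) (R : realType).
Variable mu : {finite_measure set T -> \bar R}.
Variables p q : R.
Hypotheses (p0 : 0 < p) (q0 : 0 < q) (pq : p^-1 + q^-1 = 1).
Variables (J : Type) (P : set J) (e : J -> T -> R).
Hypothesis me : forall i, measurable_fun setT (e i).
Hypothesis e1 : forall i x, `|e i x| <= 1.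
Variables (z : nat -> T -> R) (K : R).
Hypothesis Lz : forall n, Lpfun mu p (z n).
Hypothesis zK : forall n, \int[mu]_x (`|z n x| `^ p) <= K.

Implicit Types (f g phi : T -> R) (A : set T).

Definition bounded_measurable f :=
  measurable_fun setT f /\ exists C : R, forall x, `|f x| <= C.

Definition weakly_null f := bounded_measurable f /\
  forall i, P i -> \int[mu]_x (e i x * f x * z n x) @[n --> \oo] --> 0.

(** Defined by the action on weakly null functions, which makes the product of two multipliers a
    multiplier by composition. *)
Definition multiplier phi := bounded_measurable phi /\
  forall f, weakly_null f -> weakly_null (fun x => f x * phi x).

Let integ_test f i n : bounded_measurable f ->
  mu.-integrable setT (EFin \o (fun x => e i x * f x * z n x)).
Proof.
move=> [mf [C fC]]; apply: (Lpfun_mul p0 q0 pq _ (Lz n)).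
apply: (@Lpfun_bounded _ _ _ _ _ _ C) => //; first exact: ltW.
  exact: measurable_funM.
move=> x; rewrite normrM -[leRHS]mul1r; apply: ler_pM => //.
Qed.

Lemma bounded_measurable_cst (a : R) : bounded_measurable (cst a).
Proof. by split => //; exists `|a|. Qed.

Lemma bounded_measurableD f g : bounded_measurable f -> bounded_measurable g ->
  bounded_measurable (fun x => f x + g x).
Proof.
move=> [mf [C fC]] [mg [D gD]]; split; first exact: measurable_funD.
by exists (C + D) => x; apply: le_trans (ler_normD _ _) _; apply: lerD.
Qed.

Lemma bounded_measurableM f g : bounded_measurable f -> bounded_measurable g ->
  bounded_measurable (fun x => f x * g x).
Proof.
move=> [mf [C fC]] [mg [D gD]]; split; first exact: measurable_funM.
by exists (C * D) => x; rewrite normrM; apply: ler_pM.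
Qed.

Lemma multiplier_cst (a : R) : multiplier (cst a).
Proof.
split; first exact: bounded_measurable_cst.
move=> f [bf f0]; split.
  by apply: bounded_measurableM => //; exact: bounded_measurable_cst.
move=> i Pi.
rewrite (_ : (fun n => _) = (fun n => a * \int[mu]_x (e i x * f x * z n x))).
  have h : a * \int[mu]_x (e i x * f x * z n x) @[n --> \oo] --> a * 0.
    by apply: cvgM; [exact: cvg_cst|exact: f0].
  by rewrite mulr0 in h.
apply/funext => n; rewrite -RintegralZl//; last exact: integ_test.
by apply: eq_Rintegral => x _ /=; ring.
Qed.

Lemma multiplierD phi psi : multiplier phi -> multiplier psi ->
  multiplier (fun x => phi x + psi x).
Proof.
move=> [bphi Mphi] [bpsi Mpsi]; split; first exact: bounded_measurableD.
move=> f nf; have [bp hp] := Mphi f nf; have [bs hs] := Mpsi f nf.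
split; first by apply: bounded_measurableM; [case: nf|exact: bounded_measurableD].
move=> i Pi.
have h : \int[mu]_x (e i x * (f x * phi x) * z n x) +
  \int[mu]_x (e i x * (f x * psi x) * z n x) @[n --> \oo] --> (0 + 0 : R).
  by apply: cvgD; [exact: hp|exact: hs].
rewrite addr0 in h; apply: cvg_trans h; apply: near_eq_cvg; apply: nearW => n.
rewrite -RintegralD//; [|exact: integ_test..].
by apply: eq_Rintegral => x _ /=; ring.
Qed.

Lemma multiplierM phi psi : multiplier phi -> multiplier psi ->
  multiplier (fun x => phi x * psi x).
Proof.
move=> [bphi Mphi] [bpsi Mpsi]; split; first exact: bounded_measurableM.
move=> f nf; have := Mpsi _ (Mphi f nf).
by congr weakly_null; apply/funext => x; rewrite mulrA.
Qed.

Lemma multiplierX phi n : multiplier phi -> multiplier (fun x => phi x ^+ n).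
Proof.
move=> Mphi; elim: n => [|n ih]; first exact: multiplier_cst.
by under eq_fun do rewrite exprS; exact: multiplierM.
Qed.

Lemma multiplierZ (a : R) phi : multiplier phi -> multiplier (fun x => a * phi x).
Proof. by apply: multiplierM; exact: multiplier_cst. Qed.

Lemma multiplierB phi psi : multiplier phi -> multiplier psi ->
  multiplier (fun x => phi x - psi x).
Proof.
move=> Mphi Mpsi; under eq_fun do rewrite -mulN1r.
by apply: multiplierD => //; exact: multiplierZ.
Qed.

(** The error of replacing [phi] by [phi_ k] is small uniformly in [n], because the [z n] stay in a
    ball of Lp; so [k] can be fixed before [n] grows. *)
Lemma multiplier_lim (phi_ : nat -> T -> R) phi (C : R) :
  (forall k, multiplier (phi_ k)) -> (forall k x, `|phi_ k x| <= C) ->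
  (forall x, phi_ k x @[k --> \oo] --> phi x) -> multiplier phi.
Proof.
move=> Mk kC klim.
have mphi : measurable_fun setT phi.
  apply: (measurable_fun_cvg (h := phi_)) => // k.
  by case: (Mk k) => -[].
have phiC x : `|phi x| <= C.
  by apply: (cvgr_to_le (cvg_norm (klim x))); exact: nearW.
have bphi : bounded_measurable phi by split => //; exists C.
split => // f nf; have [bf _] := nf.
have bfphi : bounded_measurable (fun x => f x * phi x).
  exact: bounded_measurableM.
split => // i Pi; have [mf [D fD]] := bf.
pose b k x := e i x * (f x * phi x) - e i x * (f x * phi_ k x).
have bmk k : bounded_measurable (fun x => f x * phi_ k x).
  by apply: bounded_measurableM => //; case: (Mk k).
have mb k : measurable_fun setT (b k).
  by apply: measurable_funB; apply: measurable_funM => //; [case: bfphi|case: (bmk k)].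
have bC k x : `|b k x| <= D * (C + C).
  rewrite /b -mulrBr -mulrBr !normrM -[leRHS]mul1r.
  apply: ler_pM => //; rewrite ?mulr_ge0//; apply: ler_pM => //.
  by apply: le_trans (ler_normB _ _) _; apply: lerD.
have b0 x : b k x @[k --> \oo] --> 0.
  have h : b k x @[k --> \oo] --> e i x * (f x * phi x) - e i x * (f x * phi x).
    apply: cvgB; first exact: cvg_cst.
    by apply: cvgM; [exact: cvg_cst|apply: cvgM; [exact: cvg_cst|exact: klim]].
  by rewrite subrr in h.
apply/(@cvgr0Pnorm_le R R) => eps eps0.
have e20 : 0 < eps / 2 by rewrite divr_gt0.
have Lc : Lpfun mu q (cst (D * (C + C))).
  by apply: (@Lpfun_bounded _ _ _ _ _ _ `|D * (C + C)|) => //; exact: ltW.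
have [k _ /(_ k (leqnn k)) hk] := Lpfun_vanish p0 q0 pq mb Lc
   (fun k => aeW _ (fun x => le_trans (bC k x) (ler_norm _))) (aeW _ b0) K e20.
have [_ /(_ i Pi)] := (Mk k).2 f nf.
move=> /(@cvgr0Pnorm_le R R)/(_ _ e20); apply: filterS => n hn.
have -> : \int[mu]_x (e i x * (f x * phi x) * z n x) =
   \int[mu]_x (b k x * z n x) + \int[mu]_x (e i x * (f x * phi_ k x) * z n x).
  rewrite -RintegralD//; last exact: integ_test.
    by apply: eq_Rintegral => x _ /=; rewrite /b; ring.
  apply: (Lpfun_mul p0 q0 pq _ (Lz n)); split=> //.
  exact: (@Lpfun_bounded _ _ _ _ _ _ (D * (C + C)) (ltW q0) (mb k) (bC k)).2.
apply: le_trans (ler_normD _ _) _; rewrite [leRHS]splitr; apply: lerD => //.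
apply: (le_trans _ (hk _ (Lz n) (zK n))).
have ib : mu.-integrable setT (EFin \o (fun x => b k x * z n x)).
  apply: (Lpfun_mul p0 q0 pq _ (Lz n)).
  exact: (@Lpfun_bounded _ _ _ _ _ _ (D * (C + C)) (ltW q0) (mb k) (bC k)).
by apply: le_norm_Rint => //; exact: integrable_norm.
Qed.

Lemma multiplier_step phi (a : R) : multiplier phi -> (forall x, `|phi x| <= 1) ->
  multiplier (\1_[set x | phi x < a]).
Proof.
move=> Mphi phi1.
have [a1|a1] := ltP 1 a.
  rewrite (_ : \1__ = cst 1); first exact: multiplier_cst.
  apply/funext => x; rewrite indicE mem_set//=.
  by apply: le_lt_trans a1; rewrite (le_trans (ler_norm _)).
have [a2|a2] := leP a (-1).
  rewrite (_ : \1__ = cst 0); first exact: multiplier_cst.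
  apply/funext => x; rewrite indicE memNset//=; apply/negP; rewrite -leNgt.
  by have := phi1 x; rewrite ler_norml => /andP[? _]; apply: le_trans a2 _.
(* This affine change puts the threshold [a] at 1/2, where [bstep] jumps, and stays in [[0, 1]]
   since [|phi x|] and [|a|] are at most 1. *)
have s01 x : 0 <= 2^-1 + (phi x - a) / 4 <= 1.
  have := phi1 x; rewrite ler_norml => /andP[? ?]; apply/andP; split; lra.
apply: (@multiplier_lim (fun k x => bstep k (2^-1 + (phi x - a) / 4)) _ 1).
- move=> k; apply: multiplierX; apply: multiplierB; first exact: multiplier_cst.
  apply: multiplierX; apply: multiplierD; first exact: multiplier_cst.
  under eq_fun do rewrite mulrC; apply: multiplierZ.
  by apply: multiplierB => //; exact: multiplier_cst.
- by move=> k x; have /andP[? ?] := bstep_ge0_le1 k (s01 x); rewrite ger0_norm.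
- move=> x; have := bstep_cvg (s01 x).
  congr (_ --> _); rewrite indicE; congr (nat_of_bool _)%:R.
  have -> : (2^-1 + (phi x - a) / 4 < 2^-1) = (phi x < a) by apply/idP/idP; lra.
  by apply/idP/idP => [h|]; [rewrite inE|rewrite inE].
Qed.

(** Countable unions are limits of one minus the finite products of the indicators of the
    complements. *)
Lemma multiplier_sigma_algebra :
  sigma_algebra setT [set A | multiplier \1_A].
Proof.
split => /=.
- by rewrite indic0; exact: multiplier_cst.
- move=> A MA; rewrite setTD (_ : \1_ _ = fun x => 1 - \1_A x).
    by apply: multiplierB => //; exact: multiplier_cst.
  by apply/funext => x; rewrite !indicE in_setC; case: (_ \in _); rewrite ?subrr ?subr0.
- move=> F MF.
  pose g (N : nat) (x : T) : R := \prod_(k < N) (1 - \1_(F k) x).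
  have g01 N x : 0 <= g N x <= 1.
    rewrite /g prodr_ile1 ?prodr_ge0//; move=> k _; rewrite indicE;
      by case: (_ \in _); rewrite ?subrr ?subr0 ?lexx ?ler01.
  have Mg N : multiplier (g N).
    rewrite /g; elim: N => [|N ih].
      by under eq_fun do rewrite big_ord0; exact: multiplier_cst.
    under eq_fun do rewrite big_ord_recr/=; apply: multiplierM => //.
    by apply: multiplierB => //; exact: multiplier_cst.
  apply: (@multiplier_lim (fun N x => 1 - g N x) _ 1).
  + by move=> N; apply: multiplierB => //; exact: multiplier_cst.
  + move=> N x; have /andP[? ?] := g01 N x; rewrite ger0_norm ?subr_ge0//.
    by rewrite lerBlDr lerDl.
  + move=> x; have [[k _ Fkx]|nFx] := pselect ((\bigcup_k F k) x).
      rewrite indicE mem_set; last by exists k.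
      apply: cvg_near_cst; exists k.+1 => // N /= kN.
      by rewrite /g (bigD1 (Ordinal kN))//= indicE mem_set// subrr mul0r subr0.
    rewrite indicE memNset//; apply: cvg_near_cst; apply: nearW => N.
    rewrite /g big1 ?subrr// => k _; rewrite indicE memNset ?subr0// => Fkx.
    by apply: nFx; exists k.
Qed.

Lemma sigma_algebra_multiplier_preimage (U : Type) (f : T -> U) :
  sigma_algebra setT [set B | multiplier \1_(f @^-1` B)].
Proof.
have [M0 MC MU] := multiplier_sigma_algebra.
split => [|A MA|F MF] /=.
- by rewrite preimage_set0; exact: M0.
- by rewrite setTD preimage_setC -setTD; exact: MC.
- by rewrite preimage_bigcup; exact: MU.
Qed.

Lemma multiplier_preimage phi :
  (forall a, multiplier \1_[set x | phi x < a]) ->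
  forall B : set R, measurable B -> multiplier \1_(phi @^-1` B).
Proof.
move=> Mphi; rewrite -/(_ `<=` [set B : set R | multiplier \1_(phi @^-1` B)]).
rewrite [X in X `<=` _](_ : _ = (@RGenInftyO.G R).-sigma.-measurable); last first.
  exact: RGenInftyO.measurableE.
apply: smallest_sub; first exact: sigma_algebra_multiplier_preimage.
move=> _ [a ->] /=; have := Mphi a; congr (multiplier \1_ _).
Qed.

Lemma multiplier_preimage_pair d1 d2 (U1 : measurableType d1)
    (U2 : measurableType d2) (f : T -> U1 * U2) :
  (forall A : set U1, measurable A -> multiplier \1_((fst \o f) @^-1` A)) ->
  (forall A : set U2, measurable A -> multiplier \1_((snd \o f) @^-1` A)) ->
  forall B : set (U1 * U2), measurable B -> multiplier \1_(f @^-1` B).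
Proof.
move=> M1 M2; apply: smallest_sub; first exact: sigma_algebra_multiplier_preimage.
by move=> _ [[A mA <-]|[A mA <-]] /=; rewrite setTI -comp_preimage; [exact: M1|exact: M2].
Qed.

Lemma eq_multiplier phi psi : bounded_measurable psi -> multiplier phi ->
  (forall x, (exists i, e i x != 0) -> phi x = psi x) -> multiplier psi.
Proof.
move=> bpsi [_ Mphi] phipsi; split=> // f nf.
have [_ h] := Mphi f nf; split; first by apply: bounded_measurableM => //; case: nf.
move=> i Pi; have := h i Pi; apply: cvg_trans; apply: near_eq_cvg; apply: nearW => n.
apply: eq_Rintegral => x _; have [->|eix] := eqVneq (e i x) 0; first by rewrite !mul0r.
by rewrite phipsi//; exists i.
Qed.

Lemma multiplier_measurable : (forall A, measurable A -> multiplier \1_A) ->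
  forall f, bounded_measurable f -> multiplier f.
Proof.
move=> MA.
suff Mge0 f : bounded_measurable f -> (forall x, 0 <= f x) -> multiplier f.
  move=> f bf; have [mf [C fC]] := bf.
  rewrite (_ : f = fun x => (f x + C) - C); last by apply/funext => x; rewrite addrK.
  apply: multiplierB; last exact: multiplier_cst.
  apply: Mge0 => [|x].
    by apply: bounded_measurableD => //; exact: bounded_measurable_cst.
  by have := fC x; rewrite ler_norml => /andP[? _]; rewrite -lerBlDr sub0r.
move=> [mf [C fC]] f0.
have mEf : measurable_fun setT (EFin \o f) by exact/measurable_EFinP.
pose g (k : nat) : T -> R := nnsfun_approx measurableT mEf k.
have gcvg (x : T) : g k x @[k --> \oo] --> f x.
  have h : EFin \o g^~ x @ \oo --> (f x)%:E.
    exact: (cvg_nnsfun_approx measurableT mEf (fun x _ => f0 x)).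
  by have /fine_cvgP[] := h.
apply: (multiplier_lim (phi_ := g) (C := C)) => //.
- move=> k; have mgk : measurable_fun setT (g k) by exact: measurable_funPT.
  have [m [t gkE]] : exists (m : nat) (t : seq R),
      g k = fun x => \sum_(i < m) t`_i * \1_(g k @^-1` [set t`_i]) x.
    eexists; eexists; apply/funext => x; rewrite {1}/g; exact: fimfunEord.
  rewrite gkE; elim: m {gkE} => [|m ih].
    by under eq_fun do rewrite big_ord0; exact: multiplier_cst.
  under eq_fun do rewrite big_ord_recr/=; apply: multiplierD => //.
  by apply: multiplierZ; apply: MA; exact: measurable_preimage.
- move=> k x; rewrite ger0_norm; last exact: fun_ge0.
  apply: (le_trans _ (fC x)); apply: (le_trans _ (ler_norm _)).
  apply: (cvgr_to_ge (gcvg x)).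
  by exists k => // n /= kn; have /lefP := nd_nnsfun_approx measurableT mEf kn; exact.
Qed.

End weak_multipliers.

(** * Weak density from coordinate multipliers and a positive weight *)

Section weak_density.
Context {R : realType}.
Variable mu : {finite_measure set (R3 R) -> \bar R}.
Variables p q : R.
Hypotheses (p0 : 0 < p) (q0 : 0 < q) (pq : p^-1 + q^-1 = 1).
Variables (J : Type) (P : set J) (e : J -> R3 R -> R).
Hypothesis me : forall i, measurable_fun setT (e i).
Hypothesis e1 : forall i x, `|e i x| <= 1.
Variables (z : nat -> R3 R -> R) (K : R).
Hypothesis Lz : forall n, Lpfun mu p (z n).
Hypothesis zK : forall n, \int[mu]_x (`|z n x| `^ p) <= K.
Variable H : set (R3 R).
Hypothesis mH : measurable H.
Hypothesis eH : forall i x, e i x != 0 -> H x.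
Hypothesis H1 : forall x, H x -> [/\ `|x.1.1| <= 1, `|x.1.2| <= 1 & 0 < x.2 <= 1].

Local Notation multiplier := (multiplier mu P e z).

Hypothesis M1 : multiplier (fun x => x.1.1 * \1_H x).
Hypothesis M2 : multiplier (fun x => x.1.2 * \1_H x).
Hypothesis M3 : multiplier (fun x => x.2 ^+ 2 * \1_H x).

Let eqM (A B : set (R3 R)) : measurable B -> multiplier \1_A ->
  (forall x, H x -> A x <-> B x) -> multiplier \1_B.
Proof.
move=> mB MA AB; apply: (eq_multiplier _ MA).
  split; first exact: measurable_indic.
  by exists 1 => x; rewrite indicE; case: (_ \in _); rewrite ?normr1 ?normr0.
move=> x [i /eH Hx]; rewrite !indicE; congr (nat_of_bool _)%:R.
by apply/idP/idP; rewrite !inE => /(AB _ Hx).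
Qed.

(** Steps of the coordinate multipliers give the half-spaces, which generate the Borel sets. The
    third coordinate is available only through its square, which determines it because it is
    positive on [H]. *)
Lemma bounded_multiplier f : bounded_measurable f -> multiplier f.
Proof.
have nH t x : `|t| <= 1 -> `|t * \1_H x| <= 1.
  move=> t1; rewrite normrM indicE.
  by case: (_ \in _); rewrite ?normr1 ?normr0 ?mulr1 ?mulr0.
have nH0 t x : ~ H x -> `|t * \1_H x| <= 1.
  by move=> Hx; rewrite indicE memNset// mulr0 normr0.
have h11 x : `|x.1.1 * \1_H x| <= 1.
  by have [/H1[? _ _]|] := pselect (H x); [exact: nH|exact: nH0].
have h12 x : `|x.1.2 * \1_H x| <= 1.
  by have [/H1[_ ? _]|] := pselect (H x); [exact: nH|exact: nH0].
have h2 x : `|x.2 ^+ 2 * \1_H x| <= 1.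
  have [/H1[_ _ /andP[x0 x1]]|] := pselect (H x); last exact: nH0.
  by apply: nH; rewrite normrX exprn_ile1 ?normr_ge0// gtr0_norm.
have HE x : H x -> \1_H x = 1 :> R by move=> Hx; rewrite indicE mem_set.
have mray (g : R3 R -> R) a : measurable_fun setT g -> measurable [set x | g x < a].
  move=> mg; rewrite (_ : [set x | _] = g @^-1` `]-oo, a[%classic).
    by apply: measurable_preimage => //; exact: measurable_itv.
  by apply/seteqP; split => x /=; rewrite in_itv.
apply: (multiplier_measurable p0 q0 pq me e1 Lz zK) => //.
have c1 (A : set R) : measurable A -> multiplier \1_((fst \o fst) @^-1` A).
  apply: (multiplier_preimage p0 q0 pq me e1 Lz zK) => a.
  apply: (eqM (mray _ _ measurable_coord1) (multiplier_step p0 q0 pq me e1 Lz zK a M1 h11)).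
  by move=> x /HE /= ->; rewrite mulr1.
have c2 (A : set R) : measurable A -> multiplier \1_((snd \o fst) @^-1` A).
  apply: (multiplier_preimage p0 q0 pq me e1 Lz zK) => a.
  apply: (eqM (mray _ _ measurable_coord2) (multiplier_step p0 q0 pq me e1 Lz zK a M2 h12)).
  by move=> x /HE /= ->; rewrite mulr1.
have c12 (A : set (R * R)) : measurable A -> multiplier \1_(fst @^-1` A).
  exact: (multiplier_preimage_pair p0 q0 pq me e1 Lz zK).
have c3 (A : set R) : measurable A -> multiplier \1_(snd @^-1` A).
  apply: (multiplier_preimage p0 q0 pq me e1 Lz zK) => a; have [a0|a0] := ltP 0 a.
    have M3a := multiplier_step p0 q0 pq me e1 Lz zK (a ^+ 2) M3 h2.
    apply: (eqM (mray _ _ measurable_coord3) M3a).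
    move=> x Hx /=; rewrite HE// mulr1; have [_ _ /andP[x0 _]] := H1 Hx.
    by rewrite ltr_pXn2r// nnegrE ltW.
  apply: (@eqM set0); first exact: mray measurable_coord3.
    by rewrite indic0; exact: (multiplier_cst p0 q0 pq P me e1 Lz).
  move=> x /H1[_ _ /andP[x0 _]]; split => //= xa; have := lt_trans x0 xa.
  by rewrite ltNge a0.
move=> A mA; exact: (multiplier_preimage_pair p0 q0 pq me e1 Lz zK (f := id) c12 c3 mA).
Qed.

(** Writing [f = e i0 * g] would need the quotient [f / e i0], which may be unbounded. The bounded
    [g k = f k / (1 + k e i0)] is used instead; the error [f / (1 + k e i0)] tends to 0 on [H] and
    is dominated. *)
Lemma moments_weakly_dense (i0 : J) :
  P i0 -> (forall x, H x -> 0 < e i0 x) -> (mu (~` H) = 0)%E ->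
  (forall i, P i -> \int[mu]_x (e i x * z n x) @[n --> \oo] --> 0) ->
  forall (f : R3 R -> R) (C : R), measurable_fun setT f -> (forall x, `|f x| <= C) ->
    \int[mu]_x (f x * z n x) @[n --> \oo] --> 0.
Proof.
move=> Pi0 e0 muH ez f C mf fC.
pose ev := e i0; have ev0 x : 0 <= ev x.
  have [/e0/ltW//|Hx] := pselect (H x).
  by have [->//|/eH] := eqVneq (ev x) 0.
pose g (k : nat) x := f x * (k%:R * (1 + k%:R * ev x) `^ (-1)).
have d0 k x : 0 < 1 + k%:R * ev x by rewrite ltr_pwDl// mulr_ge0.
have invE k x : (1 + k%:R * ev x) `^ (-1) = (1 + k%:R * ev x)^-1.
  by rewrite powR_inv1// ltW.
have mev : measurable_fun setT ev by exact: me.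
have mg k : measurable_fun setT (g k).
  apply: measurable_funM => //; apply: measurable_funM => //.
  apply: (measurableT_comp (measurable_powR _)).
  by apply: measurable_funD => //; exact: measurable_funM.
have C0 : 0 <= C by apply: le_trans (fC point).
have bg k : bounded_measurable (g k).
  split => //; exists (C * (k%:R * 1)) => x; rewrite /g !normrM invE.
  apply: ler_pM => //; rewrite normr_nat; apply: ler_wpM2l => //.
  by rewrite ger0_norm ?invr_ge0 ?(ltW (d0 _ _))// invf_le1// lerDl mulr_ge0.
have n1 : weakly_null mu P e z (cst 1).
  split => [|i Pi]; first exact: bounded_measurable_cst.
  by under eq_fun do under eq_Rintegral do rewrite mulr1; exact: ez.
have step k : \int[mu]_x (ev x * g k x * z n x) @[n --> \oo] --> 0.
  have [_ /(_ _ n1)[_ /(_ i0 Pi0)]] := bounded_multiplier (bg k).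
  by under eq_fun do under eq_Rintegral do rewrite mul1r.
pose b k x := f x - ev x * g k x.
have bE k x : b k x = f x * (1 + k%:R * ev x)^-1.
  by rewrite /b /g invE; field; rewrite gt_eqF.
have mb k : measurable_fun setT (b k).
  by apply: measurable_funB => //; exact: measurable_funM.
have bC k x : `|b k x| <= C.
  rewrite bE normrM -[leRHS]mulr1; apply: ler_pM => //.
  by rewrite ger0_norm ?invr_ge0 ?(ltW (d0 _ _))// invf_le1// lerDl mulr_ge0.
have b0 x : H x -> b k x @[k --> \oo] --> 0.
  move=> /e0 ex; have h : f x * (1 + k%:R * ev x)^-1 @[k --> \oo] --> f x * 0.
    apply: cvgM; first exact: cvg_cst.
    apply/gtr0_cvgV0; first by apply: nearW => k; exact: d0.
    have ky : ev x * k%:R @[k --> \oo] --> +oo.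
      exact: (cvg_comp _ _ (@cvgr_idn R) (gt0_cvgMry ex cvg_id)).
    apply: (ger_cvgy _ ky); apply: nearW => k.
    by rewrite mulrC lerDr.
  rewrite mulr0 in h; apply: cvg_trans h; apply: near_eq_cvg; apply: nearW => k.
  by rewrite bE.
have b0ae : {ae mu, forall x, b k x @[k --> \oo] --> 0}.
  exists (~` H); split => //; first exact: measurableC.
  by move=> x /= nb /b0.
have Lc : Lpfun mu q (cst C).
  by apply: (@Lpfun_bounded _ _ _ _ _ _ C) => [|//|x]; [exact: ltW|rewrite ger0_norm].
have Lbd (g1 : R3 R -> R) (D : R) : measurable_fun setT g1 ->
    (forall x, `|g1 x| <= D) -> Lpfun mu q g1.
  by move=> mg1 gD; apply: (@Lpfun_bounded _ _ _ _ _ _ D) => //; exact: ltW.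
have Lb k : Lpfun mu q (b k) by exact: Lbd (mb k) (bC k).
apply/(@cvgr0Pnorm_le R R) => eps eps0.
have e20 : 0 < eps / 2 by rewrite divr_gt0.
have [k _ /(_ k (leqnn k)) hk] := Lpfun_vanish p0 q0 pq mb Lc
   (fun k => aeW _ (fun x => le_trans (bC k x) (ler_norm _))) b0ae K e20.
have /(@cvgr0Pnorm_le R R)/(_ _ e20) := step k; apply: filterS => n hn.
have ib : mu.-integrable setT (EFin \o (fun x => b k x * z n x)).
  exact: (Lpfun_mul p0 q0 pq (Lb k) (Lz n)).
have -> : \int[mu]_x (f x * z n x) =
   \int[mu]_x (b k x * z n x) + \int[mu]_x (ev x * g k x * z n x).
  rewrite -RintegralD//; first by apply: eq_Rintegral => x _ /=; rewrite /b; ring.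
  apply: (Lpfun_mul p0 q0 pq _ (Lz n)); apply: (Lbd _ (C + C)).
    exact: measurable_funM.
  move=> x; rewrite (_ : ev x * g k x = f x - b k x); last by rewrite /b; ring.
  by apply: le_trans (ler_normB _ _) _; apply: lerD.
apply: le_trans (ler_normD _ _) _; rewrite [leRHS]splitr; apply: lerD => //.
apply: (le_trans _ (hk _ (Lz n) (zK n))).
by apply: le_norm_Rint => //; exact: integrable_norm.
Qed.

End weak_density.

(** * The Green kernel of the hemisphere *)

Section green_expansion.
Context {R : realType}.
Implicit Types (x y : R3 R) (i : nat * nat * nat).

Definition green_index (N : nat) : seq (nat * nat * nat) :=
  [seq (kj.1, kj.2, a) | kj <- [seq (k, j) | k <- iota 0 N, j <- iota 0 k.+2],
     a <- iota 0 (kj.1.+1 - kj.2).+1].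

(* The index [(k, j, a)] stands for the monomial
   [x1 ^ (k + 1 - j - a) * x2 ^ a * x3 ^ j]; its coefficient is read off the
   degree [k + 1] terms of [- ln (1 - x.y) + ln (1 - x.y')] and vanishes for
   even [j]. *)
Definition green_coef i : R := (pi *+ 4)^-1 * (i.1.1.+1%:R^-1 *
  ('C(i.1.1.+1, i.1.2)%:R * 'C(i.1.1.+1 - i.1.2, i.2)%:R * (1 - (-1) ^+ i.1.2))).

Definition green_monomial i x : R :=
  x.1.1 ^+ (i.1.1.+1 - i.1.2 - i.2) * x.1.2 ^+ i.2 * x.2 ^+ i.1.2 *
  \1_hemisphere x.

Definition green_psum N x y : R :=
  \sum_(i <- green_index N) green_coef i * green_monomial i x * green_monomial i y.

Lemma sum_green_index N (F : nat * nat * nat -> R) :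
  \sum_(i <- green_index N) F i =
  \sum_(k < N) \sum_(j < k.+2) \sum_(a < (k.+1 - j).+1) F (k : nat, j : nat, a : nat).
Proof.
rewrite /green_index big_allpairs_dep big_allpairs_dep.
rewrite -[N in LHS]subn0 -/(index_iota 0 N) big_mkord; apply: eq_bigr => k _.
rewrite -[X in iota 0 X]subn0 -/(index_iota 0 _) big_mkord; apply: eq_bigr => j _.
by rewrite -[X in iota 0 X]subn0 -/(index_iota 0 _) big_mkord.
Qed.

Lemma green_indexP i N : reflect
  [/\ (i.1.1 < N)%N, (i.1.2 < i.1.1.+2)%N & (i.2 < (i.1.1.+1 - i.1.2).+1)%N]
  (i \in green_index N).
Proof.
have inE2 k j : ((k, j) \in [seq (k, j) | k <- iota 0 N, j <- iota 0 k.+2]) =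
    (k < N)%N && (j < k.+2)%N.
  apply/allpairsPdep/andP => [[k' [j' []]]|[kN jk]].
    by rewrite !mem_iota => kN jk [-> ->].
  by exists k, j; rewrite !mem_iota.
move: i => [[k j] a]; apply: (iffP (@allpairsPdep _ _ _ _ _ _ _)) => /=.
  move=> [[k1 j1] [a1 []]]; rewrite inE2 => /andP[k1N j1k] /= a1k [-> -> ->].
  have : a1 \in iota 0 (k1.+1 - j1).+1 by [].
  by rewrite mem_iota.

by move=> [kN jk ak]; exists (k, j), a; split => //; [rewrite inE2 kN|
  have : a \in iota 0 (k.+1 - j).+1 by rewrite mem_iota].
Qed.

(** Only odd powers of [w] survive, with a factor 2, so the coefficients are nonnegative. It is
    applied with [w = x3 y3], whose sign the reflection changes. *)
Lemma trinomial_sub (u v w : R) m :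
  (u + v + w) ^+ m - (u + v - w) ^+ m =
  \sum_(j < m.+1) \sum_(a < (m - j).+1) 'C(m, j)%:R * 'C(m - j, a)%:R *
     (1 - (-1) ^+ j) * (u ^+ (m - j - a) * v ^+ a * w ^+ j).
Proof.
rewrite exprDn exprBn -sumrB; apply: eq_bigr => j _.
rewrite exprDn; under [RHS]eq_bigr => a _.
  rewrite (_ : _ * _ = 'C(m, j)%:R * (1 - (-1) ^+ j) * w ^+ j *
     ((u ^+ (m - j - a) * v ^+ a) *+ 'C(m - j, a))); last by
    rewrite -[in RHS](mulr_natr (_ * _)); ring.
  over.
rewrite -mulr_sumr -mulrnBl; move: (\sum_(_ < _) _) => S.
by rewrite -[in LHS](mulr_natr (_ - _)); ring.
Qed.

Lemma green_psumE N x y : hemisphere x -> hemisphere y ->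
  green_psum N x y =
  (pi *+ 4)^-1 * (log_psum N (dot x y) - log_psum N (dot x (reflect3 y))).
Proof.
move=> Hx Hy; rewrite /green_psum sum_green_index /log_psum -sumrB mulr_sumr.
apply: eq_bigr => k _.
rewrite -mulrBl (_ : dot x (reflect3 y) =
    x.1.1 * y.1.1 + x.1.2 * y.1.2 - x.2 * y.2); last by rewrite /dot/= mulrN.
rewrite /dot trinomial_sub mulr_suml mulr_sumr; apply: eq_bigr => j _.
rewrite mulr_suml mulr_sumr; apply: eq_bigr => a _.
rewrite /green_coef /green_monomial/= !indicE !mem_set// !mulr1 !exprMn; ring.
Qed.

Lemma green_psum_off N x y : ~ (hemisphere x /\ hemisphere y) -> green_psum N x y = 0.
Proof.
move=> H; rewrite /green_psum big1// => i _.
have [Hx|Hx] := pselect (hemisphere x); last first.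
  by rewrite /green_monomial [\1__ x]indicE memNset// !mulr0 mul0r.
by rewrite /green_monomial [\1__ y]indicE memNset ?mulr0// => Hy; exact: H.
Qed.

Lemma green_coef_ge0 i : 0 <= green_coef i.
Proof.
have p4 : 0 <= (pi *+ 4 : R) by rewrite mulrn_wge0// pi_ge0.
apply: mulr_ge0; first by rewrite invr_ge0.
apply: mulr_ge0; first by rewrite invr_ge0.
apply: mulr_ge0; first by rewrite mulr_ge0.
by rewrite -signr_odd; case: odd; rewrite ?expr0 ?expr1 ?subrr// opprK addr_ge0.
Qed.

Lemma green_coef_gt0 i : (0 < green_coef i) =
  [&& odd i.1.2, (i.1.2 <= i.1.1.+1)%N & (i.2 <= i.1.1.+1 - i.1.2)%N].
Proof.
have p4 : 0 < (pi *+ 4 : R)^-1 by rewrite invr_gt0 pmulrn_lgt0// pi_gt0.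
rewrite /green_coef pmulr_rgt0// pmulr_rgt0 ?invr_gt0//.
rewrite -signr_odd; case: odd; last by rewrite expr0 subrr mulr0 ltxx.
rewrite expr1 opprK pmulr_lgt0; last by rewrite addr_gt0.
rewrite -natrM ltr0n muln_gt0 !bin_gt0; done.
Qed.

Lemma green_monomial_le1 i x : `|green_monomial i x| <= 1.
Proof.
rewrite /green_monomial indicE; have [|_] := boolP (x \in _); last first.
  by rewrite mulr0 normr0.
rewrite inE => -[xS _]; have [x1 x2 x3] := coord_sphere xS.
by rewrite mulr1 !normrM !normrX !mulr_ile1 ?mulr_ge0 ?exprn_ge0 ?exprn_ile1.
Qed.

Lemma measurable_green_monomial i : measurable_fun setT (green_monomial i).
Proof.
apply: measurable_funM; last exact: (measurable_indic measurable_hemisphere).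
apply: measurable_funM; last exact: (measurable_funX _ measurable_coord3).
apply: measurable_funM; first exact: (measurable_funX _ measurable_coord1).
exact: (measurable_funX _ measurable_coord2).
Qed.

Lemma enorm_sub_sphere x y : sphere x -> sphere y ->
  enorm (x - y) = Num.sqrt (2 * (1 - dot x y)).
Proof.
move=> /dot_sphere xx /dot_sphere yy; congr Num.sqrt.
have -> : dot (x - y) (x - y) = dot x x + dot y y - 2 * dot x y.
  by rewrite /dot/=; ring.
by rewrite xx yy; ring.
Qed.

Lemma sphere_reflect3 y : sphere y -> sphere (reflect3 y).
Proof. by rewrite /sphere/= => <-; rewrite /enorm /dot /reflect3/= mulrNN. Qed.

(** On the sphere [1 - x.y] and [1 + x.y] are half the squared norms of [x - y] and [x + y], hence
    at least half the squared third coordinates; the same holds with [y']. As [x3 y3 > 0], the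
    smaller of these is [(y3 - x3) ^ 2 / 2]. *)
Lemma dot_hemisphere_le x y : hemisphere x -> hemisphere y ->
  `|dot x y| <= 1 - (y.2 - x.2) ^+ 2 / 2 /\
  `|dot x (reflect3 y)| <= 1 - (y.2 - x.2) ^+ 2 / 2.
Proof.
move=> [/dot_sphere + x0] [/dot_sphere + y0]; have := mulr_gt0 x0 y0.
rewrite /dot /reflect3/= -!expr2 !ler_norml => xy xx yy.
have := sqr_ge0 (x.1.1 - y.1.1); have := sqr_ge0 (x.1.1 + y.1.1).
have := sqr_ge0 (x.1.2 - y.1.2); have := sqr_ge0 (x.1.2 + y.1.2).
by split; apply/andP; split; lra.
Qed.

Definition green_kernel x y : R :=
  (pi *+ 2)^-1 * ln (enorm (x - reflect3 y) / enorm (x - y)) *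
  \1_hemisphere x * \1_hemisphere y.

End green_expansion.

Section green_kernel_bounds.
Context {R : realType}.
Variable q : R.
Hypothesis q0 : 0 < q.
Implicit Types x y : R3 R.

(** A finite measure on the whole space, so that the abstract results, which integrate over [setT],
    apply to functions extended by 0. *)
Definition hemi_area := mfrestr (@measurable_hemisphere R) (@area_hemisphere_fin R).

HB.instance Definition _ := FiniteMeasure.on hemi_area.

Lemma hemi_areaE (A : set (R3 R)) : hemi_area A = area (hemisphere `&` A).
Proof. by rewrite /hemi_area /mfrestr /mrestr setIC. Qed.

Lemma Rintegral_hemi_area (f : R3 R -> R) :
  \int[area]_(x in hemisphere) f x = \int[hemi_area]_x (f \_ hemisphere) x.
Proof.
rewrite -Rintegral_mkcond /Rintegral; congr fine.
apply: eq_measure_integral => A mA AH; rewrite /= hemi_areaE.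
by rewrite setIidr.
Qed.

Lemma green_kernelE x y : hemisphere x -> hemisphere y -> x.2 != y.2 ->
  green_kernel x y =
  (pi *+ 4)^-1 * (- ln (1 - dot x y) - - ln (1 - dot x (reflect3 y))).
Proof.
move=> Hx Hy xy; have [d1 d2] := dot_hemisphere_le Hx Hy.
have s0 : 0 < (y.2 - x.2) ^+ 2 / 2.
  by rewrite divr_gt0// exprn_even_gt0//= subr_eq0 eq_sym.
have [xS _] := Hx; have [yS _] := Hy.
have p1 : 0 < 1 - dot x y by move: d1; rewrite ler_norml => /andP[? ?]; lra.
have p2 : 0 < 1 - dot x (reflect3 y) by move: d2; rewrite ler_norml => /andP[? ?]; lra.
have sqrtE (t : R) : 0 < t -> ln (Num.sqrt (2 * t)) = 2^-1 * (ln 2 + ln t).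
  move=> t0; rewrite -lnM ?posrE// -powR12_sqrt ?mulr_ge0 ?(ltW t0)//.
  by rewrite ln_powR.
rewrite /green_kernel !indicE !mem_set// !mulr1.
rewrite enorm_sub_sphere//; last exact: sphere_reflect3.
rewrite enorm_sub_sphere//.
rewrite ln_div ?posrE ?sqrtr_gt0 ?mulr_gt0//.
rewrite !sqrtE//; have := pi_gt0 R => pi0.
by move: (@pi R) pi0 => c c0; field; rewrite gt_eqF.
Qed.

Lemma green_psum_cvg x y : x.2 != y.2 ->
  green_psum n x y @[n --> \oo] --> green_kernel x y.
Proof.
move=> xy; have [[Hx Hy]|H] := pselect (hemisphere x /\ hemisphere y); last first.
  rewrite (_ : green_kernel x y = 0); last first.
    rewrite /green_kernel; have [Hx|Hx] := pselect (hemisphere x).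
      by rewrite [\1__ y]indicE memNset ?mulr0// => Hy; exact: H.
    by rewrite [\1__ x]indicE memNset// mulr0 mul0r.
  by under eq_fun do rewrite green_psum_off//; exact: cvg_cst.
rewrite green_kernelE//; under eq_fun do rewrite green_psumE//.
have [d1 d2] := dot_hemisphere_le Hx Hy.
have s0 : 0 < (y.2 - x.2) ^+ 2 / 2.
  by rewrite divr_gt0// exprn_even_gt0//= subr_eq0 eq_sym.
have r1 : 1 - (y.2 - x.2) ^+ 2 / 2 < 1 by rewrite ltrBlDr ltrDl.
apply: cvgM; first exact: cvg_cst.
by apply: cvgB; apply: log_psum_cvg; [exact: le_lt_trans d1 r1|exact: le_lt_trans d2 r1].
Qed.

(* From [1 - |x.y| >= s] with [s = (x3 - y3)^2 / 2], and likewise for [x.y'],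
   and [- ln s <= s^-a / a] with [a = 1 / (4 q)]: the power of [green_bound]
   that has to be integrable is then [|x3 - y3|^(-1/2)]. *)
Definition green_bound x y : R :=
  (pi *+ 4)^-1 * (8 * q * 2 `^ (4 * q)^-1) * (`|y.2 - x.2|^-1) `^ (2 * q)^-1 *
  \1_hemisphere x * \1_hemisphere y.

Let bound_cst_ge0 : 0 <= (pi *+ 4)^-1 * (8 * q * 2 `^ (4 * q)^-1) :> R.
Proof.
apply: mulr_ge0; first by rewrite invr_ge0 mulrn_wge0// pi_ge0.
by apply: mulr_ge0; [apply: mulr_ge0 => //; exact: ltW|exact: powR_ge0].
Qed.

Lemma green_bound_ge0 x y : 0 <= green_bound x y.
Proof.
do 2!(apply: mulr_ge0; last by rewrite indicE).
by apply: mulr_ge0; [exact: bound_cst_ge0|exact: powR_ge0].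
Qed.

Lemma green_psum_le n x y : x.2 != y.2 -> `|green_psum n x y| <= green_bound x y.
Proof.
move=> xy; have [[Hx Hy]|H] := pselect (hemisphere x /\ hemisphere y); last first.
  by rewrite green_psum_off// normr0 green_bound_ge0.
have [d1 d2] := dot_hemisphere_le Hx Hy.
have n0 : 0 < `|y.2 - x.2| by rewrite normr_gt0 subr_eq0 eq_sym.
pose s := (y.2 - x.2) ^+ 2 / 2.
have s0 : 0 < s by rewrite divr_gt0// exprn_even_gt0//= subr_eq0 eq_sym.
have r1 : 1 - s < 1 by rewrite ltrBlDr ltrDl.
have a0 : 0 < (4 * q)^-1 by rewrite invr_gt0 mulr_gt0.
have p4 : 0 <= (pi *+ 4 : R)^-1 by rewrite invr_ge0 mulrn_wge0 ?pi_ge0.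
rewrite green_psumE// normrM ger0_norm// /green_bound !indicE !mem_set// !mulr1.
rewrite -mulrA; apply: ler_wpM2l => //.
apply: le_trans (ler_normB _ _) _.
have b1 := log_psum_norm_le n d1 r1; have b2 := log_psum_norm_le n d2 r1.
apply: le_trans (lerD b1 b2) _; rewrite opprB addrCA subrr addr0.
(* Each of the two logarithms costs [1 / a = 4 q]; this is the origin of the factor [8 q]. *)
have := oppln_le_powR s0 a0; rewrite invrK.
have -> : (s^-1) `^ (4 * q)^-1 = 2 `^ (4 * q)^-1 * (`|y.2 - x.2|^-1) `^ (2 * q)^-1.
  rewrite /s invfM invrK mulrC powRM ?invr_ge0 ?sqr_ge0//; congr (_ * _).
  rewrite -real_normK ?num_real// -exprVn -powR_mulrn ?invr_ge0// -powRrM.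
  by congr (_ `^ _); field; rewrite gt_eqF.
set A := 2 `^ _; set B := _ `^ _ => h; lra.
Qed.

Lemma measurable_green_bound x : measurable_fun setT (green_bound x).
Proof.
apply: measurable_funM; last exact: (measurable_indic measurable_hemisphere).
apply: measurable_funM => //; apply: measurable_funM => //.
have mB : measurable_fun setT (fun y : R3 R => y.2 - x.2).
  exact: measurable_funB measurable_coord3 (measurable_cst _).
apply: (measurableT_comp (measurable_powR _)).
rewrite (_ : (fun y : R3 R => `|y.2 - x.2|^-1) = (fun y => `|y.2 - x.2| `^ (- 1))).
  apply: (measurableT_comp (measurable_powR _)).
  exact: measurableT_comp mB.
by apply/funext => y; rewrite powR_inv1.
Qed.

Lemma measurable_green_kernel x : measurable_fun setT (green_kernel x).
Proof.
apply: measurable_funM; last exact: (measurable_indic measurable_hemisphere).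
apply: measurable_funM => //; apply: measurable_funM => //.
apply: (measurableT_comp (@measurable_ln R)).
have mE (f : R3 R -> R3 R) : measurable_fun setT f ->
    measurable_fun setT (fun y => enorm (x - f y)).
  move=> mf; have mc1 : measurable_fun setT (fun y => (f y).1.1).
    exact: measurableT_comp measurable_coord1 mf.
  have mc2 : measurable_fun setT (fun y => (f y).1.2).
    exact: measurableT_comp measurable_coord2 mf.
  have mc3 : measurable_fun setT (fun y => (f y).2).
    exact: measurableT_comp measurable_coord3 mf.
  apply: measurableT_comp measurable_enorm _.
  apply: measurable_fun_pair; last exact: measurable_funB.
  by apply: measurable_fun_pair; exact: measurable_funB.
rewrite (_ : (fun y => _) =
    fun y => enorm (x - reflect3 y) * enorm (x - y) `^ (- 1)); last first.
  by apply/funext => y; rewrite powR_inv1// sqrtr_ge0.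
apply: measurable_funM.
  apply: mE; apply: measurable_fun_pair; last first.
    exact: measurableT_comp measurable_coord3.
  apply: measurable_fun_pair; first exact: measurable_coord1.
  exact: measurable_coord2.
by apply: (measurableT_comp (measurable_powR _)); exact: mE.
Qed.

Definition green_bound_cst : R :=
  ((pi *+ 4)^-1 * (8 * q * 2 `^ (4 * q)^-1)) `^ q * (pi *+ 16).

Lemma green_bound_integral x :
  (\int[hemi_area]_y (`|green_bound x y| `^ q)%:E <= green_bound_cst%:E)%E.
Proof.
have C0 := bound_cst_ge0.
set C := (X in 0 <= X) in C0.
have mH := @measurable_hemisphere R.
have K0 : 0 <= green_bound_cst.
  by apply: mulr_ge0; [exact: powR_ge0|rewrite mulrn_wge0// pi_ge0].
have off y : ~ (hemisphere x /\ hemisphere y) -> `|green_bound x y| `^ q = 0.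
  move=> H; rewrite (_ : green_bound x y = 0) ?normr0 ?powR0 ?gt_eqF//.
  rewrite /green_bound; have [Hx|Hx] := pselect (hemisphere x).
    by rewrite [\1__ y]indicE memNset ?mulr0// => Hy; exact: H.
  by rewrite [\1__ x]indicE memNset// mulr0 mul0r.
have [Hx|Hx] := pselect (hemisphere x); last first.
  by rewrite integral0_eq// => y _; rewrite off// => -[].
have x01 : 0 < x.2 <= 1.
  have [xS ->] := Hx; have [_ _ x1] := coord_sphere xS.
  exact: le_trans (ler_norm _) x1.
rewrite (_ : (\int[hemi_area]_y _ =
    \int[area]_(y in hemisphere) (`|green_bound x y| `^ q)%:E)%E); last first.
  rewrite [RHS](@eq_measure_integral _ _ _ _ hemi_area); last first.
    by move=> A mA AH; rewrite /= hemi_areaE setIidr.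
  rewrite [RHS]integral_mkcond; apply: eq_integral => y _; rewrite patchE.
  by case: ifPn => //; rewrite notin_setE => Hy; rewrite off// => -[].
rewrite (eq_integral
    (fun y => (C `^ q)%:E * ((`|y.2 - x.2|^-1) `^ 2^-1)%:E)%E); last first.
  move=> y; rewrite inE => Hy; rewrite -EFinM; congr EFin.
  rewrite ger0_norm ?green_bound_ge0// /green_bound !indicE !mem_set// !mulr1.
  rewrite powRM ?powR_ge0// -powRrM (_ : (2 * q)^-1 * q = 2^-1)//.
  by field; rewrite gt_eqF.
rewrite ge0_integralZl//; last 2 first.
- apply: measurable_funTS; apply/measurable_EFinP.
  have mB : measurable_fun setT (fun y : R3 R => y.2 - x.2).
    exact: measurable_funB measurable_coord3 (measurable_cst _).
  apply: (measurableT_comp (measurable_powR _)).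
  rewrite (_ : (fun y : R3 R => `|y.2 - x.2|^-1) = (fun y => `|y.2 - x.2| `^ (- 1))).
    apply: (measurableT_comp (measurable_powR _)).
    exact: measurableT_comp mB.
  by apply/funext => y; rewrite powR_inv1.
- by rewrite lee_fin powR_ge0.
rewrite /green_bound_cst EFinM; apply: lee_wpmul2l; first by rewrite lee_fin powR_ge0.
exact: area_singular.
Qed.

Lemma Lpfun_green_bound x : Lpfun hemi_area q (green_bound x).
Proof.
have mb := measurable_green_bound x.
have mq : measurable_fun setT (fun y => `|green_bound x y| `^ q).
  exact: measurable_norm_powR.
split => //; apply/integrableP; split; first exact/measurable_EFinP.
apply: (le_lt_trans _ (ltry green_bound_cst)).
under eq_integral do rewrite abse_EFin ger0_norm ?powR_ge0//.
exact: green_bound_integral.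
Qed.

Lemma green_bound_Rintegral_le x :
  \int[hemi_area]_y (`|green_bound x y| `^ q) <= green_bound_cst.
Proof.
rewrite -lee_fin fineK; first exact: green_bound_integral.
by apply: integrable_fin_num => //; exact: (Lpfun_green_bound x).2.
Qed.

End green_kernel_bounds.

(** * Weak density of the monomials in the Green kernel *)

Section hemisphere_density.
Context {R : realType}.
Variables p q : R.
Hypotheses (p0 : 0 < p) (q0 : 0 < q) (pq : p^-1 + q^-1 = 1).
Variables (z : nat -> R3 R -> R) (K : R).
Hypothesis Lz : forall n, Lpfun (@hemi_area R) p (z n).
Hypothesis zK : forall n, \int[@hemi_area R]_x (`|z n x| `^ p) <= K.

Let P : set (nat * nat * nat) := [set i | 0 < green_coef i :> R].
Local Notation multiplier := (multiplier (@hemi_area R) P green_monomial z).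

(** If multiplication by [t] maps the monomials indexed by [P] to such monomials, weak nullity is
    inherited by reindexing. *)
Let shift_multiplier (t : R3 R -> R) (C : R) (sh : nat * nat * nat -> nat * nat * nat) :
  measurable_fun setT t -> (forall x, `|t x| <= C) ->
  (forall i, P i -> P (sh i)) ->
  (forall i x, P i -> green_monomial i x * t x = green_monomial (sh i) x) ->
  multiplier t.
Proof.
move=> mt tC Psh gt; split; first by split => //; exists C.
move=> f [bf f0]; split.
  by apply: bounded_measurableM => //; split => //; exists C.
move=> i Pi; have := f0 _ (Psh _ Pi); apply: cvg_trans; apply: near_eq_cvg.
apply: nearW => n; apply: eq_Rintegral => x _.
by rewrite -gt//; ring.
Qed.

Let hcoord (x : R3 R) : hemisphere x ->
  [/\ `|x.1.1| <= 1, `|x.1.2| <= 1 & 0 < x.2 <= 1].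
Proof.
move=> [/coord_sphere[x1 x2 x3] x0]; split => //; rewrite x0.
exact: le_trans (ler_norm _) x3.
Qed.

Let measurable_indic_hemisphere : measurable_fun setT (\1_hemisphere : R3 R -> R).
Proof. exact: (measurable_indic measurable_hemisphere). Qed.

Let indicM_le (t : R3 R -> R) x : (hemisphere x -> `|t x| <= 1) ->
  `|t x * \1_hemisphere x| <= 1.
Proof.
move=> t1; rewrite normrM indicE; case: (boolP (x \in _)) => [|_].
  by rewrite inE => /t1; rewrite normr1 mulr1.
by rewrite normr0 mulr0.
Qed.

Let mult1 : multiplier (fun x => x.1.1 * \1_hemisphere x).
Proof.
apply: (shift_multiplier (C := 1) (sh := fun i => (i.1.1.+1, i.1.2, i.2))).
- by apply: measurable_funM => //; exact: measurable_coord1.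
- by move=> x; apply: (indicM_le (t := fun x => x.1.1)) => /hcoord[].
- move=> [[k j] a]; rewrite /P/= !green_coef_gt0/= => /and3P[-> jk ak].
  by rewrite (leq_trans jk)//= (leq_trans ak)// leq_sub2r.
- move=> [[k j] a] x; rewrite /P/= green_coef_gt0/= => /and3P[_ jk ak].
  rewrite /green_monomial/= indicE; case: (_ \in _); rewrite ?mulr0// !mulr1.
  by rewrite (_ : k.+2 - j - a = (k.+1 - j - a).+1)%N ?exprS; [ring|lia].
Qed.

Let mult2 : multiplier (fun x => x.1.2 * \1_hemisphere x).
Proof.
apply: (shift_multiplier (C := 1) (sh := fun i => (i.1.1.+1, i.1.2, i.2.+1))).
- by apply: measurable_funM => //; exact: measurable_coord2.
- by move=> x; apply: (indicM_le (t := fun x => x.1.2)) => /hcoord[].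
- move=> [[k j] a]; rewrite /P/= !green_coef_gt0/= => /and3P[-> jk ak] /=; lia.
- move=> [[k j] a] x; rewrite /P/= green_coef_gt0/= => /and3P[_ jk ak].
  rewrite /green_monomial/= indicE; case: (_ \in _); rewrite ?mulr0// !mulr1.
  by rewrite (_ : k.+2 - j - a.+1 = k.+1 - j - a)%N ?exprS; [ring|lia].
Qed.

(** Raising the exponent of [x3] by two keeps it odd; multiplication by [x3] alone would leave
    [P]. *)
Let mult3 : multiplier (fun x => x.2 ^+ 2 * \1_hemisphere x).
Proof.
apply: (shift_multiplier (C := 1) (sh := fun i => (i.1.1.+2, i.1.2.+2, i.2))).
- apply: measurable_funM => //; apply: measurable_funX; exact: measurable_coord3.
- move=> x; apply: (indicM_le (t := fun x => x.2 ^+ 2)) => /hcoord[_ _ /andP[x0 x1]].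
  by rewrite normrX exprn_ile1// gtr0_norm.
- move=> [[k j] a]; rewrite /P/= !green_coef_gt0/= => /and3P[jo jk ak].
  by rewrite negbK jo; lia.
- move=> [[k j] a] x; rewrite /P/= green_coef_gt0/= => /and3P[_ jk ak].
  rewrite /green_monomial/= indicE; case: (_ \in _); rewrite ?mulr0// !mulr1.
  by rewrite (_ : k.+3 - j.+2 - a = k.+1 - j - a)%N ?exprS; [ring|lia].
Qed.

Lemma green_moments_dense :
  (forall i, 0 < green_coef i :> R ->
    \int[@hemi_area R]_x (green_monomial i x * z n x) @[n --> \oo] --> 0) ->
  forall (f : R3 R -> R) (C : R), measurable_fun setT f ->
    (forall x, `|f x| <= C) ->
    \int[@hemi_area R]_x (f x * z n x) @[n --> \oo] --> 0.
Proof.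
(* The index [(0, 1, 0)] is the monomial [x3], positive on the open hemisphere, which serves as the
   weight. *)
apply: (@moments_weakly_dense _ (@hemi_area R) p q p0 q0 pq _ P green_monomial
  (@measurable_green_monomial R) (@green_monomial_le1 R) z K Lz zK hemisphere
  (@measurable_hemisphere R) _ hcoord mult1 mult2 mult3 (0%N, 1%N, 0%N)).
- move=> i x; rewrite /green_monomial indicE; case: (boolP (x \in _)).
    by rewrite inE.
  by rewrite mulr0 eqxx.
- by rewrite /P/= green_coef_gt0.
- move=> x Hx; rewrite /green_monomial/= indicE mem_set// !expr0 expr1 !mul1r mulr1.
  by case: Hx.
- apply: etrans (hemi_areaE _) _; rewrite setICr; exact: measure0.
Qed.

End hemisphere_density.

(** * Stability *)

Section hemisphere_restriction.
Context {R : realType}.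
Variables p q : R.
Hypotheses (p0 : 0 < p) (q0 : 0 < q) (pq : p^-1 + q^-1 = 1).
Implicit Types v w : R3 R -> R.

Local Notation mu := (@hemi_area R).
Local Notation Lp := (Lpfun mu p).
Local Notation rst v := (v \_ hemisphere).
Local Notation height := (fun x : R3 R => x.2 * \1_hemisphere x).

Lemma measurable_rst v : measurable_fun hemisphere v <-> measurable_fun setT (rst v).
Proof. exact: measurable_restrictT measurable_hemisphere. Qed.

Lemma equidist_rst v w : equidist mu (rst v) (rst w) <->
  forall s : R, area (hemisphere `&` [set x | s < w x]) =
                area (hemisphere `&` [set x | s < v x]).
Proof.
have E u (s : R) : mu [set x | s < rst u x] = area (hemisphere `&` [set x | s < u x]).
  rewrite hemi_areaE; congr area; apply/seteqP; split => x /= [Hx].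
    by rewrite patchE mem_set.
  by rewrite patchE mem_set.
split=> H s.
  exact: etrans (esym (E w s)) (etrans (esym (H s)) (E v s)).
exact: etrans (E v s) (etrans (esym (H s)) (esym (E w s))).
Qed.

Lemma Lpnorm_rst v : Lpnorm p v = ((\int[mu]_x (`|rst v x| `^ p)%:E) `^ p^-1)%E.
Proof.
rewrite /Lpnorm unlock; congr (_ `^ _)%E.
transitivity (\int[area]_(x in hemisphere) (`|rst v x| `^ p)%:E)%E.
  rewrite [RHS]integral_mkcond; apply: eq_integral => x _; rewrite patchE /=.
  by case: ifPn => // xH; rewrite patchE (negbTE xH) normr0 powR0// gt_eqF.
rewrite (@eq_measure_integral _ _ _ _ mu); last first.
  by move=> A mA AH; rewrite /= hemi_areaE setIidr.
rewrite integral_mkcond; apply: eq_integral => x _; rewrite patchE /=.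
by case: ifPn => // xH; rewrite patchE (negbTE xH) normr0 powR0// gt_eqF.
Qed.

Lemma inLp_rst v : inLp p v -> Lp (rst v).
Proof.
move=> [mv]; rewrite Lpnorm_rst => vy; have mrv := (measurable_rst v).1 mv.
split => //; apply/integrableP; split.
  by apply/measurable_EFinP; exact: measurable_norm_powR.
under eq_integral do rewrite abse_EFin ger0_norm ?powR_ge0//.
by apply: lty_poweRy vy; rewrite invr_eq0 gt_eqF.
Qed.

Lemma Lpnorm_rstE v : Lp (rst v) ->
  Lpnorm p v = ((\int[mu]_x (`|rst v x| `^ p)) `^ p^-1)%:E.
Proof.
move=> Lv; rewrite Lpnorm_rst -poweR_EFin; congr poweR.
by rewrite fineK//; apply: integrable_fin_num => //; exact: Lv.2.
Qed.

Lemma Lpnorm_lt v (r : R) : 0 < r -> Lp (rst v) ->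
  (Lpnorm p v < r%:E)%E = (\int[mu]_x (`|rst v x| `^ p) < r `^ p).
Proof.
move=> r0 Lv; rewrite Lpnorm_rstE// lte_fin.
have I0 : 0 <= \int[mu]_x (`|rst v x| `^ p).
  by apply: Rintegral_ge0 => x _; exact: powR_ge0.
have pn0 : p != 0 by exact: lt0r_neq0.
rewrite !ltNge; congr (~~ _); apply/idP/idP => h.
- rewrite -[leRHS](powRr1 I0) -(mulVf pn0) powRrM.
  by apply: ge0_ler_powR; rewrite ?nnegrE ?powR_ge0 ?(ltW p0) ?(ltW r0).
- rewrite -[leLHS](powRr1 (ltW r0)) -(mulfV pn0) powRrM.
  by apply: ge0_ler_powR; rewrite ?nnegrE ?powR_ge0 ?invr_ge0 ?(ltW p0).
Qed.

Lemma rstB v w x : rst (v \- w) x = rst v x - rst w x.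
Proof. by rewrite !patchE; case: ifP => //; rewrite subr0. Qed.

Let ae_height (x : R3 R) : {ae mu, forall y : R3 R, x.2 != y.2}.
Proof.
exists [set y | y.2 = x.2]; split.
- rewrite (_ : [set y | _] = (fun y : R3 R => y.2) @^-1` [set x.2])//.
  exact: (measurable_preimage measurable_coord3).
- by have := @area_level R x.2; rewrite -hemi_areaE.
- by move=> y /= /negP; rewrite negbK => /eqP.
Qed.

Lemma Lpfun_green_kernel x : Lpfun mu q (green_kernel x).
Proof.
have mk := measurable_green_kernel x; split => //.
apply: (le_integ_ae _ (Lpfun_green_bound q0 x).2); first exact: measurable_norm_powR.
apply: filterS (ae_height x) => y xy; rewrite ger0_norm ?powR_ge0//.
apply: ge0_ler_powR; rewrite ?nnegrE ?(ltW q0)//.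
rewrite [leRHS]ger0_norm ?green_bound_ge0//.
apply: (cvgr_to_le (cvg_norm (green_psum_cvg xy))).
by apply: nearW => n; exact: green_psum_le.
Qed.

Lemma potential_rst v x : Lp (rst v) -> hemisphere x ->
  potential mu green_kernel (rst v) x = greenop v x.
Proof.
move=> Lv Hx; rewrite /greenop Rintegral_hemi_area /potential.
have p2 : (pi *+ 2 : R) != 0 by rewrite mulrn_eq0/= gt_eqF ?pi_gt0.
have ik := Lpfun_mul p0 q0 pq (Lpfun_green_kernel x) Lv.
rewrite -[LHS](mulKf p2); congr (_ * _); rewrite -RintegralZl//.
apply: eq_Rintegral => y _; rewrite /green_kernel !patchE !indicE mem_set//.
case: ifP => Hy; last by rewrite !mulr0.
by rewrite !mulr1 -mulrA mulVKf.
Qed.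

Lemma energy_rst lambda v : Lp (rst v) ->
  energy v - lambda * impulse v = functional mu green_kernel height lambda (rst v).
Proof.
move=> Lv; rewrite /energy /impulse /functional /bienergy !Rintegral_hemi_area.
congr (_ * _ - _ * _); apply: eq_Rintegral => x _; rewrite !patchE ?indicE.
  case: ifPn => Hx; last by rewrite mulr0.
  by rewrite (potential_rst Lv) 1?mulrC// -inE.
by case: ifPn => Hx; [rewrite mulr1|rewrite !mulr0].
Qed.

Lemma level_rst v (s : R) : mu [set x | s < rst v x] = mu [set x | s < v x].
Proof.
rewrite /= !hemi_areaE; congr area; apply/seteqP; split => x /= [Hx];
  by rewrite patchE mem_set.
Qed.

(** Kernel and height vanish off the hemisphere. This reconciles maximality among functions on the
    whole space with maximality on the hemisphere, where values elsewhere are irrelevant. *)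
Lemma functional_rst lambda v : functional mu green_kernel height lambda (rst v) =
  functional mu green_kernel height lambda v.
Proof.
have kE x y : green_kernel x y * rst v y = green_kernel x y * v y.
  rewrite /green_kernel patchE (indicE _ hemisphere y); case: (y \in hemisphere) => //.
  by rewrite !mulr0 mul0r.
have pE x : potential mu green_kernel (rst v) x = potential mu green_kernel v x.
  by apply: eq_Rintegral => y _; exact: kE.
have p0E x : x \notin hemisphere -> potential mu green_kernel v x = 0.
  move=> /negbTE Hx; transitivity (\int[mu]_y (cst 0 (y : R3 R) : R)).
    apply: eq_Rintegral => y _; rewrite /green_kernel (indicE _ hemisphere x) Hx.
    by rewrite mulr0 !mul0r.
  by rewrite Rintegral_cst// mul0r.
congr (_ * _ - _ * _); apply: eq_Rintegral => x _.
  rewrite pE patchE; case: ifPn => // /p0E ->; by rewrite !mul0r.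
by rewrite patchE indicE; case: (x \in hemisphere) => //; rewrite !mulr0 mul0r.
Qed.

Lemma maximizers_maximal lambda v0 u : Lp (rst v0) ->
  maximizers (fun v => energy v - lambda * impulse v) (rearrangement v0) u ->
  [/\ measurable_fun setT (rst u), equidist mu (rst v0) (rst u) &
    maximal mu green_kernel height lambda (rst v0) (rst u)].
Proof.
move=> Lv0 [[mu_ v0u] umax]; have mru := (measurable_rst u).1 mu_.
have eu := (equidist_rst v0 u).2 v0u.
have Lu := equidist_Lpfun mru eu Lv0.
split => // v mv v0v; have mHv : measurable_fun hemisphere v by exact: measurable_funTS.
have ev : equidist mu (rst v0) (rst v).
  by move=> s; exact: etrans (v0v s) (esym (level_rst v s)).
have Lv := equidist_Lpfun ((measurable_rst v).1 mHv) ev Lv0.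
rewrite -[leLHS]functional_rst -(energy_rst lambda Lv) -(energy_rst lambda Lu).
by apply: umax; split; [exact: mHv|exact: (equidist_rst v0 v).1 ev].
Qed.

Lemma maximal_maximizers lambda v0 w : Lp (rst v0) -> measurable_fun setT w ->
  equidist mu (rst v0) w -> maximal mu green_kernel height lambda (rst v0) w ->
  maximizers (fun v => energy v - lambda * impulse v) (rearrangement v0) w.
Proof.
move=> Lv0 mw v0w wmax; have mHw : measurable_fun hemisphere w by exact: measurable_funTS.
have ew : equidist mu (rst v0) (rst w).
  by move=> s; exact: etrans (v0w s) (esym (level_rst w s)).
have Lw := equidist_Lpfun ((measurable_rst w).1 mHw) ew Lv0.
split; first by split; [exact: mHw|exact: (equidist_rst v0 w).1 ew].
move=> v [mv v0v]; have mrv := (measurable_rst v).1 mv.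
have ev := (equidist_rst v0 v).2 v0v.
have Lv := equidist_Lpfun mrv ev Lv0.
rewrite (energy_rst lambda Lv) (energy_rst lambda Lw) [leRHS]functional_rst.
exact: wmax mrv ev.
Qed.

End hemisphere_restriction.

Lemma cvg_harmonic_powR {R : realType} (p : R) : 1 < p ->
  (n.+1%:R^-1 : R) `^ p @[n --> \oo] --> 0.
Proof.
move=> p1; apply: (squeeze_cvgr _ (cvg_cst 0) (@cvg_harmonic R)).
apply: nearW => n; rewrite powR_ge0 /=.
have h0 : 0 <= (n.+1%:R^-1 : R) by rewrite invr_ge0.
rewrite -[leRHS](powRr1 h0); apply: ger_powR; last exact: ltW.
by rewrite invr_gt0 ltr0n invf_le1// ler1n.
Qed.

(** Solutions are reduced to their values at times 0 and [t_n], linked by the conservation laws. *)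
Lemma near_maximizer {R : realType} (p lambda eps : R) (v0 : R3 R -> R)
    (w0 wt u : nat -> R3 R -> R) :
  let M := maximizers (fun v => energy v - lambda * impulse v)
             (rearrangement v0) in
  1 < p -> inLp p v0 -> 0 < eps ->
  (forall n, inLp p (w0 n)) -> (forall n, inLp p (wt n)) ->
  (forall n, energy (wt n) = energy (w0 n)) ->
  (forall n, impulse (wt n) = impulse (w0 n)) ->
  (forall n, rearrangement (w0 n) (wt n)) ->
  (forall n, M (u n)) ->
  (forall n, (Lpnorm p (w0 n \- u n)%R < (n.+1%:R^-1)%:E)%E) ->
  exists n w, M w /\ (Lpnorm p (wt n \- w)%R < eps%:E)%E.
Proof.
move=> M p1 hv0 eps0 hw0 hwt ewt iwt rwt Mu un.
have p0 : 0 < p by exact: lt_trans p1.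
pose q := p / (p - 1).
have q0 : 0 < q by rewrite divr_gt0// subr_gt0.
have pq : p^-1 + q^-1 = 1.
  by rewrite /q; field; rewrite !gt_eqF// subr_gt0.
have Lv0 := inLp_rst p0 hv0.
have Lw0 n := inLp_rst p0 (hw0 n); have Lwt n := inLp_rst p0 (hwt n).
have Mu' n := maximizers_maximal p0 q0 pq Lv0 (Mu n).
have Lu n : Lpfun (@hemi_area R) p (u n \_ hemisphere).
  by have [mu_ eu _] := Mu' n; exact: equidist_Lpfun mu_ eu Lv0.
have Lwu n : Lpfun (@hemi_area R) p ((w0 n \- u n) \_ hemisphere).
  rewrite (_ : _ \_ _ = w0 n \_ hemisphere \- u n \_ hemisphere).
    exact: LpfunB.
  by apply/funext => x; exact: rstB.
have wuE n : \int[@hemi_area R]_x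
    (`|(w0 n \_ hemisphere) x - (u n \_ hemisphere) x| `^ p) < n.+1%:R^-1 `^ p.
  have n0 : 0 < n.+1%:R^-1 :> R by rewrite invr_gt0.
  have := un n; rewrite (Lpnorm_lt p0 n0 (Lwu n)).
  by under eq_Rintegral do rewrite rstB.
have sc i : 0 < green_coef i :> R -> \forall n \near \oo, i \in green_index n.
  rewrite green_coef_gt0 => /and3P[_ jk ak]; exists i.1.1.+1 => // n /= kn.
  by apply/green_indexP; split.
have h0 (t : R) : hemi_area [set x : R3 R | x.2 = t] = 0%E.
  by rewrite hemi_areaE; exact: area_level.
have ml : measurable_fun setT (fun x : R3 R => x.2 * \1_hemisphere x).
  apply: measurable_funM; first exact: measurable_coord3.
  exact: (measurable_indic measurable_hemisphere).
have l1 (x : R3 R) : `|x.2 * \1_hemisphere x| <= 1.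
  rewrite normrM indicE; case: (boolP (x \in hemisphere)) => [|_].
    by rewrite inE normr1 mulr1 => -[/coord_sphere[]].
  by rewrite normr0 mulr0.
have dense (z : nat -> R3 R -> R) : (forall n, Lpfun (@hemi_area R) p (z n)) ->
    (exists C : R, forall n, \int[@hemi_area R]_x (`|z n x| `^ p) <= C) ->
    (forall i, 0 < green_coef i :> R ->
      moment (@hemi_area R) green_monomial i (z n) @[n --> \oo] --> 0) ->
    forall (f : R3 R -> R) (C : R), measurable_fun setT f ->
      (forall x, `|f x| <= C) ->
      \int[@hemi_area R]_x (f x * z n x) @[n --> \oo] --> 0.
  by move=> Lz [K zK]; exact: (green_moments_dense p0 q0 pq Lz zK).
have eqm n : equidist (@hemi_area R) (wt n \_ hemisphere) (w0 n \_ hemisphere).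
  by apply/equidist_rst => s; rewrite (rwt n).2.
have eqF n : functional (@hemi_area R) green_kernel (fun x => x.2 * \1_hemisphere x)
    lambda (wt n \_ hemisphere) = functional (@hemi_area R) green_kernel
    (fun x => x.2 * \1_hemisphere x) lambda (w0 n \_ hemisphere).
  by rewrite -!(energy_rst p0 q0 pq) ?ewt ?iwt.
have wu1 n : \int[@hemi_area R]_x
    (`|(w0 n \_ hemisphere) x - (u n \_ hemisphere) x| `^ p) <= 1.
  apply: (le_trans (ltW (wuE n))).
  apply: (@le_trans _ _ (1 `^ p)); last by rewrite powR1.
  by apply: ge0_ler_powR; rewrite ?nnegrE ?invr_ge0// ?(ltW p0)// invf_le1// ler1n.
have wu0 : \int[@hemi_area R]_x
    (`|(w0 n \_ hemisphere) x - (u n \_ hemisphere) x| `^ p) @[n --> \oo] --> 0.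
  apply: (squeeze_cvgr _ (cvg_cst 0) (cvg_harmonic_powR p1)); apply: nearW => n.
  by rewrite (ltW (wuE n)) andbT; apply: Rintegral_ge0 => x _; exact: powR_ge0.
have mu_ n : measurable_fun setT (u n \_ hemisphere) by have [] := Mu' n.
have eu n : equidist (@hemi_area R) (v0 \_ hemisphere) (u n \_ hemisphere).
  by have [] := Mu' n.
have umax n : maximal (@hemi_area R) green_kernel (fun x => x.2 * \1_hemisphere x)
    lambda (v0 \_ hemisphere) (u n \_ hemisphere) by have [] := Mu' n.
have [w [mw v0w wmax near_w]] := maximizing_sequence_cvg p0 q0 pq
  (@green_coef_ge0 R) (@measurable_green_monomial R) (@green_monomial_le1 R)
  sc measurable_coord3 h0 (@measurable_green_kernel R) (Lpfun_green_bound q0)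
  (green_bound_Rintegral_le q0) (fun n x y => @green_psum_le R q q0 n x y)
  (@green_psum_cvg R) ml l1 dense Lv0 Lwt Lw0 mu_ eu umax eqm eqF wu1 wu0.
have Mw : M w by exact: (maximal_maximizers p0 q0 pq Lv0 mw v0w wmax).
have epsp : 0 < eps `^ p by exact: powR_gt0.
have [n wn] := near_w _ epsp; exists n, w; split => //.
have Lw : Lpfun (@hemi_area R) p w by exact: equidist_Lpfun mw v0w Lv0.
have Lrw : Lpfun (@hemi_area R) p (w \_ hemisphere).
  have [[mHw _] _] := Mw; apply: (equidist_Lpfun _ _ Lv0).
    exact: (measurable_rst w).1.
  by move=> s; exact: etrans (v0w s) (esym (level_rst w s)).
have E : (wt n \- w) \_ hemisphere = wt n \_ hemisphere \- w \_ hemisphere.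
  by apply/funext => x; exact: rstB.
have Ld : Lpfun (@hemi_area R) p ((wt n \- w) \_ hemisphere).
  by rewrite E; exact: LpfunB.
rewrite (Lpnorm_lt p0 eps0 Ld); apply: le_lt_trans wn.
(* [w] need not vanish off the hemisphere; restricting it makes the integrand 0 there. *)
apply: le_Rint; [exact: Ld.2|exact: (LpfunB p0 (Lwt n) Lw).2|move=> x].
rewrite rstB !patchE; case: ifPn => // _.
by rewrite subrr normr0 powR0 ?powR_ge0// gt_eqF.
Qed.

Theorem theorem1p3 (R : realType) (p : R) (hp : 1 < p)
    (v0 : R3 R -> R) (hv0 : inLp p v0) (lambda : R)
    (M : set (R3 R -> R))
    (hM : M = maximizers (fun v => energy v - lambda * impulse v)
                         (rearrangement v0)) :
  forall eps : R, 0 < eps ->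
  exists delta : R, 0 < delta /\
    forall w : R -> R3 R -> R, smooth_solution p w ->
      (Lpdist p (w 0%R) M < delta%:E)%E ->
      forall t : R, (Lpdist p (w t) M < eps%:E)%E.
Proof.
move=> eps eps0; apply: contrapT => unstable.
(* The triple holds the values of a solution at time 0 and at a bad time, and a maximizer close to
   the former, for [delta = 1 / (n + 1)]. *)
have bad n : exists a : (R3 R -> R) * (R3 R -> R) * (R3 R -> R),
    [/\ [/\ inLp p a.1.1, inLp p a.1.2, energy a.1.2 = energy a.1.1,
        impulse a.1.2 = impulse a.1.1 & rearrangement a.1.1 a.1.2],
      M a.2, (Lpnorm p (a.1.1 \- a.2)%R < (n.+1%:R^-1)%:E)%E &
      ~ (Lpdist p a.1.2 M < eps%:E)%E].
  apply: contrapT => good; apply: unstable; exists n.+1%:R^-1.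
  split; first by rewrite invr_gt0.
  move=> w sw wM t; apply: contrapT => wt; apply: good.
  (* A distance below [delta] yields an actual maximizer; for empty [M] the distance is [+oo] and
     this case does not arise. *)
  have [_ [u Mu <-] wu] := ereal_inf_lt wM.
  exists (w 0, w t, u); split; [|exact: Mu|exact: wu|exact: wt].
  split; [exact: smooth_solution_Lp sw 0|exact: smooth_solution_Lp sw t| | |].
  - exact: smooth_solution_energy sw t.
  - exact: smooth_solution_impulse sw t.
  - exact: smooth_solution_rearrangement sw t.
have [a aP] := choice bad.
have [n [w [Mw wn]]] : exists n w, M w /\ (Lpnorm p ((a n).1.2 \- w)%R < eps%:E)%E.
  rewrite hM; apply: (near_maximizer (w0 := fun n => (a n).1.1)
    (wt := fun n => (a n).1.2) (u := fun n => (a n).2) hp hv0 eps0) => n;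
    have [[? ? ? ? ?]] := aP n; by rewrite ?hM.
have [_ _ _] := aP n; apply; apply: le_lt_trans wn.
by apply: ereal_inf_lbound; exists w.
Qed.
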